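(* Let $\ell$ be the quantum characteristic of $(K,q)$. Suppose that $\ell>0$ and that the order of $q$ is odd if $q\neq\pm1$. Let $\lambda_0,\lambda_1\in X$ and suppose that $\lambda_0$ is restricted, i.e. $0\le\langle\lambda_0,\alpha^\vee\rangle<\ell$ for all $\alpha\in\Pi$. Then there exist $E$- and $F$-operators on the $X$-graded space $S(\lambda_0)\otimes_K S(\ell\lambda_1)$ such that we obtain an object in $\mathcal X$ with $$S(\lambda_0)\otimes S(\ell\lambda_1)\cong S(\lambda_0+\ell\lambda_1).$$
   Context: $R$ is a simply laced root system (i.e. $\langle\alpha,\beta^\vee\rangle\in\{0,-1\}$ for $\alpha\ne\beta$ in the basis) with basis $\Pi$ and weight lattice $X$; $\alpha^\vee$ is the coroot of $\alpha$. Partial order on $X$: $\mu\le\lambda$ iff $\lambda-\mu$ is a (possibly empty) sum of elements of $\Pi$. A subset $T\subset X$ is quasi-bounded (from above) if for all $\mu\in X$ the set $\{\lambda\in T\mid\mu\le\lambda\}$ is finite. $K$ is a field and $q\in K^\times$. Quantum numbers: in $\mathbb Z[v,v^{-1}]$ set $[n]=\frac{v^n-v^{-n}}{v-v^{-1}}$ for $n\in\mathbb Z$, and for $a,b\in\mathbb Z$ let ${a\brack b}=\frac{[a][a-1]\cdots[a-b+1]}{[1][2]\cdots[b]}\in\mathbb Z[v,v^{-1}]$ if $b>0$, ${a\brack 0}=1$, and ${a\brack b}=0$ if $b<0$. These are regarded as elements of $K$ via $v\mapsto q$. The quantum characteristic $\ell$ of $(K,q)$ is $0$ if $[n]\ne0$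 in $K$ for all $n\neq0$, and otherwise the smallest positive integer $\ell$ with $[\ell]=0$ in $K$. The category $\mathcal X=\mathcal X_{(K,q)}$: objects are $X$-graded $K$-vector spaces $M=\bigoplus_{\mu\in X}M_\mu$ with $K$-linear operators $E_{\alpha,n}=E_{\mu,\alpha,n}\colon M_\mu\to M_{\mu+n\alpha}$ and $F_{\alpha,n}=F_{\mu,\alpha,n}\colon M_{\mu+n\alpha}\to M_\mu$ for all $\mu\in X$, $\alpha\in\Pi$, $n>0$ (with $E_{\mu,\alpha,0}=F_{\mu,\alpha,0}=\operatorname{id}_{M_\mu}$ and $E_{\mu,\alpha,n}=F_{\mu,\alpha,n}=0$ for $n<0$), such that: (X1) The set of $\mu$ with $M_\mu\ne0$ is quasi-bounded from above and each $M_\mu$ is finite dimensional. (X2) For all $\mu\in X$, $\alpha,\beta\in\Pi$, $m,n>0$ and $v\in M_{\mu+n\beta}$: $E_{\alpha,m}F_{\beta,n}(v)=F_{\beta,n}E_{\alpha,m}(v)$ if $\alpha\ne\beta$, and $E_{\alpha,m}F_{\alpha,n}(v)=\sum_{r\in\mathbb Z}{\langle\mu,\alpha^\vee\rangle+m+n\brack r}F_{\alpha,n-r}E_{\alpha,m-r}(v)$ if $\alpha=\beta$. (X3) For all $\mu\in X$: $M_\mu=\ker E_\mu\oplus\operatorname{im}F_\mu$, where $M_{\delta\mu}:=\bigoplus_{\alpha\in\Pi,n>0}M_{\mu+n\alpha}$, $E_\mu\colon M_\mu\to M_{\delta\mu}$ has components $E_{\mu,\alpha,n}$, and $F_\mu\colon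 M_{\delta\mu}\to M_\mu$ is $(v_{\mu+n\alpha})\mapsto\sum_{\alpha,n}F_{\mu,\alpha,n}(v_{\mu+n\alpha})$. Morphisms are grading-preserving $K$-linear maps commuting with all $E$- and $F$-operators. For $\lambda\in X$, $S(\lambda)$ denotes the up to isomorphism unique object of $\mathcal X$ that is indecomposable, with $\dim_KS(\lambda)_\lambda=1$, and such that $S(\lambda)_\mu\neq0$ implies $\mu\le\lambda$. The $X$-grading on $S(\lambda_0)\otimes_KS(\ell\lambda_1)$ is the tensor product grading: its component of degree $\mu$ is $\bigoplus_{\nu+\nu'=\mu}S(\lambda_0)_\nu\otimes_KS(\ell\lambda_1)_{\nu'}$ (sum over all $\nu,\nu'\in X$ with $\nu+\nu'=\mu$). *)

(* Defs.v *)
From HB Require Import structures.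
From mathcomp Require Import all_boot all_order all_algebra.
From mathcomp Require Import all_classical all_reals.

Set Implicit Arguments.
Unset Strict Implicit.
Unset Printing Implicit Defensive.

Import Order.TTheory GRing.Theory Num.Theory.

Local Open Scope ring_scope.
Local Open Scope classical_set_scope.
Local Open Scope quotient_scope.

(* A root system is finite, crystallographic and reduced, and spans [V]. The
   value [coroot a x] is <x, a^vee>; it is meaningful only for [a \in roots]. *)
Record root_system (R : realType) (V : vectType R) := RootSystem {
  roots : seq V;
  coroot : V -> 'Hom(V, R^o);
  root_neq0 : 0 \notin roots;
  root_span : <<roots>>%VS = fullv;
  coroot_self : {in roots, forall a, coroot a a = 2};
  coroot_refl : {in roots &, forall a b, b - coroot a b *: a \in roots};
  coroot_int : {in roots &, forall a b, (coroot a b : R) \is a Num.int};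
  root_reduced : {in roots, forall a (c : R),
    c *: a \in roots -> c = 1 \/ c = -1}
}.

Section Weights.
Variables (R : realType) (V : vectType R) (Phi : root_system V).

Record base := Base {
  rank : nat;
  simple : rank.-tuple V;
  simple_root : {subset simple <= roots Phi};
  simple_basis : basis_of fullv simple;
  root_comb : {in roots Phi, forall b, exists c : 'I_rank -> nat,
    b = \sum_i tnth simple i *+ c i \/ b = - \sum_i tnth simple i *+ c i}
}.

Definition simply_laced (Pi : base) : Prop :=
  forall i j : 'I_(rank Pi), i != j ->
    coroot Phi (tnth (simple Pi) j) (tnth (simple Pi) i) = 0 \/
    coroot Phi (tnth (simple Pi) j) (tnth (simple Pi) i) = -1.

Definition is_weight : pred V :=
  fun x => all (fun a => (coroot Phi a x : R) \is a Num.int) (roots Phi).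

Fact is_weight_zmod_closed : zmod_closed is_weight.
Proof.
split=> [|x y /allP xP /allP yP]; apply/allP => a aPhi.
  by rewrite linear0 rpred0.
by rewrite linearB rpredB ?xP ?yP.
Qed.
HB.instance Definition _ :=
  GRing.isZmodClosed.Build V is_weight is_weight_zmod_closed.

Record weight := Weight { wval :> V; wvalP : wval \in is_weight }.
HB.instance Definition _ := [isSub for wval].
HB.instance Definition _ := [Choice of weight by <:].
HB.instance Definition _ := [SubChoice_isSubZmodule of weight by <:].

Section Base.
Variable Pi : base.

Fact simple_is_weight (i : 'I_(rank Pi)) : tnth (simple Pi) i \in is_weight.
Proof.
by apply/allP => a aPhi; apply: coroot_int => //; apply/simple_root/mem_tnth.
Qed.

Definition srt (i : 'I_(rank Pi)) : weight := Weight (simple_is_weight i).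

(* <mu, alpha_i^vee> is an integer, so taking the floor loses nothing. *)
Definition pairing (mu : weight) (i : 'I_(rank Pi)) : int :=
  Num.floor (coroot Phi (wval (srt i)) (wval mu) : R).

Definition wle (mu la : weight) : Prop :=
  exists c : 'I_(rank Pi) -> nat, la - mu = \sum_i srt i *+ c i.

Definition quasi_bounded (T : set weight) : Prop :=
  forall mu, finite_set [set la | T la /\ wle mu la].

End Base.
End Weights.

(* Quantum numbers and binomials are formed in the fraction field of Z[v]; they
   lie in the subring Z[v, v^-1], where v may be specialised to q != 0. *)
Definition qfrac : fieldType := {fraction {poly int}}.

Local Notation tofrac := (@FracField.tofrac {poly int}).

Definition qv : qfrac := tofrac 'X.

Definition qnum (n : int) : qfrac := (qv ^ n - qv ^ (- n)) / (qv - qv^-1).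

Definition qbinom (a b : int) : qfrac :=
  match b with
  | Posz k => (\prod_(i < k) qnum (a - i%:Z)) / (\prod_(i < k) qnum i.+1%:Z)
  | Negz _ => 0
  end.

Definition specialize (K : fieldType) (q : K) (f : qfrac) : K :=
  xget 0 [set x | exists (p : {poly int}) (k : nat),
    f = tofrac p / qv ^+ k /\ x = (map_poly intr p).[q] / q ^+ k].

Definition quantum_char (K : fieldType) (q : K) (l : nat) : Prop :=
  (l = 0%N /\ forall n : int, n != 0 -> specialize q (qnum n) != 0) \/
  [/\ (0 < l)%N, specialize q (qnum l%:Z) = 0 &
      forall m : nat, (0 < m < l)%N -> specialize q (qnum m%:Z) != 0].

Section Tensor.
Variables (K : fieldType) (U V : lmodType K).

(* A list of pairs (u_i, v_i) stands for the tensor sum_i u_i (x) v_i. *)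
Definition tsum_eval (W : lmodType K) (b : {bilinear U -> V -> W})
    (s : seq (U * V)) : W :=
  \sum_(p <- s) b p.1 p.2.

(* Two such lists present the same tensor iff no bilinear map tells them
   apart. *)
Definition tsum_eq (s t : seq (U * V)) : bool :=
  `[< forall (W : lmodType K) (b : {bilinear U -> V -> W}),
      tsum_eval b s = tsum_eval b t >].

Fact tsum_eq_refl : reflexive tsum_eq.
Proof. by move=> s; apply/asboolP. Qed.

Fact tsum_eq_sym : symmetric tsum_eq.
Proof.
by move=> s t; apply/asboolP/asboolP => st W b; rewrite st.
Qed.

Fact tsum_eq_trans : transitive tsum_eq.
Proof.
by move=> t s u /asboolP st /asboolP tu; apply/asboolP => W b; rewrite st tu.
Qed.

Canonical tsum_equiv := EquivRel tsum_eq tsum_eq_refl tsum_eq_sym tsum_eq_trans.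

Definition tensor := {eq_quot tsum_equiv}.
HB.instance Definition _ := Choice.on tensor.
HB.instance Definition _ := EqQuotient.on tensor.

Definition tens (u : U) (v : V) : tensor := \pi_tensor [:: (u, v)].

Definition tensor_scale_seq (c : K) (s : seq (U * V)) : seq (U * V) :=
  [seq (c *: p.1, p.2) | p <- s].

Definition tensor_zero : tensor := \pi_tensor [::].
Definition tensor_add (x y : tensor) : tensor := \pi_tensor (repr x ++ repr y).
Definition tensor_scale (c : K) (x : tensor) : tensor :=
  \pi_tensor (tensor_scale_seq c (repr x)).
Definition tensor_opp (x : tensor) : tensor := tensor_scale (-1) x.

Definition tensor_lift (W : lmodType K) (b : {bilinear U -> V -> W})
    (x : tensor) : W := tsum_eval b (repr x).

Fact tensor_lift_pi (W : lmodType K) (b : {bilinear U -> V -> W}) s :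
  tensor_lift b (\pi_tensor s) = tsum_eval b s.
Proof.
have /eqmodP/asboolP : repr (\pi_tensor s) = s %[mod tensor] by rewrite reprK.
exact.
Qed.

Fact tensor_ext (x y : tensor) :
  (forall (W : lmodType K) (b : {bilinear U -> V -> W}),
     tensor_lift b x = tensor_lift b y) -> x = y.
Proof.
move=> xy; rewrite -[x]reprK -[y]reprK; apply/eqmodP/asboolP => W b.
exact: xy.
Qed.

Fact tensor_lift0 (W : lmodType K) (b : {bilinear U -> V -> W}) :
  tensor_lift b tensor_zero = 0.
Proof. by rewrite tensor_lift_pi /tsum_eval big_nil. Qed.

Fact tensor_liftD (W : lmodType K) (b : {bilinear U -> V -> W}) x y :
  tensor_lift b (tensor_add x y) = tensor_lift b x + tensor_lift b y.
Proof. by rewrite tensor_lift_pi /tsum_eval big_cat. Qed.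

Fact tensor_liftZ (W : lmodType K) (b : {bilinear U -> V -> W}) c x :
  tensor_lift b (tensor_scale c x) = c *: tensor_lift b x.
Proof.
rewrite tensor_lift_pi /tsum_eval big_map scaler_sumr.
by apply: eq_bigr => p _; rewrite linearZl_LR.
Qed.

Let liftE := (tensor_lift0, tensor_liftD, tensor_liftZ).

Fact tensor_addA : associative tensor_add.
Proof. by move=> x y z; apply: tensor_ext => W b; rewrite !liftE addrA. Qed.
Fact tensor_addC : commutative tensor_add.
Proof. by move=> x y; apply: tensor_ext => W b; rewrite !liftE addrC. Qed.
Fact tensor_add0 : left_id tensor_zero tensor_add.
Proof. by move=> x; apply: tensor_ext => W b; rewrite !liftE add0r. Qed.
Fact tensor_addN : left_inverse tensor_zero tensor_opp tensor_add.
Proof.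
by move=> x; apply: tensor_ext => W b; rewrite !liftE scaleN1r addNr.
Qed.
HB.instance Definition _ := GRing.isZmodule.Build tensor
  tensor_addA tensor_addC tensor_add0 tensor_addN.

Fact tensor_scaleA c d x :
  tensor_scale c (tensor_scale d x) = tensor_scale (c * d) x.
Proof. by apply: tensor_ext => W b; rewrite !liftE scalerA. Qed.
Fact tensor_scale1 : left_id 1 tensor_scale.
Proof. by move=> x; apply: tensor_ext => W b; rewrite !liftE scale1r. Qed.
Fact tensor_scaleDr : right_distributive tensor_scale +%R.
Proof. by move=> c x y; apply: tensor_ext => W b; rewrite !liftE scalerDr. Qed.
Fact tensor_scaleDl x : {morph tensor_scale^~ x : c d / c + d}.
Proof. by move=> c d; apply: tensor_ext => W b; rewrite !liftE scalerDl. Qed.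
HB.instance Definition _ := GRing.Zmodule_isLmodule.Build K tensor
  tensor_scaleA tensor_scale1 tensor_scaleDr tensor_scaleDl.

Fact tens_is_bilinear : bilinear_for *:%R *:%R tens.
Proof.
split=> [v c u u'|u c v v']; apply: tensor_ext => W b;
  rewrite tensor_liftD tensor_liftZ !tensor_lift_pi /tsum_eval !big_seq1 /=.
  by rewrite linearPl.
by rewrite linearPr.
Qed.

Fact tensor_lift_linear (W : lmodType K) (b : {bilinear U -> V -> W}) :
  linear (tensor_lift b).
Proof. by move=> c x y; rewrite tensor_liftD tensor_liftZ. Qed.

Fact tensor_lift_tens (W : lmodType K) (b : {bilinear U -> V -> W}) u v :
  tensor_lift b (tens u v) = b u v.
Proof. by rewrite tensor_lift_pi /tsum_eval big_seq1. Qed.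

Fact tensor_sum (x : tensor) : x = \sum_(p <- repr x) tens p.1 p.2.
Proof.
rewrite -{1}[x]reprK; elim: (repr x) => [|p s IHs]; first by rewrite big_nil.
rewrite big_cons -IHs; apply: tensor_ext => W b.
by rewrite tensor_liftD !tensor_lift_pi /tsum_eval big_cons big_seq1.
Qed.

End Tensor.

Section DirectSum.
Variables (K : fieldType) (I : choiceType) (V : I -> lmodType K).

Record dirsum := Dirsum {
  dsval :> forall i, V i;
  dsvalP : finite_set [set i | dsval i != 0]
}.
HB.instance Definition _ := gen_eqMixin dirsum.
HB.instance Definition _ := gen_choiceMixin dirsum.

Fact dirsum_ext (f g : dirsum) : (forall i, f i = g i) -> f = g.
Proof.
case: f g => [f fP] [g gP] /= fg.
have {}fg : f = g by apply: functional_extensionality_dep.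
by case: _ / fg gP => gP; congr Dirsum; apply: Prop_irrelevance.
Qed.

Fact dirsum_zeroP : finite_set [set i | (fun i => 0 : V i) i != 0].
Proof.
by rewrite (_ : [set i | _] = set0) //; apply/seteqP; split=> i //=; rewrite eqxx.
Qed.
Fact dirsum_addP (f g : dirsum) : finite_set [set i | f i + g i != 0].
Proof.
apply: (@sub_finite_set _ _ ([set i | f i != 0] `|` [set i | g i != 0])).
  move=> i /=; case: (eqVneq (f i) 0) => [->|]; last by left.
  by rewrite add0r; right.
by rewrite finite_setU; split; exact: dsvalP.
Qed.
Fact dirsum_scaleP (c : K) (f : dirsum) : finite_set [set i | c *: f i != 0].
Proof.
apply: sub_finite_set (dsvalP f) => i /=.
by apply: contra_neq => ->; rewrite scaler0.
Qed.

Definition dirsum_zero := Dirsum dirsum_zeroP.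
Definition dirsum_add (f g : dirsum) := Dirsum (dirsum_addP f g).
Definition dirsum_scale (c : K) (f : dirsum) := Dirsum (dirsum_scaleP c f).
Definition dirsum_opp (f : dirsum) := dirsum_scale (-1) f.

Fact dirsum_addA : associative dirsum_add.
Proof. by move=> f g h; apply: dirsum_ext => i /=; rewrite addrA. Qed.
Fact dirsum_addC : commutative dirsum_add.
Proof. by move=> f g; apply: dirsum_ext => i /=; rewrite addrC. Qed.
Fact dirsum_add0 : left_id dirsum_zero dirsum_add.
Proof. by move=> f; apply: dirsum_ext => i /=; rewrite add0r. Qed.
Fact dirsum_addN : left_inverse dirsum_zero dirsum_opp dirsum_add.
Proof. by move=> f; apply: dirsum_ext => i /=; rewrite scaleN1r addNr. Qed.
HB.instance Definition _ := GRing.isZmodule.Build dirsum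
  dirsum_addA dirsum_addC dirsum_add0 dirsum_addN.

Fact dirsum_scaleA c d f :
  dirsum_scale c (dirsum_scale d f) = dirsum_scale (c * d) f.
Proof. by apply: dirsum_ext => i /=; rewrite scalerA. Qed.
Fact dirsum_scale1 : left_id 1 dirsum_scale.
Proof. by move=> f; apply: dirsum_ext => i /=; rewrite scale1r. Qed.
Fact dirsum_scaleDr : right_distributive dirsum_scale +%R.
Proof. by move=> c f g; apply: dirsum_ext => i /=; rewrite scalerDr. Qed.
Fact dirsum_scaleDl f : {morph dirsum_scale^~ f : c d / c + d}.
Proof. by move=> c d; apply: dirsum_ext => i /=; rewrite scalerDl. Qed.
HB.instance Definition _ := GRing.Zmodule_isLmodule.Build K dirsum
  dirsum_scaleA dirsum_scale1 dirsum_scaleDr dirsum_scaleDl.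

End DirectSum.

Section Category.
Variables (R : realType) (V : vectType R) (Phi : root_system V).
Variables (Pi : base Phi) (K : fieldType) (q : K).

Local Notation X := (weight Phi).

Definition graded := X -> lmodType K.

(* The degree [mu] part is the direct sum over all pairs of total degree [mu]. *)
Definition graded_tensor (M N : graded) : graded := fun mu =>
  dirsum (fun p : {p : X * X | p.1 + p.2 == mu} =>
            tensor (M (val p).1) (N (val p).2)).

Definition E_ops (M : graded) : Type :=
  forall (mu : X) (i : 'I_(rank Pi)) (n : nat),
    {linear M mu -> M (mu + srt i *+ n)}.

Definition F_ops (M : graded) : Type :=
  forall (mu : X) (i : 'I_(rank Pi)) (n : nat),
    {linear M (mu + srt i *+ n) -> M mu}.

Record EFspace := EFSpace {
  component :> X -> lmodType K;
  opE : E_ops component;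
  opF : F_ops component
}.
Arguments opE M mu i n : rename.
Arguments opF M mu i n : rename.

(* The identity M_mu = M_nu when [mu] and [nu] are equal weights; it only serves
   to compare components whose degrees are equal but not convertible. *)
Definition regrade (M : graded) (mu nu : X) (v : M mu) : M nu :=
  match mu =P nu with
  | ReflectT e => eq_rect mu (fun k => M k : Type) v nu e
  | ReflectF _ => 0
  end.
Arguments regrade {M mu nu} v.

Definition nonzero (M : graded) (mu : X) : Prop := exists v : M mu, v != 0.

Definition findim (W : lmodType K) : Prop :=
  exists s : seq W, forall w : W, exists c : 'I_(size s) -> K,
    w = \sum_i c i *: s`_i.

(* Operators with index [0] are identities and those with negative index vanish. *)
Definition axX0 (M : EFspace) : Prop :=
  (forall mu i (v : M mu), opE M mu i 0%N v = regrade v) /\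
  (forall mu i (v : M (mu + srt i *+ 0%N)), opF M mu i 0%N v = regrade v).

Definition axX1 (M : EFspace) : Prop :=
  quasi_bounded Pi [set mu | nonzero M mu] /\ forall mu, findim (M mu).

(* The sum over all integers [r] reduces to 0 <= r <= min(m, n): the binomial
   vanishes for r < 0, and one of the operators vanishes for r > min(m, n). *)
Definition axX2 (M : EFspace) : Prop :=
  forall (mu : X) (i j : 'I_(rank Pi)) (m n : nat), (0 < m)%N -> (0 < n)%N ->
  (i != j -> forall v : M (mu + srt j *+ n),
     opE M mu i m (opF M mu j n v) =
     opF M (mu + srt i *+ m) j n
       (regrade (opE M (mu + srt j *+ n) i m v))) /\
  (forall v : M (mu + srt i *+ n),
     opE M mu i m (opF M mu i n v) =
     \sum_(r < (minn m n).+1)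
       specialize q (qbinom (pairing mu i + m%:Z + n%:Z) r%:Z) *:
       opF M (mu + srt i *+ m) i (n - r)%N
         (regrade (opE M (mu + srt i *+ n) i (m - r)%N v))).

Definition kerE (M : EFspace) (mu : X) (v : M mu) : Prop :=
  forall i n, (0 < n)%N -> opE M mu i n v = 0.

(* An element of the direct sum over all [i] and [n > 0] of M_(mu + n alpha_i)
   is a family [w] of which only the members with [n <= N] matter. *)
Definition imF (M : EFspace) (mu : X) (v : M mu) : Prop :=
  exists (N : nat) (w : forall i n, M (mu + srt i *+ n)),
    v = \sum_(i < rank Pi) \sum_(1 <= n < N.+1) opF M mu i n (w i n).

Definition axX3 (M : EFspace) : Prop :=
  forall mu,
  (forall v : M mu, exists k f : M mu, [/\ kerE k, imF f & v = k + f]) /\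
  (forall v : M mu, kerE v -> imF v -> v = 0).

Definition in_X (M : EFspace) : Prop :=
  [/\ axX0 M, axX1 M, axX2 M & axX3 M].

Definition is_hom (M N : EFspace) (f : forall mu, {linear M mu -> N mu}) : Prop :=
  (forall mu i n (v : M mu), f _ (opE M mu i n v) = opE N mu i n (f _ v)) /\
  (forall mu i n (v : M (mu + srt i *+ n)),
     f _ (opF M mu i n v) = opF N mu i n (f _ v)).

Definition isomorphic (M N : EFspace) : Prop :=
  exists (f : forall mu, {linear M mu -> N mu}),
    is_hom f /\ forall mu, bijective (f mu).

Section BinarySum.
Variables M N : EFspace.

Definition sum_graded : graded := fun mu => (M mu * N mu)%type.

Definition sum_opE_fun mu i n (v : sum_graded mu) :
    sum_graded (mu + srt i *+ n) :=
  (opE M mu i n v.1, opE N mu i n v.2).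

Fact sum_opE_linear mu i n : linear (@sum_opE_fun mu i n).
Proof. by move=> c x y; rewrite /sum_opE_fun /= !linearP. Qed.
HB.instance Definition _ mu i n :=
  GRing.isLinear.Build K (sum_graded mu) (sum_graded (mu + srt i *+ n)) *:%R
    (@sum_opE_fun mu i n) (@sum_opE_linear mu i n).

Definition sum_opF_fun mu i n (v : sum_graded (mu + srt i *+ n)) :
    sum_graded mu :=
  (opF M mu i n v.1, opF N mu i n v.2).

Fact sum_opF_linear mu i n : linear (@sum_opF_fun mu i n).
Proof. by move=> c x y; rewrite /sum_opF_fun /= !linearP. Qed.
HB.instance Definition _ mu i n :=
  GRing.isLinear.Build K (sum_graded (mu + srt i *+ n)) (sum_graded mu) *:%R
    (@sum_opF_fun mu i n) (@sum_opF_linear mu i n).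

Definition EFsum : EFspace :=
  @EFSpace sum_graded (fun mu i n => @sum_opE_fun mu i n)
    (fun mu i n => @sum_opF_fun mu i n).

End BinarySum.

Definition is_zero (M : EFspace) : Prop := forall mu (v : M mu), v = 0.

Definition indecomposable (M : EFspace) : Prop :=
  ~ is_zero M /\
  forall A B : EFspace, in_X A -> in_X B -> isomorphic M (EFsum A B) ->
    is_zero A \/ is_zero B.

(* [is_S la M] says that [M] is the object S(la), unique up to isomorphism. *)
Definition is_S (la : X) (M : EFspace) : Prop :=
  [/\ in_X M,
      indecomposable M,
      (exists2 v : M la, v != 0 & forall w : M la, exists c : K, w = c *: v) &
      forall mu, nonzero M mu -> wle Pi mu la].

End Category.

(* Main.v *)
From HB Require Import structures.
Require Import Defs.
From mathcomp Require Import all_boot all_order all_algebra.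
From mathcomp Require Import all_classical all_reals.
From mathcomp Require Import ring lra zify.

(** The proof follows the idea of Steinberg's tensor product theorem.  Let [A] be
    S(la0) and [B] be S(l la1), viewed through their total spaces.  On the tensor
    product the operators are those of the coproduct of the quantized enveloping
    algebra: on [a] of degree [mu] and [b] of degree [nu],
    - [E_n (a (x) b)] is the sum over [k] of
      [q^(k (n - k) + (n - k) <mu, alpha^vee>)] times [E_k a (x) E_(n - k) b],
    - [F_n (a (x) b)] is the sum over [k] of
      [q^(k (n - k) - k <nu, alpha^vee>)] times [F_k a (x) F_(n - k) b].
    The rule for moving [E] past [F] on the tensor product results from the rule
    on the factors by the q-Vandermonde identity [q_vandermonde]; see [tensor_ax].

    An object S(la) is characterised by being generated by its highest weight
    vector under the [F], and cogenerated by it: a vector of degree other than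
    [la] killed by all [E_n], [n > 0], vanishes.  Indeed the highest weight
    vectors and the remaining primitive vectors generate complementary
    subobjects, so an indecomposable object has no such remaining vectors
    ([kerE_eq0], [tot_simple_hw]).  Conversely, two modules generated and
    cogenerated by highest weight vectors of the same weight are isomorphic: in
    their direct sum, the submodule generated by the pair of these vectors is the
    graph of a bijection ([graph_fun], [graph_inj], [graph_total]).  So it has to
    be shown that the tensor of the highest weight vectors generates and
    cogenerates the tensor product.

    Two facts make this work.  First, [B] is a Frobenius twist: its weights
    are congruent to l la1 modulo l times the root lattice, and [E_n], [F_n] vanish
    on it unless [l] divides [n] ([frob_E], [frob_F]).  Hence [E_1] and [F_1] act
    on the tensor product through [A], up to powers of [q].  Secondly, as la0 is
    restricted, [A] is generated by its highest weight vector under the [F_1] alone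
    and cogenerated under the [E_1] alone ([hw_ind1], [E1_cogenerated]).  This
    rests on the divided power and Serre relations.  These are not among the
    axioms: for the [E] they are proved on vectors obtained from the top by the
    [F] ([wE1E], [wE_serre]), and they carry over to the [F] by transposition with
    respect to the contravariant form ([form_exists], [wF_serre]).

    Consequently a vector killed by the [E_1] has the form [vA (x) b], and if all
    the [E_n] kill it, then they kill [b], which is thus a multiple of [vB]
    ([tensor_cogen]); and the [F_n] with [l] dividing [n] send [vA (x) b] to
    [vA (x) F_n b], after which the [F_1] move the first factor ([tensor_ind]).
    The bijection obtained in this way identifies the graded tensor product with
    S(la0 + l la1) degree by degree, and the operators are carried over along it
    ([tr_in_X], [tr_isomorphic]). *)

Set Implicit Arguments.
Unset Strict Implicit.
Unset Printing Implicit Defensive.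

Import Order.TTheory GRing.Theory Num.Theory.
Local Open Scope ring_scope.

(** * Quantum numbers at a formal parameter *)

Section QuantumNumbers.
Variables (F : fieldType) (v : F).
Hypotheses (v_neq0 : v != 0) (v_exp_neq1 : forall n, (0 < n)%N -> v ^+ n != 1).

Definition qint (n : int) : F := (v ^ n - v ^ (- n)) / (v - v^-1).

Definition qbin (a : int) (k : nat) : F :=
  (\prod_(i < k) qint (a - i%:Z)) / (\prod_(i < k) qint i.+1%:Z).

Lemma sub_inv_neq0 (x : F) : x != 0 -> x ^+ 2 != 1 -> x - x^-1 != 0.
Proof.
move=> x0; apply: contra_neq => /eqP; rewrite subr_eq0 => /eqP e.
by rewrite expr2 {1}e mulVf.
Qed.

Lemma v_gap : v - v^-1 != 0.
Proof. by rewrite sub_inv_neq0 ?v_exp_neq1. Qed.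

Lemma v_expz_neq1 (n : int) : n != 0 -> v ^ n != 1.
Proof.
case: n => [n|n] n0; first by apply: v_exp_neq1; lia.
by rewrite -[_ ^ _]/(_^-1) invr_eq1 v_exp_neq1.
Qed.

Lemma qint_neq0 (n : int) : n != 0 -> qint n != 0.
Proof.
move=> n0; rewrite /qint mulf_neq0 ?invr_eq0 ?v_gap //.
rewrite -invr_expz sub_inv_neq0 ?expfz_neq0 //.
by rewrite exprnP exprz_exp v_expz_neq1 // mulf_neq0.
Qed.

Lemma qint0 : qint 0 = 0.
Proof. by rewrite /qint oppr0 subrr mul0r. Qed.

Lemma qint1 : qint 1 = 1.
Proof. by rewrite /qint expr1z exprN1 divff ?v_gap. Qed.

Lemma qintN n : qint (- n) = - qint n.
Proof. by rewrite /qint opprK -mulNr opprB. Qed.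

Lemma qintD (a b : int) : qint (a + b) = v ^ b * qint a + v ^ (- a) * qint b.
Proof.
rewrite /qint !mulrA -mulrDl; congr (_ / _).
by rewrite !opprD !expfzDr //; ring.
Qed.

(** The source of the binomial identities below, which all reduce to it once
    denominators are cleared. *)
Lemma qint_exch (a b k : int) :
  qint a * qint b = qint (a + k) * qint (b - k) + qint k * qint (a - b + k).
Proof.
rewrite /qint !mulf_div -mulrDl; congr (_ / _).
rewrite !opprD !opprK !expfzDr // -!invr_expz.
have := expfz_neq0 a v_neq0; have := expfz_neq0 b v_neq0.
have := expfz_neq0 k v_neq0.
move: (v ^ a) (v ^ b) (v ^ k) => A B T T0 B0 A0.
by field; rewrite A0 B0 T0.
Qed.

Lemma qbin0 a : qbin a 0 = 1.
Proof. by rewrite /qbin !big_ord0 divr1. Qed.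

Lemma qbinSr (a : int) (r : nat) :
  qbin a r.+1 * qint r.+1 = qbin a r * qint (a - r%:Z).
Proof.
rewrite /qbin !big_ord_recr /= invfM [X in X * _]mulrA mulfVK ?qint_neq0 //.
by rewrite mulrAC.
Qed.

Lemma qbinS (a : int) (r : nat) :
  qbin a r.+1 * qint r.+1 = qint a * qbin (a - 1) r.
Proof.
rewrite /qbin big_ord_recl [X in _ / X]big_ord_recr /= invfM subr0.
rewrite [X in X * _]mulrA mulfVK ?qint_neq0 // -mulrA; congr (_ * (_ * _)).
by apply: eq_bigr => i _; rewrite /bump /=; congr qint; lia.
Qed.

Lemma qbinS1 (a : int) (r : nat) :
  qbin (a + 1) r.+1 * qint r.+1 = qint (a + 1) * qbin a r.
Proof. by rewrite qbinS addrK. Qed.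

(** Moving [F_k] to the left of [E_n E_1], every term arises in two ways; this
    identity adds up their coefficients. *)
Lemma qbin_idW (w b : int) (t : nat) :
  qbin (w + 1) t.+1 * qint (b - t.+1%:Z) + qint (w + 1 - b) * qbin w t =
  qint b * qbin w t.+1.
Proof.
have qc : qint t.+1 != 0 by exact: qint_neq0.
apply: (mulIf qc); have := qbinS1 w t; have := qbinSr w t.
have := qint_exch (w + 1) (b - t.+1%:Z) (- t.+1%:Z).
have -> : w + 1 - t.+1%:Z = w - t%:Z by lia.
have -> : b - t.+1%:Z - - t.+1%:Z = b by lia.
have -> : w + 1 - (b - t.+1%:Z) - t.+1%:Z = w + 1 - b by lia.
rewrite qintN; move: (qbin _ _) (qbin _ _) (qbin _ _) => A B C.
move: (qint _) (qint _) (qint _) (qint _) (qint _) (qint _) => a b' c d e f E1 E2 E3.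
transitivity (e * (A * b') + a * B * b'); first by ring.
rewrite E3; transitivity (B * (f * e) + a * B * b'); first by ring.
rewrite E1; transitivity (c * (B * d)); first by ring.
by rewrite -E2; ring.
Qed.

(** The same identity for the product [E_1 E_n]. *)
Lemma qbin_idD (w b : int) (t : nat) :
  qbin w t.+1 * qint (b - t.+1%:Z) + qbin w t * qint (w + b + 1 - t.+1%:Z) =
  qint b * qbin (w + 1) t.+1.
Proof.
have qc : qint t.+1 != 0 by exact: qint_neq0.
apply: (mulIf qc); have := qbinS1 w t; have := qbinSr w t.
have := qint_exch (w + 1) b (t.+1%:Z - (w + 1)).
have -> : w + 1 + (t.+1%:Z - (w + 1)) = t.+1%:Z by lia.
have -> : b - (t.+1%:Z - (w + 1)) = w + b + 1 - t.+1%:Z by lia.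
have -> : t.+1%:Z - (w + 1) = - (w - t%:Z) by lia.
have -> : w + 1 - b - (w - t%:Z) = - (b - t.+1%:Z) by lia.
rewrite !qintN mulrNN; move: (qbin _ _) (qbin _ _) (qbin _ _) => A B C.
move: (qint _) (qint _) (qint _) (qint _) (qint _) (qint _) => a b' c d e f E1 E2 E3.
transitivity (a * (C * d) + B * c * d); first by ring.
rewrite E2; transitivity (B * (d * c + b' * a)); first by ring.
by rewrite -E1 -[RHS]mulrA E3; ring.
Qed.

Lemma qbin_pascal (w : int) (t : nat) :
  qbin (w + 1) t.+1 =
  v ^ (t.+1%:Z) * qbin w t.+1 + v ^ (- (w - t%:Z)) * qbin w t.
Proof.
have qc : qint t.+1 != 0 by exact: qint_neq0.
apply: (mulIf qc); have := qbinS1 w t; have := qbinSr w t.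
have := qintD (w - t%:Z) t.+1%:Z.
have -> : w - t%:Z + t.+1%:Z = w + 1 by lia.
move: (qbin _ _) (qbin _ _) (qbin _ _) (v ^ _) (v ^ _) => A B C V W.
move: (qint _) (qint _) (qint _) => a b' c E1 E2 E3.
rewrite E3 E1; transitivity (W * (B * b') + V * a * B); first by ring.
by rewrite -E2; ring.
Qed.

Lemma qbin_lt (a r : nat) : (a < r)%N -> qbin a%:Z r = 0.
Proof.
move=> ar; rewrite /qbin (bigD1 (Ordinal ar)) //= subrr qint0 !mul0r //.
Qed.

End QuantumNumbers.

(** * Specialisation at [q] *)

Section Specialise.
Variables (F : fieldType) (j : {rmorphism {poly int} -> F}).
Hypothesis j_inj : injective j.
Local Notation v := (j 'X).
Variables (K : fieldType) (q : K) (q_neq0 : q != 0) (sp : F -> K).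
Hypothesis spE : forall (p : {poly int}) (k : nat),
  sp (j p / v ^+ k) = (map_poly intr p).[q] / q ^+ k.

Lemma j_eq0 p : (j p == 0) = (p == 0).
Proof. by rewrite -(rmorph0 j) (inj_eq j_inj). Qed.

Lemma v_neq0 : v != 0.
Proof. by rewrite j_eq0 polyX_eq0. Qed.

Lemma jX_exp_neq1 (n : nat) : (0 < n)%N -> v ^+ n != 1.
Proof.
move=> n0; rewrite -rmorphXn -(rmorph1 j) (inj_eq j_inj) -subr_eq0.
by rewrite -size_poly_eq0 -polyC1 size_XnsubC.
Qed.

Local Notation qint := (qint v).
Local Notation qbin := (qbin v).
Let qint1 : qint 1 = 1 := qint1 v_neq0 jX_exp_neq1.
Let qintD := qintD v_neq0.
Let qbin_pascal := qbin_pascal v_neq0 jX_exp_neq1.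

(** The elements on which [sp] is a ring morphism: the image of
    [Z[v, v^-1]]. *)
Definition laurent (f : F) : Prop :=
  exists (p : {poly int}) (k : nat), f = j p / v ^+ k.

Lemma laurentD f g : laurent f -> laurent g ->
  laurent (f + g) /\ sp (f + g) = sp f + sp g.
Proof.
move=> [p [k ->]] [p' [k' ->]].
have e : j p / v ^+ k + j p' / v ^+ k' =
         j (p * 'X^k' + p' * 'X^k) / v ^+ (k + k').
  rewrite rmorphD !rmorphM !rmorphXn /= exprD addf_div ?expf_neq0 ?v_neq0 // //.
split; first by rewrite e; exists (p * 'X^k' + p' * 'X^k), (k + k')%N.
rewrite e !spE rmorphD !rmorphM /= !map_polyXn hornerD !hornerM.
by rewrite !hornerXn exprD addf_div ?expf_neq0.
Qed.

Lemma laurentM f g : laurent f -> laurent g ->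
  laurent (f * g) /\ sp (f * g) = sp f * sp g.
Proof.
move=> [p [k ->]] [p' [k' ->]].
have e : j p / v ^+ k * (j p' / v ^+ k') =
         j (p * p') / v ^+ (k + k').
  by rewrite rmorphM exprD mulf_div.
split; first by rewrite e; exists (p * p'), (k + k')%N.
by rewrite e !spE rmorphM /= hornerM exprD mulf_div.
Qed.

Lemma laurentC (n : int) : laurent n%:~R /\ sp n%:~R = n%:~R.
Proof.
have e : n%:~R = j n%:~R / v ^+ 0 :> F by rewrite expr0 divr1 rmorph_int.
split; first by rewrite e; exists n%:~R, 0%N.
by rewrite e spE expr0 divr1 rmorph_int -(rmorph_int (@polyC K)) hornerC.
Qed.

Lemma laurent_vX (n : int) : laurent (v ^ n) /\ sp (v ^ n) = q ^ n.
Proof.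
case: n => n.
  have e : v ^ n = j 'X^n / v ^+ 0 by rewrite expr0 divr1 rmorphXn.
  split; first by rewrite e; exists 'X^n, 0%N.
  by rewrite e spE expr0 divr1 map_polyXn hornerXn.
have e : v ^ (Negz n) = j 1 / v ^+ n.+1 by rewrite rmorph1 div1r.
split; first by rewrite e; exists 1, n.+1.
by rewrite e spE rmorph1 hornerC div1r.
Qed.

Lemma laurentN f : laurent f -> laurent (- f) /\ sp (- f) = - sp f.
Proof.
move=> lf; have [l1 e1] := laurentC (-1); have [l2 e2] := laurentM l1 lf.
by move: l2 e2; rewrite e1 !rmorphN1 !mulN1r.
Qed.

Lemma laurent_qint (n : int) : laurent (qint n).
Proof.
have nat_case (m : nat) : laurent (qint m).
  elim: m => [|m IH]; first by rewrite qint0; have [] := laurentC 0.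
  have -> : m.+1%:Z = m%:Z + 1 by lia.
  rewrite qintD qint1 mulr1.
  have [l1 _] := laurent_vX 1; have [l2 _] := laurent_vX (- m%:Z).
  by have [l3 _] := laurentM l1 IH; have [] := laurentD l3 l2.
case: n => n; first exact: nat_case.
by rewrite NegzE qintN; have [] := laurentN (nat_case n.+1).
Qed.

(** Pascal's rule has powers of [v] as its only coefficients, so integrality
    propagates by it in both directions from [a = 0] to all integers [a]. *)
Lemma laurent_qbin (a : int) (r : nat) : laurent (qbin a r).
Proof.
elim: r a => [|r IH] a; first by rewrite qbin0; have [] := laurentC 1.
have up (w : int) : laurent (qbin w r.+1) -> laurent (qbin (w + 1) r.+1).
  move=> lw; rewrite qbin_pascal.
  have [l1 _] := laurent_vX r.+1; have [l2 _] := laurent_vX (- (w - r%:Z)).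
  have [l3 _] := laurentM l1 lw; have [l4 _] := laurentM l2 (IH w).
  by have [] := laurentD l3 l4.
have down (w : int) : laurent (qbin (w + 1) r.+1) -> laurent (qbin w r.+1).
  move=> lw; have e : qbin w r.+1 = v ^ (- r.+1%:Z) *
      (qbin (w + 1) r.+1 - v ^ (- (w - r%:Z)) * qbin w r).
    rewrite qbin_pascal addrK mulrA -expfzDr ?v_neq0 // // addNr expr0z mul1r //.
  have [l2 _] := laurent_vX (- (w - r%:Z)); have [l4 _] := laurentM l2 (IH w).
  have [l5 _] := laurentN l4; have [l6 _] := laurentD lw l5.
  have [l1 _] := laurent_vX (- r.+1%:Z); have [l7 _] := laurentM l1 l6.
  by rewrite e.
have base : laurent (qbin 0 r.+1).
  by rewrite (@qbin_lt _ _ 0 r.+1) //; have [] := laurentC 0.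
elim/int_rec: a => [//|n IHn|n IHn].
  by have -> : n.+1%:Z = n%:Z + 1 by [lia]; apply: up.
by apply: down; have -> : - n.+1%:Z + 1 = - n%:Z by lia.
Qed.

Let lq := laurent_qint.
Let lb := laurent_qbin.
Let lM := fun f g lf lg => (@laurentM f g lf lg).1.
Let sD := fun f g lf lg => (@laurentD f g lf lg).2.
Let sM := fun f g lf lg => (@laurentM f g lf lg).2.
Let lX := fun n => (laurent_vX n).1.
Let sX := fun n => (laurent_vX n).2.

(** Quantum integers may vanish in [K], so only identities free of division
    survive specialisation; those on which the representation theory rests are
    collected here. *)
Record qnumbers (gn : int -> K) (gb : int -> nat -> K) : Prop := QNumbers {
  gn0 : gn 0 = 0;
  gn1 : gn 1 = 1;
  gnN : forall n, gn (- n) = - gn n;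
  gnD : forall a b, gn (a + b) = q ^ b * gn a + q ^ (- a) * gn b;
  gn_exch : forall a b k,
    gn a * gn b = gn (a + k) * gn (b - k) + gn k * gn (a - b + k);
  gb0 : forall a, gb a 0 = 1;
  gb_lt : forall a r : nat, (a < r)%N -> gb a r = 0;
  gbS : forall a (r : nat), gb a r.+1 * gn r.+1 = gn a * gb (a - 1) r;
  gb_pascal : forall w (t : nat),
    gb (w + 1) t.+1 = q ^ (t.+1%:Z) * gb w t.+1 + q ^ (- (w - t%:Z)) * gb w t;
  gb_idW : forall w b (t : nat),
    gb (w + 1) t.+1 * gn (b - t.+1%:Z) + gn (w + 1 - b) * gb w t =
    gn b * gb w t.+1;
  gb_idD : forall w b (t : nat),
    gb w t.+1 * gn (b - t.+1%:Z) + gb w t * gn (w + b + 1 - t.+1%:Z) =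
    gn b * gb (w + 1) t.+1
}.

Lemma specialize_qnumbers :
  qnumbers (fun n => sp (qint n)) (fun a r => sp (qbin a r)).
Proof.
have s0 : sp 0 = 0 by have [_] := laurentC 0.
have s1 : sp 1 = 1 by have [_] := laurentC 1.
split=> [||n|a b|a b k|a|a r ar|a r|w t|w b t|w b t].
- by rewrite qint0.
- by rewrite qint1.
- by rewrite qintN (laurentN (lq n)).2.
- rewrite qintD (sD (lM (lX _) (lq _)) (lM (lX _) (lq _))).
  by rewrite !(sM (lX _) (lq _)) !sX.
- rewrite -!(sM (lq _) (lq _)) -(sD (lM (lq _) (lq _)) (lM (lq _) (lq _))).
  by rewrite (qint_exch v_neq0 a b k).
- by rewrite qbin0.
- by rewrite qbin_lt.
- rewrite -(sM (lb _ _) (lq _)) -(sM (lq _) (lb _ _)).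
  by rewrite (qbinS v_neq0 jX_exp_neq1).
- rewrite qbin_pascal (sD (lM (lX _) (lb _ _)) (lM (lX _) (lb _ _))).
  by rewrite !(sM (lX _) (lb _ _)) !sX.
- rewrite -!(sM (lb _ _) (lq _)) -!(sM (lq _) (lb _ _)).
  rewrite -(sD (lM (lb _ _) (lq _)) (lM (lq _) (lb _ _))).
  by rewrite (qbin_idW v_neq0 jX_exp_neq1).
- rewrite -!(sM (lb _ _) (lq _)) -!(sM (lq _) (lb _ _)).
  rewrite -(sD (lM (lb _ _) (lq _)) (lM (lb _ _) (lq _))).
  by rewrite (qbin_idD v_neq0 jX_exp_neq1).
Qed.

End Specialise.

Lemma specialize_frac (K : fieldType) (q : K) (p : {poly int}) (k : nat) :
  q != 0 ->
  specialize q (FracField.tofrac p / qv ^+ k) = (map_poly intr p).[q] / q ^+ k.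
Proof.
move=> q0; have qv0 : qv != 0 by rewrite /qv tofrac_eq0 polyX_eq0.
rewrite /specialize; apply: xget_unique => [|x [p' [k' [e ->]]]].
  by exists p, k.
move/eqP: e; rewrite eqr_div ?expf_neq0 // /qv -!tofracXn -!tofracM.
rewrite tofrac_eq => /eqP /(congr1 (fun p => (map_poly (intr : int -> K) p).[q])).
rewrite !rmorphM /= !map_polyXn !hornerM !hornerXn => e.
by apply/eqP; rewrite eqr_div ?expf_neq0 // e.
Qed.

Definition gn (K : fieldType) (q : K) (n : int) := specialize q (qnum n).
Definition gb (K : fieldType) (q : K) (a : int) (r : nat) :=
  specialize q (qbinom a r%:Z).

Lemma qnumbersP (K : fieldType) (q : K) : q != 0 -> qnumbers q (gn q) (gb q).
Proof.
move=> q0; apply: (@specialize_qnumbers _ (@FracField.tofrac {poly int})) => //.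
  by move=> x y /eqP; rewrite tofrac_eq => /eqP.
by move=> p k; apply: specialize_frac.
Qed.

(** * Quantum numbers at a given quantum characteristic *)

Section QnumTheory.
Variables (K : fieldType) (q : K).
Variables (gn : int -> K) (gb : int -> nat -> K) (Q : qnumbers q gn gb).

Lemma gn_three (w n : int) :
  gn (w - n) + gn (n - 1) * gn w = gn (w - 1) * gn n.
Proof.
rewrite (gn_exch Q (w - 1) n 1) (gn1 Q) mul1r subrK.
by rewrite addrC mulrC; congr (_ + gn _); lia.
Qed.

Hypothesis q_neq0 : q != 0.

(** Both sides satisfy Pascal's rule in [X], which determines them from [t - 1]
    and from their values at [X = 0]; the rule can be run backwards, so negative
    [X] are covered too. *)
Lemma q_vandermonde (X Y : int) (t : nat) :
  \sum_(r < t.+1) q ^ ((t - r)%:Z * X - r%:Z * Y) * (gb X r * gb Y (t - r)) =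
  gb (X + Y) t.
Proof.
pose V X t := \sum_(r < t.+1)
  q ^ ((t - r)%:Z * X - r%:Z * Y) * (gb X r * gb Y (t - r)).
rewrite -/(V X t).
have V0 X' : V X' 0 = 1.
  by rewrite /V big_ord_recl big_ord0 /= !mul0r subr0 expr0z !(gb0 Q) !mulr1 addr0.
have VS X' t' : V (X' + 1) t'.+1 =
    q ^ t'.+1%:Z * V X' t'.+1 + q ^ (- (X' + Y - t'%:Z)) * V X' t'.
  rewrite /V big_ord_recl [in X in q ^ t'.+1 * X]big_ord_recl [in RHS]mulrDr.
  rewrite -[RHS]addrA; congr (_ + _).
    rewrite mulrA -expfzDr //= !(gb0 Q); congr (q ^ _ * _); lia.
  rewrite !mulr_sumr -big_split /=; apply: eq_bigr => r _.
  have rt : (r <= t')%N by rewrite -ltnS.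
  rewrite /bump /= add1n subSS (gb_pascal Q) -!subzn //.
  rewrite !mulrA -!expfzDr //; set A := gb X' r; set B := gb X' _; set C := gb _ _.
  set x := (X in q ^ X * (_ + _)).
  transitivity (q ^ x * q ^ r.+1%:Z * B * C + q ^ x * q ^ (- (X' - r%:Z)) * A * C).
    by ring.
  by rewrite -!expfzDr // /x; congr (q ^ _ * _ * _ + q ^ _ * _ * _); lia.
elim: t X => [|t IH] X; first by rewrite V0 (gb0 Q).
have V0S t' : V 0 t' = gb Y t'.
  rewrite /V big_ord_recl /= mul0r subr0 mulr0 expr0z mul1r (gb0 Q) mul1r subn0.
  rewrite big1 ?addr0 // => r _; rewrite /bump /= add1n.
  by rewrite (gb_lt Q (a := 0)) // mul0r mulr0.
elim/int_rec: X => [|n IHn|n IHn]; first by rewrite V0S add0r.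
  have -> : n.+1%:Z = n%:Z + 1 by lia.
  rewrite VS IHn IH -(gb_pascal Q); congr gb; lia.
apply: (mulfI (_ : q ^ t.+1%:Z != 0)); first by rewrite expfz_neq0.
have := VS (- n.+1%:Z) t; have -> : - n.+1%:Z + 1 = - n%:Z by lia.
rewrite IHn IH; have -> : - n%:Z + Y = - n.+1%:Z + Y + 1 by lia.
by rewrite (gb_pascal Q) => /addIr.
Qed.

Section Char.
Variables (l : nat).
Hypotheses (l_gt0 : (0 < l)%N) (gnl : gn l%:Z = 0)
  (gn_lt : forall m : nat, (0 < m < l)%N -> gn m%:Z != 0).

Lemma gn_mull (c : int) : gn (l%:Z * c) = 0.
Proof.
elim/int_rec: c => [|n IHn|n IHn]; first by rewrite mulr0 (gn0 Q).
  have -> : l%:Z * n.+1%:Z = l%:Z * n%:Z + l%:Z by lia.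
  by rewrite (gnD Q) IHn gnl !mulr0 addr0.
have -> : l%:Z * - n.+1%:Z = l%:Z * (- n%:Z) + (- l%:Z) by lia.
by rewrite (gnD Q) IHn (gnN Q) gnl oppr0 !mulr0 addr0.
Qed.

Lemma gn_neq0 (r : nat) : ~~ (l %| r)%N -> gn r%:Z != 0.
Proof.
move=> lr; have -> : r%:Z = l%:Z * (r %/ l)%:Z + (r %% l)%:Z.
  by rewrite {1}(divn_eq r l) PoszD PoszM mulrC.
rewrite (gnD Q) gn_mull mulr0 add0r.
by rewrite mulf_neq0 ?expfz_neq0 // gn_lt // ltn_mod l_gt0 andbT lt0n.
Qed.

(** [gb (l c) r * gn r] is a multiple of [gn (l c)], which vanishes, while
    [gn r] does not. *)
Lemma gb_mull (c : int) (r : nat) : ~~ (l %| r)%N -> gb (l%:Z * c) r = 0.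
Proof.
case: r => [|r] lr; first by rewrite dvdn0 in lr.
apply: (mulIf (gn_neq0 lr)); by rewrite (gbS Q) gn_mull !mul0r.
Qed.

Lemma l_gt1 : (1 < l)%N.
Proof.
rewrite ltn_neqAle l_gt0 andbT; apply/eqP => l1.
by have := gnl; rewrite -l1 (gn1 Q) => /eqP; rewrite oner_eq0.
Qed.

End Char.
End QnumTheory.

(** * Weights and Cartan integers *)

Section WeightTheory.
Variables (R : realType) (V : vectType R) (Phi : root_system V) (Pi : base Phi).
Local Notation X := (weight Phi).
Local Notation I := 'I_(rank Pi).
Local Notation al := (@srt _ _ _ Pi).

Definition shift (nu : X) (i : I) (k : int) : X := nu + al i *~ k.

Lemma shift0 nu i : shift nu i 0 = nu.
Proof. by rewrite /shift mulr0z addr0. Qed.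

Lemma shiftD nu i a b : shift (shift nu i a) i b = shift nu i (a + b).
Proof. by rewrite /shift mulrzDr addrA. Qed.

Lemma shiftC nu i j a b : shift (shift nu i a) j b = shift (shift nu j b) i a.
Proof. by rewrite /shift addrAC. Qed.

Lemma shift_addl mu nu i k : shift (mu + nu) i k = shift mu i k + nu.
Proof. by rewrite /shift addrAC. Qed.

Lemma shift_addr mu nu i k : shift (mu + nu) i k = mu + shift nu i k.
Proof. by rewrite /shift addrA. Qed.

Lemma pairing_intr (mu : X) (i : I) :
  (pairing mu i)%:~R = coroot Phi (wval (al i)) (wval mu) :> R.
Proof.
apply/esym/eqP; rewrite eq_sym -intrEfloor.
have /allP := wvalP mu; apply; apply: simple_root; exact: mem_tnth.
Qed.

Lemma pairingD (mu nu : X) (i : I) : pairing (mu + nu) i = pairing mu i + pairing nu i.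
Proof.
apply: (@intr_inj R); rewrite rmorphD /= !pairing_intr.
by rewrite -[LHS]/(coroot Phi (wval (al i)) (wval mu + wval nu)) linearD.
Qed.

Lemma pairing0 (i : I) : pairing (0 : X) i = 0.
Proof. by apply: (addIr (pairing 0 i)); rewrite -pairingD !add0r. Qed.

Lemma pairingN (nu : X) (i : I) : pairing (- nu) i = - pairing nu i.
Proof. by apply: (addIr (pairing nu i)); rewrite -pairingD !addNr pairing0. Qed.

Lemma pairingMn (nu : X) n (i : I) : pairing (nu *+ n) i = pairing nu i *+ n.
Proof.
elim: n => [|n IH]; first by rewrite !mulr0n pairing0.
by rewrite !mulrS pairingD IH.
Qed.

Lemma pairingMz (nu : X) k (i : I) : pairing (nu *~ k) i = k * pairing nu i.
Proof.
case: k => k; first by rewrite -pmulrn pairingMn -mulr_natl natz.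
by rewrite NegzE mulrNz pairingN -pmulrn pairingMn -mulr_natl natz mulNr.
Qed.

Definition cartan (i j : I) : int := pairing (al i) j.

Lemma pairing_shift nu i k j :
  pairing (shift nu i k) j = pairing nu j + k * cartan i j.
Proof. by rewrite /shift pairingD pairingMz. Qed.

Lemma cartan_diag i : cartan i i = 2.
Proof.
apply: (@intr_inj R); rewrite pairing_intr coroot_self //.
apply: simple_root; exact: mem_tnth.
Qed.

Lemma wval_sum (c : I -> int) :
  wval (\sum_i al i *~ c i) = \sum_i (c i)%:~R *: tnth (simple Pi) i.
Proof.
rewrite -[LHS]/(\val (\sum_i al i *~ c i)) raddf_sum; apply: eq_bigr => i _.
by rewrite raddfMz scaler_int.
Qed.

Lemma simple_free (c : I -> R) :
  \sum_i c i *: tnth (simple Pi) i = 0 -> forall i, c i = 0.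
Proof.
have /basis_free/freeP fr := simple_basis Pi => e; apply: fr.
by rewrite -[RHS]e; apply: eq_bigr => i _; rewrite (tnth_nth 0).
Qed.

Lemma srt_free (c : I -> int) : \sum_i al i *~ c i = 0 -> forall i, c i = 0.
Proof.
move=> /(congr1 (@wval _ _ _)); rewrite wval_sum => e i.
by apply/eqP; rewrite -(intr_eq0 R); apply/eqP; move: i; apply: simple_free.
Qed.

(** Otherwise [a + b] is a root, being the reflection of [b] along [a], and its
    own reflection along [b] is the root [a - b], of mixed signs. *)
Lemma cartan0_sym i j : simply_laced Pi -> i != j ->
  cartan i j = 0 -> cartan j i = 0.
Proof.
move=> sl ij; rewrite /cartan => ci.
have := sl j i; rewrite eq_sym => /(_ ij).
set a := tnth (simple Pi) i; set b := tnth (simple Pi) j.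
have aP : a \in Defs.roots Phi by apply: simple_root; exact: mem_tnth.
have bP : b \in Defs.roots Phi by apply: simple_root; exact: mem_tnth.
have ab0 : coroot Phi b a = 0 by have := pairing_intr (al i) j; rewrite ci.
move=> [] e; first by apply: (@intr_inj R); rewrite pairing_intr.
have r1 : a + b \in Defs.roots Phi.
  by have := coroot_refl aP bP; rewrite e scaleN1r opprK addrC.
have r2 : a - b \in Defs.roots Phi.
  have cab : coroot Phi b (a + b) = 2.
    transitivity (coroot Phi b a + coroot Phi b b); first exact: linearD.
    by rewrite ab0 coroot_self // add0r.
  have := coroot_refl bP r1; rewrite cab.
  by rewrite scaler_nat mulr2n opprD addrA addrK.
have [c r2E] := root_comb Pi r2.
have expand (s : R) : a - b = s *: \sum_h tnth (simple Pi) h *+ c h ->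
    forall h, (h == i)%:R - (h == j)%:R = s * (c h)%:R :> R.
  move=> E h; apply/eqP; rewrite -subr_eq0; apply/eqP; move: h.
  apply: simple_free; move/eqP: E; rewrite -subr_eq0 => /eqP E; rewrite -[RHS]E.
  rewrite scaler_sumr [LHS](eq_bigr (fun h => ((h == i)%:R *: tnth (simple Pi) h -
    (h == j)%:R *: tnth (simple Pi) h) - s *: (tnth (simple Pi) h *+ c h))).
    rewrite !sumrB; congr (_ - _ - _).
      rewrite (bigD1 i) //= eqxx scale1r big1 ?addr0 // => h /negbTE ->.
      by rewrite scale0r.
    rewrite (bigD1 j) //= eqxx scale1r big1 ?addr0 // => h /negbTE ->.
    by rewrite scale0r.
  by move=> h _; rewrite !scalerBl -scaler_nat scalerA.
case: r2E => r2E.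
  have := expand 1; rewrite scale1r => /(_ r2E j).
  rewrite eqxx [j == i]eq_sym (negbTE ij) mul1r sub0r => e'.
  by have := ler0n R (c j); rewrite -e' oppr_ge0 leNgt ltr01.
have := expand (-1); rewrite scaleN1r => /(_ r2E i).
rewrite eqxx (negbTE ij) mulN1r subr0 => e'.
by have := ler0n R (c i); rewrite -oppr_le0 -e' leNgt ltr01.
Qed.

Lemma cartan_off i j : simply_laced Pi -> i != j ->
  cartan i j = 0 \/ cartan i j = -1.
Proof.
move=> sl ij; case: (sl i j ij) => e; [left|right];
  by apply: (@intr_inj R); rewrite pairing_intr e // rmorphN1.
Qed.

Lemma cartan_sym i j : simply_laced Pi -> cartan i j = cartan j i.
Proof.
move=> sl; have [->//|ij] := eqVneq i j; have ji : j != i by rewrite eq_sym.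
have [e|e] := cartan_off sl ij; rewrite e; first by rewrite (cartan0_sym sl ij e).
have [e'|->//] := cartan_off sl ji.
by have := cartan0_sym sl ji e'; rewrite e.
Qed.

(** Induction from the top: adding multiples of a simple root decreases the
    height of [la - mu] as long as the weight stays below [la]. *)
Lemma wle_ind (la : X) (P : X -> Prop) :
  (forall mu, ~ wle Pi mu la -> P mu) ->
  (forall mu, (forall i (n : nat), (0 < n)%N -> P (shift mu i n)) -> P mu) ->
  forall mu, P mu.
Proof.
move=> P0 PS mu; have [[c cE]|] := pselect (wle Pi mu la); last exact: P0.
have [h] := ubnP (\sum_i c i)%N; elim: h => // h IH in mu c cE *.
rewrite ltnS => ch; apply: PS => i n n0.
have [[c' c'E]|] := pselect (wle Pi (shift mu i n) la); last exact: P0.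
apply: (IH _ c' c'E); apply: leq_trans ch.
have e k : (c k)%:Z - ((c' k)%:Z + (n * (k == i))%N%:Z) = 0.
  move: k; apply: srt_free.
  rewrite (eq_bigr (fun k => al k *+ c k - (al k *+ c' k + al k *+ (n * (k == i))%N))).
    rewrite sumrB big_split /= -cE -c'E (bigD1 i) //= eqxx muln1 big1 ?addr0.
      by rewrite /shift -pmulrn [- (mu + _)]opprD addrA subrK subrr.
    by move=> k /negbTE ->; rewrite muln0.
  by move=> k _; rewrite mulrzBr mulrzDr -!pmulrn.
have -> : (\sum_k c k = \sum_k c' k + n)%N.
  rewrite (eq_bigr (fun k => c' k + n * (k == i))%N).
    rewrite big_split /=; congr addn; rewrite (bigD1 i) //= eqxx muln1.
    by rewrite big1 ?addn0 // => k /negbTE ->; rewrite muln0.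
  by move=> k _; have := e k; lia.
by rewrite -addn1 leq_add2l.
Qed.

Lemma wle_shiftN la i n : (0 < n)%N -> ~ wle Pi (shift la i n%:Z) la.
Proof.
move=> n0 [c cE].
have e k : (c k)%:Z + (n * (k == i))%N%:Z = 0.
  move: k; apply: srt_free.
  rewrite (eq_bigr (fun k => al k *+ c k + al k *+ (n * (k == i))%N)).
    rewrite big_split /= -cE (bigD1 i) //= eqxx muln1 big1 ?addr0.
      by rewrite /shift -pmulrn opprD addrA subrr add0r addNr.
    by move=> k /negbTE ->; rewrite muln0.
  by move=> k _; rewrite mulrzDr -!pmulrn.
by have := e i; rewrite eqxx; lia.
Qed.

Lemma wle_shift_off la i j n : i != j ->
  ~ wle Pi (shift (shift la i (- n%:Z)) j 1) la.
Proof.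
move=> ij [c cE].
have e k : (c k)%:Z + ((k == j)%:Z - (n * (k == i))%N%:Z) = 0.
  move: k; apply: srt_free.
  rewrite (eq_bigr (fun k => al k *+ c k + (al k *+ (k == j) - al k *+ (n * (k == i))%N))).
    rewrite big_split sumrB /= -cE [in X in _ + (X - _)](bigD1 j) //= eqxx big1 ?addr0.
      rewrite [in X in _ + (_ - X)](bigD1 i) //= eqxx muln1 big1 ?addr0.
        have gen (a b d : X) : a - (a - b + d) + (d - b) = 0.
          apply/eqP; rewrite addr_eq0 opprB -[a - b + d]addrA opprD addrA subrr.
          by rewrite add0r opprD opprK.
        by rewrite /shift mulrNz -pmulrn mulr1z mulr1n gen.
      by move=> k /negbTE ->; rewrite muln0.
    by move=> k /negbTE ->.
  by move=> k _; rewrite mulrzDr mulrzBr -!pmulrn.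
by have := e j; rewrite eqxx [j == i]eq_sym (negbTE ij); lia.
Qed.

Lemma wleD la la' mu mu' :
  wle Pi mu la -> wle Pi mu' la' -> wle Pi (mu + mu') (la + la').
Proof.
move=> [c cE] [c' c'E]; exists (fun i => c i + c' i)%N.
rewrite opprD addrACA cE c'E -big_split; apply: eq_bigr => i _.
by rewrite mulrnDr.
Qed.

Section RootSublattice.
Variables (la1 : X) (l : nat).

(** The coset of [l la1] modulo [l] times the root lattice: the weights of the
    simple object of highest weight [l la1] lie in it. *)
Definition in_lattice (mu : X) : Prop :=
  exists c : I -> int, mu - la1 *+ l = \sum_i al i *~ (l%:Z * c i).

Lemma in_lattice0 : in_lattice (la1 *+ l).
Proof. by exists (fun=> 0); rewrite subrr big1 // => i _; rewrite mulr0 mulr0z. Qed.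

Lemma in_lattice_dvd mu nu (d : I -> int) : in_lattice mu -> in_lattice nu ->
  mu - nu = \sum_i al i *~ d i -> forall i, exists k, d i = l%:Z * k.
Proof.
move=> [c cE] [c' c'E] e i; exists (c i - c' i).
have : \sum_k al k *~ (d k - l%:Z * (c k - c' k)) = 0.
  rewrite (eq_bigr (fun k => al k *~ d k -
     (al k *~ (l%:Z * c k) - al k *~ (l%:Z * c' k)))).
    by rewrite !sumrB -cE -c'E -e [- (nu - _)]opprB subrKA subrr.
  by move=> k _; rewrite mulrBr !mulrzBr.
by move=> /srt_free/(_ i)/eqP; rewrite subr_eq0 => /eqP.
Qed.

Lemma shift_sum mu i n : shift mu i n - mu = \sum_k al k *~ (n * (k == i)%:Z).
Proof.
rewrite /shift addrC addrA addNr add0r (bigD1 i) //= eqxx mulr1 big1 ?addr0 //.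
by move=> k /negbTE ->; rewrite mulr0 mulr0z.
Qed.

Lemma in_lattice_step mu i (n : int) : in_lattice mu ->
  in_lattice (shift mu i n) -> exists k, n = l%:Z * k.
Proof.
move=> h1 h2; have := in_lattice_dvd h2 h1 (shift_sum mu i n) i.
by rewrite eqxx mulr1.
Qed.

Lemma in_lattice_step2 mu i j (n m : int) : i != j ->
  in_lattice (shift mu i n) -> in_lattice (shift mu j m) ->
  exists k, n = l%:Z * k.
Proof.
move=> ij h1 h2.
have e : shift mu i n - shift mu j m =
    \sum_k al k *~ (n * (k == i)%:Z - m * (k == j)%:Z).
  rewrite (eq_bigr (fun k => al k *~ (n * (k == i)%:Z) - al k *~ (m * (k == j)%:Z))).
    by rewrite sumrB -!(shift_sum mu) [- (_ - mu)]opprB subrKA.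
  by move=> k _; rewrite mulrzBr.
by have := in_lattice_dvd h1 h2 e i; rewrite eqxx (negbTE ij) mulr0 subr0 mulr1.
Qed.

Lemma in_lattice_shift mu i (k : int) :
  in_lattice (shift mu i (l%:Z * k)) -> in_lattice mu.
Proof.
move=> [c cE]; exists (fun h => c h - k * (h == i)%:Z).
rewrite (eq_bigr (fun h => al h *~ (l%:Z * c h) - al h *~ (l%:Z * k * (h == i)%:Z))).
  by rewrite sumrB -cE -(shift_sum mu) opprB [RHS]addrC subrKA.
by move=> h _; rewrite mulrBr mulrA mulrzBr.
Qed.

Lemma in_lattice_pairing mu (i : I) : in_lattice mu -> exists k, pairing mu i = l%:Z * k.
Proof.
move=> [c /eqP]; rewrite subr_eq => /eqP ->.
exists (\sum_j c j * cartan j i + pairing la1 i); rewrite pairingD pairingMn.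
rewrite mulrDr -mulr_natl natz; congr (_ + _).
rewrite mulr_sumr; elim/big_rec2: _ => [|j x y _ <-]; first by rewrite pairing0.
by rewrite pairingD pairingMz mulrA.
Qed.
End RootSublattice.

End WeightTheory.

(** * Weight modules *)

Definition subspace (K : fieldType) (W : lmodType K) (Q : W -> Prop) : Prop :=
  Q 0 /\ forall c x y, Q x -> Q y -> Q (c *: x + y).

Section Subspace.
Variables (K : fieldType) (W : lmodType K) (Q : W -> Prop) (sQ : subspace Q).

Lemma subspaceD x y : Q x -> Q y -> Q (x + y).
Proof. by move=> Qx Qy; have := sQ.2 1 x y Qx Qy; rewrite scale1r. Qed.

Lemma subspaceZ c x : Q x -> Q (c *: x).
Proof. by move=> Qx; have := sQ.2 c x 0 Qx sQ.1; rewrite addr0. Qed.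

Lemma subspaceN x : Q x -> Q (- x).
Proof. by move=> Qx; rewrite -scaleN1r; apply: subspaceZ. Qed.

Lemma subspace_sum (J : Type) (r : seq J) (P : pred J) (f : J -> W) :
  (forall i, P i -> Q (f i)) -> Q (\sum_(i <- r | P i) f i).
Proof. by move=> Qf; elim/big_ind: _ => //; [exact: sQ.1|exact: subspaceD]. Qed.

Lemma subspace_sum_seq (J : eqType) (r : seq J) (f : J -> W) :
  (forall i, i \in r -> Q (f i)) -> Q (\sum_(i <- r) f i).
Proof.
move=> Qf; rewrite big_seq_cond; apply: subspace_sum => i.
by rewrite andbT; apply: Qf.
Qed.
End Subspace.

Section WeightModules.
Variables (R : realType) (V : vectType R) (Phi : root_system V) (Pi : base Phi).
Variable (K : fieldType).
Local Notation X := (weight Phi).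
Local Notation I := 'I_(rank Pi).

(** A graded space with operators, given by its ungraded total space and the
    predicate of being homogeneous of a given degree: iterated operators then
    compose without any transport between components of equal degrees. *)
Record wmod := WMod {
  wcar :> lmodType K;
  wt : X -> wcar -> Prop;
  wE : I -> nat -> {linear wcar -> wcar};
  wF : I -> nat -> {linear wcar -> wcar}
}.
Arguments wt {w} _ _.
Arguments wE {w} _ _.
Arguments wF {w} _ _.

Variable q : K.
Variables (gn : int -> K) (gb : int -> nat -> K) (Q : qnumbers q gn gb).

(** In the commutation rule [mu] is the degree of the vector [x] itself, whence
    the sign of [n] in the binomial. *)
Record wmod_ax (U : wmod) : Prop := WModAx {
  wt_sub : forall mu, subspace (@wt U mu);
  wtE : forall mu i n (x : U), wt mu x -> wt (shift mu i n%:Z) (wE i n x);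
  wtF : forall mu i n (x : U), wt mu x -> wt (shift mu i (- n%:Z)) (wF i n x);
  wE0 : forall mu i (x : U), wt mu x -> wE i 0 x = x;
  wF0 : forall mu i (x : U), wt mu x -> wF i 0 x = x;
  wEF_ne : forall mu i j m n (x : U), i != j -> wt mu x ->
    wE i m (wF j n x) = wF j n (wE i m x);
  wEF_eq : forall mu i m n (x : U), wt mu x ->
    wE i m (wF i n x) = \sum_(r < (minn m n).+1)
      gb (pairing mu i - n%:Z + m%:Z) r *: wF i (n - r) (wE i (m - r) x)
}.

Definition below (la : X) (U : wmod) : Prop :=
  forall mu (x : U), ~ wle Pi mu la -> wt mu x -> x = 0.

Definition cogenerated (la : X) (U : wmod) : Prop :=
  forall mu (x : U), mu != la -> wt mu x ->
    (forall i n, (0 < n)%N -> wE i n x = 0) -> x = 0.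

Definition generated (la : X) (U : wmod) : Prop :=
  forall mu (P : U -> Prop), mu != la -> subspace P ->
    (forall i n y, (0 < n)%N -> wt (shift mu i n%:Z) y -> P (wF i n y)) ->
    forall x, wt mu x -> P x.

(** What is known about the object with highest weight [la]: it is both
    generated and cogenerated by its top component, the line of [v].  The last
    field is the coordinate along [v]. *)
Record simple_hw (la : X) (U : wmod) (v : U) : Prop := SimpleHw {
  hw_ax : wmod_ax U;
  hw_below : below la U;
  hw_cogen : cogenerated la U;
  hw_gen : generated la U;
  hw_span : forall P : U -> Prop, subspace P ->
    (forall mu x, wt mu x -> P x) -> forall x, P x;
  hw_wt : wt la v;
  hw_neq0 : v != 0;
  hw_top : forall x, wt la x -> exists c, x = c *: v;
  hw_coord : exists phi : U -> K^o, [/\ linear phi, phi v = 1 &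
    forall mu x, mu != la -> wt mu x -> phi x = 0]
}.

(** [E_{m-r}], with the convention that operators of negative index vanish. *)
Definition wEm (U : wmod) (i : I) (m r : nat) (x : U) : U :=
  if (r <= m)%N then wE i (m - r) x else 0.

Fact wEm_linear (U : wmod) i m r : linear (@wEm U i m r).
Proof.
by move=> c x y; rewrite /wEm; case: ifP; rewrite ?linearP ?scaler0 ?addr0.
Qed.
HB.instance Definition _ (U : wmod) i m r :=
  GRing.isLinear.Build K U U *:%R (@wEm U i m r) (@wEm_linear U i m r).

Lemma wEm0 (U : wmod) i m (x : U) : wEm i m 0 x = wE i m x.
Proof. by rewrite /wEm leq0n subn0. Qed.

Lemma wEmS (U : wmod) i m r (x : U) : wEm i m.+1 r.+1 x = wEm i m r x.
Proof. by rewrite /wEm ltnS subSS. Qed.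

Section Commutation.
Variables (U : wmod) (Ux : wmod_ax U).

Lemma wEm_wt mu i m r (x : U) : wt mu x -> wt (shift mu i (m%:Z - r%:Z)) (wEm i m r x).
Proof.
move=> hx; rewrite /wEm; case: leqP => rm; last exact: (wt_sub Ux _).1.
by rewrite subzn //; apply: wtE.
Qed.

Lemma wEF mu i m n (x : U) : wt mu x ->
  wE i m (wF i n x) = \sum_(r < n.+1)
      gb (pairing mu i - n%:Z + m%:Z) r *: wF i (n - r) (wEm i m r x).
Proof.
move=> hx; rewrite (wEF_eq Ux _ _ _ hx).
have le : ((minn m n).+1 <= n.+1)%N by rewrite ltnS geq_minr.
pose f r := gb (pairing mu i - n%:Z + m%:Z) r *: wF i (n - r) (wE i (m - r) x).
rewrite (big_ord_widen n.+1 f le) big_mkcond; apply: eq_bigr => r _.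
rewrite ltnS leq_min -[(r <= n)%N]ltnS ltn_ord andbT /f /wEm.
by case: ifP => // _; rewrite linear0 scaler0.
Qed.

Lemma gb1 a : gb a 1 = gn a.
Proof. by have := gbS Q a 0; rewrite (gn1 Q) mulr1 (gb0 Q) mulr1. Qed.

Lemma wE1F mu i n (x : U) : wt mu x -> wE i 1 (wF i n x) = wF i n (wE i 1 x) +
  (if n is m.+1 then gn (pairing mu i - m%:Z) *: wF i m x else 0).
Proof.
case: n => [|n] hx.
  by rewrite addr0 (wF0 Ux _ hx) (wF0 Ux _ (wtE Ux _ _ hx)).
rewrite (wEF _ _ _ hx) 2!big_ord_recl big1 ?addr0 /=.
  rewrite (gb0 Q) scale1r subn0 wEm0 gb1 /wEm /= subnn (wE0 Ux _ hx) subn1 /=.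
  by congr (_ + gn _ *: _); lia.
by move=> r _; rewrite /wEm /bump /= linear0 scaler0.
Qed.
End Commutation.

End WeightModules.
Arguments wt {R V Phi Pi K w} _ _.
Arguments wE {R V Phi Pi K w} _ _.
Arguments wF {R V Phi Pi K w} _ _.

(** * Relations between the raising operators *)

Section Relations.
Variables (R : realType) (V : vectType R) (Phi : root_system V) (Pi : base Phi).
Variable (K : fieldType).
Local Notation X := (weight Phi).
Local Notation I := 'I_(rank Pi).
Local Notation wmod := (wmod Pi K).
Variable q : K.
Variables (gn : int -> K) (gb : int -> nat -> K) (Q : qnumbers q gn gb).

Section Simple.
Variables (la : X) (U : wmod) (v : U) (S : simple_hw gb la v).
Let Ux : wmod_ax gb U := hw_ax S.

Lemma hw_ind (P : X -> U -> Prop) :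
  (forall mu, subspace (P mu)) -> P la v ->
  (forall mu i n x, (0 < n)%N -> wt mu x -> P mu x ->
     P (shift mu i (- n%:Z)) (wF i n x)) ->
  forall mu x, wt mu x -> P mu x.
Proof.
move=> Ps Pv PF; apply: (@wle_ind _ _ _ Pi la) => [mu nle|mu IH] x hx.
  by rewrite (hw_below S nle hx); exact: (Ps mu).1.
have [e|ne] := eqVneq mu la.
  rewrite e in hx *; have [c ->] := hw_top S hx; exact: subspaceZ.
apply: (hw_gen S ne (Ps mu)) => // i n y n0 hy.
by have := PF _ i n y n0 hy (IH i n n0 _ hy); rewrite shiftD subrr shift0.
Qed.

Lemma wE_top (i : I) n : (0 < n)%N -> wE i n v = 0.
Proof.
move=> n0; apply: (hw_below S (mu := shift la i n)); first exact: wle_shiftN.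
exact: (wtE Ux _ _ (hw_wt S)).
Qed.

(** The relations among the [E] are not axioms; they hold because the module is
    generated by [v].  The vectors that satisfy such a relation in all degrees
    of the operators include [v], and are stable under the [F]: when [F_k] is
    moved to the left on both sides, there remains an identity between binomials,
    here [gb_idD].  The next three lemmas are proved in the same way. *)
Lemma wE1E (i : I) mu (x : U) : wt mu x ->
  forall n, wE i 1 (wE i n x) = gn n.+1%:Z *: wE i n.+1 x.
Proof.
move: mu x; apply: hw_ind.
- move=> mu; split=> [n|c x y Hx Hy n]; first by rewrite !linear0.
  by rewrite !linearP Hx Hy.
- move=> n; rewrite (wE_top i (n := n.+1)) // scaler0.
  by case: n => [|n]; rewrite ?(wE0 Ux _ (hw_wt S)) wE_top ?linear0.
move=> mu j k y _ hy Hy n.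
have [ij|ij] := eqVneq i j; last first.
  rewrite !(wEF_ne Ux _ _ ij hy) (wEF_ne Ux _ _ ij (wtE Ux _ _ hy)).
  by rewrite Hy linearZ.
subst j.
have Hm r : wE i 1 (wEm i n r y) = gn (n.+1%:Z - r%:Z) *: wEm i n.+1 r y.
  rewrite /wEm; case: leqP => rn; last first.
    rewrite linear0; case: leqP => [rn'|_]; last by rewrite scaler0.
    have -> : n.+1%:Z - r%:Z = 0 by lia.
    by rewrite (gn0 Q) scale0r.
  by rewrite Hy ifT ?subzn ?subSn //; lia.
rewrite !(wEF Ux _ _ _ hy) linear_sum scaler_sumr /=.
under eq_bigr => r _ do
  rewrite linearZ /= (wE1F Q Ux _ _ (wEm_wt Ux _ _ _ hy)) scalerDr Hm.
rewrite big_split /= [in X in X + _]big_ord_recl [in X in _ + X]big_ord_recr /=.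
rewrite [RHS]big_ord_recl subnn scaler0 -[LHS]addrA [X in _ + (_ + X)]addr0 -big_split /=.
congr (_ + _).
  rewrite !(gb0 Q) !scale1r linearZ /=; congr (gn _ *: _); lia.
apply: eq_bigr => r _; rewrite /bump /= add1n wEmS.
have rk : (r < k)%N by [].
have -> : (k - r = (k - r.+1).+1)%N by lia.
rewrite linearZ /= !scalerA -scalerDl; congr (_ *: _).
rewrite pairing_shift cartan_diag.
have := gb_idD Q (pairing mu i - k%:Z + n%:Z) n.+1%:Z r.
have -> : (pairing mu i - k%:Z + n.+1%:Z) = (pairing mu i - k%:Z + n%:Z) + 1 by lia.
move=> <-; congr (_ + _ * gn _); lia.
Qed.

Lemma wEE1 (i : I) mu (x : U) : wt mu x ->
  forall n, wE i n (wE i 1 x) = gn n.+1%:Z *: wE i n.+1 x.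
Proof.
move: mu x; apply: hw_ind.
- move=> mu; split=> [n|c x y Hx Hy n]; first by rewrite !linear0.
  by rewrite !linearP Hx Hy.
- by move=> n; rewrite !wE_top // linear0 scaler0.
move=> mu j k y _ hy Hy n.
have [ij|ij] := eqVneq i j; last first.
  rewrite !(wEF_ne Ux _ _ ij hy) (wEF_ne Ux _ _ ij (wtE Ux _ _ hy)).
  by rewrite Hy linearZ.
subst j.
have Hm r : wEm i n r (wE i 1 y) = gn (n.+1%:Z - r%:Z) *: wEm i n.+1 r y.
  rewrite /wEm; case: leqP => rn; last first.
    case: leqP => [rn'|_]; last by rewrite scaler0.
    have -> : n.+1%:Z - r%:Z = 0 by lia.
    by rewrite (gn0 Q) scale0r.
  by rewrite Hy ifT ?subzn ?subSn //; lia.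
have hy1 := wtE Ux i 1 hy.
rewrite (wE1F Q Ux _ _ hy) linearD /= (wEF Ux _ _ _ hy1) (wEF Ux _ _ _ hy).
rewrite big_ord_recl [in RHS]big_ord_recl scalerDr -[LHS]addrA.
congr (_ + _).
  rewrite !(gb0 Q) !scale1r subn0 Hm linearZ /=; congr (gn _ *: _); lia.
rewrite scaler_sumr; case: k => [|k]; first by rewrite !big_ord0 linear0 addr0.
rewrite linearZ /= (wEF Ux _ _ _ hy) scaler_sumr -big_split /=.
apply: eq_bigr => r _; rewrite /bump /= add1n wEmS Hm subSS linearZ /=.
rewrite !scalerA -scalerDl; congr (_ *: _).
rewrite pairing_shift cartan_diag mul1r.
have := gb_idW Q (pairing mu i - k%:Z + n%:Z) n.+1%:Z r.
have -> : pairing mu i - k.+1%:Z + n.+1%:Z = pairing mu i - k%:Z + n%:Z by lia.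
move=> <-; congr (gb _ _ * gn _ + gn _ * _); lia.
Qed.

Lemma wEC (i j : I) mu (x : U) : i != j -> cartan i j = 0 -> cartan j i = 0 ->
  wt mu x -> forall n, wE j 1 (wE i n x) = wE i n (wE j 1 x).
Proof.
move=> ij cij cji; move: mu x; apply: hw_ind.
- move=> mu; split=> [n|c x y Hx Hy n]; first by rewrite !linear0.
  by rewrite !linearP Hx Hy.
- move=> [|n]; last by rewrite !wE_top // !linear0.
  by rewrite (wE0 Ux _ (hw_wt S)) wE_top // linear0.
move=> mu g k y _ hy Hy n.
have hyi m := wtE Ux i m hy; have hyj := wtE Ux j 1 hy.
have [ig|ig] := eqVneq i g.
  subst g; have ji : j != i by rewrite eq_sym.
  have Hm r : wE j 1 (wEm i n r y) = wEm i n r (wE j 1 y).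
    by rewrite /wEm; case: leqP => _; rewrite ?Hy ?linear0.
  rewrite (wEF_ne Ux _ _ ji hy) (wEF Ux _ _ _ hyj) (wEF Ux _ _ _ hy) linear_sum.
  apply: eq_bigr => r _; rewrite pairing_shift cji mulr0 addr0 linearZ /=.
  by rewrite (wEF_ne Ux _ _ ji (wEm_wt Ux _ _ _ hy)) Hm.
rewrite (wEF_ne Ux _ _ ig hy).
have [jg|jg] := eqVneq j g; last first.
  rewrite (wEF_ne Ux _ _ jg hy) (wEF_ne Ux _ _ jg (hyi n)).
  by rewrite (wEF_ne Ux _ _ ig hyj) Hy.
subst g; rewrite (wE1F Q Ux _ _ hy) (wE1F Q Ux _ _ (hyi n)) linearD /=.
rewrite (wEF_ne Ux _ _ ig hyj) Hy; congr (_ + _).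
case: k => [|k]; first by rewrite linear0.
by rewrite linearZ /= (wEF_ne Ux _ _ ig hy) pairing_shift cij mulr0 addr0.
Qed.

(** A form of the quantum Serre relation with divided powers; for [n = 2] it is
    the Serre relation itself. *)
Lemma wE_serre (i j : I) mu (x : U) : i != j ->
  cartan i j = -1 -> cartan j i = -1 -> wt mu x -> forall n,
  wE j 1 (wE i n x) + gn (n%:Z - 1) *: wE i n (wE j 1 x) =
  wEm i n 1 (wE j 1 (wE i 1 x)).
Proof.
move=> ij cij cji.
have serre0 nu (z : U) : wt nu z -> wE j 1 (wE i 0 z) + gn (0%:Z - 1) *: wE i 0 (wE j 1 z) =
    wEm i 0 1 (wE j 1 (wE i 1 z)).
  move=> hz; rewrite (wE0 Ux _ hz) (wE0 Ux _ (wtE Ux j 1 hz)) /wEm /= sub0r.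
  by rewrite (gnN Q) (gn1 Q) scaleN1r subrr.
move: mu x; apply: hw_ind.
- move=> mu; split=> [n|c x y Hx Hy n]; first by rewrite !linear0 addr0.
  by rewrite !linearP /= -Hx -Hy scalerDr addrACA.
- move=> [|n]; first exact: serre0 (hw_wt S).
  by rewrite !wE_top // !linear0 addr0.
move=> mu g k y _ hy Hy [|n]; first exact: serre0 (wtF Ux _ _ hy).
rewrite wEmS wEm0 -[n.+1%:Z]natz -natr1 addrK natz.
have hyi m := wtE Ux i m hy; have hyj := wtE Ux j 1 hy.
have hyij := wtE Ux j 1 (hyi 1%N).
have [ig|ig] := eqVneq i g.
  subst g; have ji : j != i by rewrite eq_sym.
  have Hm r : wE j 1 (wEm i n.+1 r y) +
      gn (n%:Z - r%:Z) *: wEm i n.+1 r (wE j 1 y) = wEm i n r (wE j 1 (wE i 1 y)).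
    rewrite -(wEmS i n r); have [rn|rn] := leqP r n.+1; last first.
      by rewrite /wEm !ifF ?linear0 ?scaler0 ?addr0 //; lia.
    have := Hy (n.+1 - r)%N.
    rewrite -subzn // (_ : n.+1%:Z - r%:Z - 1 = n%:Z - r%:Z); last by lia.
    rewrite /wEm rn ltnS => ->; have [rn'|rn'] := leqP 1 (n.+1 - r).
      by rewrite ifT; [congr (wE _ _ _)|]; lia.
    by rewrite ifF //; lia.
  rewrite (wEF_ne Ux _ _ ji hy) (wEF Ux _ _ _ hy) linear_sum /=.
  rewrite (wEF Ux _ _ _ hyj) (wE1F Q Ux _ _ hy) !linearD /=.
  rewrite (wEF_ne Ux _ _ ji (hyi 1%N)) (wEF Ux _ _ _ hyij).
  rewrite scaler_sumr -big_split big_ord_recl [in RHS]big_ord_recl /= -[RHS]addrA.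
  have Hr r : wE j 1 (wF i (k - r) (wEm i n.+1 r y)) =
       wF i (k - r) (wEm i n r (wE j 1 (wE i 1 y))) - gn (n%:Z - r%:Z) *:
       wF i (k - r) (wEm i n.+1 r (wE j 1 y)).
    rewrite (wEF_ne Ux _ _ ji (wEm_wt Ux _ _ _ hy)) -linearZ -linearB -Hm.
    by rewrite addrK.
  congr (_ + _).
    rewrite linearZ /= Hr !(gb0 Q) !scale1r; rewrite -[RHS]addr0 -addrA; congr (_ + _).
    by rewrite -scaleNr -scalerDl (_ : n%:Z - 0%:Z = n) ?addNr ?scale0r //; lia.
  case: k Hr hy {Hy} => [|k] Hr hy; first by rewrite !big_ord0 !linear0 addr0.
  rewrite !linearZ /= (wEF_ne Ux _ _ ji hy) (wEF Ux _ _ _ hyj).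
  rewrite scaler_sumr -big_split; apply: eq_bigr => r _; rewrite /bump /= add1n.
  rewrite linearZ /= Hr scalerBr !scalerA subSS wEmS -[LHS]addrA.
  rewrite !pairing_shift cji cartan_diag.
  rewrite (_ : pairing mu i + 1%:Z * 2 + 1%:Z * -1 - k.+1%:Z + n%:Z =
     pairing mu i - k.+1%:Z + n.+1%:Z); last by lia.
  congr (_ + _); rewrite -scaleNr -scalerDl; congr (_ *: _).
  have := gb_idW Q (pairing mu i - k.+1%:Z + n%:Z) n%:Z r.
  rewrite (_ : pairing mu i - k.+1%:Z + n%:Z + 1 =
     pairing mu i - k.+1%:Z + n.+1%:Z); last by lia.
  rewrite (_ : pairing mu i - k.+1%:Z + n.+1%:Z - n%:Z = pairing mu i - k%:Z); last by lia.
  rewrite (_ : pairing mu i + 1%:Z * -1 - k.+1%:Z + n.+1%:Z =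
     pairing mu i - k.+1%:Z + n%:Z); last by lia.
  rewrite (_ : pairing mu i + 1%:Z * -1 - k%:Z + n%:Z =
     pairing mu i - k.+1%:Z + n%:Z); last by lia.
  by move=> <-; ring.
rewrite !(wEF_ne Ux _ _ ig hy).
have [jg|jg] := eqVneq j g; last first.
  rewrite (wEF_ne Ux _ _ jg hy) (wEF_ne Ux _ _ jg (hyi n.+1)).
  rewrite (wEF_ne Ux _ _ ig hyj) (wEF_ne Ux _ _ jg (hyi 1%N)).
  rewrite (wEF_ne Ux _ _ ig hyij).
  have := Hy n.+1; rewrite wEmS wEm0 -[n.+1%:Z]natz -natr1 addrK natz => <-.
  by rewrite linearD linearZ.
subst g; rewrite (wE1F Q Ux _ _ hy) (wE1F Q Ux _ _ (hyi n.+1)).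
rewrite (wE1F Q Ux _ _ (hyi 1%N)) !linearD /= (wEF_ne Ux _ _ ig hyj).
rewrite (wEF_ne Ux _ _ ig hyij).
have := Hy n.+1; rewrite wEmS wEm0 -[n.+1%:Z]natz -natr1 addrK natz => <-.
rewrite linearD linearZ /= addrACA; congr (_ + _).
case: k {hy Hy} (hy) => [|k] hy; first by rewrite !linear0 addr0.
rewrite !linearZ /= !(wEF_ne Ux _ _ ig hy) (wEF_ne Ux _ _ ig (hyi 1%N)).
rewrite (wEE1 i hy) [wF j k (_ *: _)]linearZ /= !scalerA -scalerDl; congr (_ *: _).
rewrite !pairing_shift cij.
have := gn_three Q (pairing mu j - k%:Z) n.+1%:Z.
rewrite (_ : n.+1%:Z - 1 = n%:Z); last by lia.
move=> e; transitivity (gn (pairing mu j - k%:Z - n.+1%:Z) + gn n * gn (pairing mu j - k%:Z)).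
  by rewrite [gn n * _]mulrC; congr (gn _ + _); lia.
by rewrite e; congr (gn _ * _); lia.
Qed.

End Simple.
End Relations.

(** * Comparison of highest weight modules and the contravariant form *)

Section Graph.
Variables (R : realType) (V : vectType R) (Phi : root_system V) (Pi : base Phi).
Variable (K : fieldType).
Local Notation X := (weight Phi).
Local Notation I := 'I_(rank Pi).
Local Notation wmod := (wmod Pi K).
Variables (gb : int -> nat -> K) (la : X).
Variables (U : wmod) (v : U) (S : simple_hw gb la v).
Variables (W : wmod) (Wx : wmod_ax gb W) (Wb : below la W)
  (Wc : cogenerated la W) (w : W) (hw : wt la w).
Let Ux : wmod_ax gb U := hw_ax S.

(** The submodule of [U + W] generated by [(v, w)].  A vector [(0, y)] in it of
    degree other than [la] is killed by the [E] modulo vectors of the same kind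
    in higher degrees, so cogeneration forces [y = 0], by induction from the
    top; likewise for [(x, 0)].  Hence it is the graph of a morphism. *)
Inductive graph : X -> U -> W -> Prop :=
| graph0 mu : graph mu 0 0
| graph_top : graph la v w
| graph_lin mu c x y x' y' : graph mu x y -> graph mu x' y' ->
    graph mu (c *: x + x') (c *: y + y')
| graph_F mu i n x y : graph mu x y ->
    graph (shift mu i (- n%:Z)) (wF i n x) (wF i n y).

Lemma graph_wt mu x y : graph mu x y -> wt mu x /\ wt mu y.
Proof.
elim=> {mu x y} [mu||mu c x y x' y' _ [h1 h2] _ [h3 h4]|mu i n x y _ [h1 h2]].
- by split; [exact: (wt_sub Ux _).1|exact: (wt_sub Wx _).1].
- by split; [exact: hw_wt S|exact: hw].
- by split; [exact: (wt_sub Ux _).2|exact: (wt_sub Wx _).2].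
- by split; [exact: (wtF Ux _ _ h1)|exact: (wtF Wx _ _ h2)].
Qed.

Lemma graphZ mu c x y : graph mu x y -> graph mu (c *: x) (c *: y).
Proof. by move=> g; have := graph_lin c g (graph0 mu); rewrite !addr0. Qed.

Lemma graphD mu x y x' y' : graph mu x y -> graph mu x' y' ->
  graph mu (x + x') (y + y').
Proof. by move=> g g'; have := graph_lin 1 g g'; rewrite !scale1r. Qed.

Lemma graphB mu x y x' y' : graph mu x y -> graph mu x' y' ->
  graph mu (x - x') (y - y').
Proof.
move=> g g'; have := graph_lin (-1) g' g; by rewrite !scaleN1r ![- _ + _]addrC.
Qed.

Lemma graph_sum mu n (f : 'I_n -> U) (g : 'I_n -> W) :
  (forall i, graph mu (f i) (g i)) -> graph mu (\sum_i f i) (\sum_i g i).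
Proof.
move=> fg; elim/big_rec2: _ => [|i y x _ h]; first exact: graph0.
exact: graphD.
Qed.

Lemma graph_eq mu nu x y : graph mu x y -> mu = nu -> graph nu x y.
Proof. by move=> g <-. Qed.

(** In [E_m F_n] the [E] can be moved to the right, until they reach [v] and [w],
    which they kill. *)
Lemma graph_E mu x y : graph mu x y ->
  forall i m, graph (shift mu i m%:Z) (wE i m x) (wE i m y).
Proof.
elim=> {mu x y} [mu i m||mu c x y x' y' _ h1 _ h2 i m|mu j n x y g IH i m].
- by rewrite !linear0; exact: graph0.
- move=> i [|m].
    rewrite shift0 (wE0 Ux _ (hw_wt S)) (wE0 Wx _ hw); exact: graph_top.
  rewrite (wE_top S) // (Wb _ (wtE Wx i m.+1 hw)); first exact: graph0.
  exact: wle_shiftN.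
- by rewrite !linearP; exact: graph_lin.
have [hx hy] := graph_wt g; have [ij|ij] := eqVneq i j; last first.
  rewrite (wEF_ne Ux _ _ ij hx) (wEF_ne Wx _ _ ij hy) shiftC.
  by apply: graph_F.
subst j; rewrite (wEF Ux _ _ _ hx) (wEF Wx _ _ _ hy); apply: graph_sum => r.
apply: graphZ; rewrite /wEm; case: leqP => rm.
  apply: graph_eq (graph_F i (n - r) (IH i (m - r)%N)) _.
  by rewrite !shiftD; congr shift; have := ltn_ord r; lia.
by rewrite !linear0; exact: graph0.
Qed.

(** In degree [la] nothing but multiples of [(v, w)] arises, for the operators
    [F_n], [n > 0], would have to start above [la]. *)
Lemma graph_la mu x y : graph mu x y -> mu = la ->
  exists c, x = c *: v /\ y = c *: w.
Proof.
elim=> {mu x y} [mu _||mu c x y x' y' _ h1 _ h2 e|mu i n x y g IH e].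
- by exists 0; rewrite !scale0r.
- by exists 1; rewrite !scale1r.
- have [a [-> ->]] := h1 e; have [b [-> ->]] := h2 e.
  by exists (c * a + b); rewrite !scalerDl !scalerA.
have [hx hy] := graph_wt g; case: n e => [|n] e.
  rewrite (wF0 Ux _ hx) (wF0 Wx _ hy); apply: IH.
  by rewrite -e -[0%:Z]/(0 : int) oppr0 shift0.
exists 0; have nle : ~ wle Pi mu la.
  have -> : mu = shift la i n.+1%:Z by rewrite -e shiftD addNr shift0.
  exact: wle_shiftN.
by rewrite (hw_below S nle hx) (Wb nle hy) !linear0 !scale0r.
Qed.

Lemma graph_fun mu y : graph mu 0 y -> y = 0.
Proof.
move: mu y; apply: (@wle_ind _ _ _ Pi la) => [mu nle y /graph_wt[_ hy]|mu IH y g].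
  exact: Wb nle hy.
have [e|ne] := eqVneq mu la.
  have [c [/esym/eqP + ->]] := graph_la g e.
  by rewrite scaler_eq0 (negbTE (hw_neq0 S)) orbF => /eqP ->; rewrite scale0r.
apply: (Wc ne); first by have [] := graph_wt g.
by move=> i n n0; apply: (IH i n n0); have := graph_E g i n; rewrite linear0.
Qed.

Lemma graph_inj mu x : w != 0 -> graph mu x 0 -> x = 0.
Proof.
move=> w0; move: mu x; apply: (@wle_ind _ _ _ Pi la) => [mu nle x /graph_wt[hx _]|mu IH x g].
  exact: (hw_below S nle hx).
have [e|ne] := eqVneq mu la.
  have [c [-> /esym/eqP]] := graph_la g e.
  by rewrite scaler_eq0 (negbTE w0) orbF => /eqP ->; rewrite scale0r.
apply: (hw_cogen S ne); first by have [] := graph_wt g.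
by move=> i n n0; apply: (IH i n n0); have := graph_E g i n; rewrite linear0.
Qed.

Lemma graph_total mu x : wt mu x -> exists y, graph mu x y.
Proof.
move: mu x; apply: (hw_ind S).
- move=> mu; split=> [|c x y [x' gx] [y' gy]]; first by exists 0; exact: graph0.
  by exists (c *: x' + y'); exact: graph_lin.
- by exists w; exact: graph_top.
- by move=> mu i n x _ _ [y g]; exists (wF i n y); exact: graph_F.
Qed.

End Graph.

Section Precomposition.
Variables (K : fieldType) (U : lmodType K) (f : U -> U).

Definition precomp (phi : U -> K^o) : U -> K^o := fun x => phi (f x).

Fact precomp_linear : linear precomp.
Proof. by []. Qed.
HB.instance Definition _ := GRing.isLinear.Build K (U -> K^o) (U -> K^o) *:%R
  precomp precomp_linear.
End Precomposition.

Lemma linear_form0 (K : fieldType) (U : lmodType K) (phi : U -> K^o) :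
  linear phi -> phi 0 = 0.
Proof. by move=> lp; have := lp (-1) 0 0; rewrite scaler0 addr0 scaleN1r addNr. Qed.

Section Dual.
Variables (R : realType) (V : vectType R) (Phi : root_system V) (Pi : base Phi).
Variable (K : fieldType).
Local Notation X := (weight Phi).
Local Notation I := 'I_(rank Pi).
Local Notation wmod := (wmod Pi K).
Variables (gb : int -> nat -> K) (la : X).
Variables (U : wmod) (v : U) (S : simple_hw gb la v).
Let Ux : wmod_ax gb U := hw_ax S.

(** The linear forms on [U], with [E] and [F] acting by the transposes of [F]
    and [E]; a contravariant form on [U] is a morphism from [U] to this module. *)
Definition dual_wt (mu : X) (phi : U -> K^o) : Prop :=
  linear phi /\ forall nu x, nu != mu -> wt nu x -> phi x = 0.

Definition dual : wmod := @WMod _ _ _ Pi K (U -> K^o) dual_wt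
  (fun i n => @precomp K U (wF i n)) (fun i n => @precomp K U (wE i n)).

Lemma fun_ext_wt (phi psi : U -> K^o) : linear phi -> linear psi ->
  (forall mu x, wt mu x -> phi x = psi x) -> phi = psi.
Proof.
move=> lphi lpsi e; apply/funext; apply: (hw_span S) => //; split.
  by rewrite !linear_form0.
by move=> c x y ex ey; rewrite lphi lpsi ex ey.
Qed.

Lemma dual_ax : wmod_ax gb dual.
Proof.
have lin_comp (f : {linear U -> U}) (phi : U -> K^o) : linear phi ->
    linear (fun x => phi (f x)).
  by move=> lp c x y; rewrite linearP lp.
have sub mu : subspace (dual_wt mu).
  split; first by split=> [c x y|//]; rewrite scaler0 addr0.
  move=> c f g [lf zf] [lg zg]; split=> [d x y|nu x ne hx]; last first.
    by rewrite -[LHS]/(c *: f x + g x) (zf _ _ ne hx) (zg _ _ ne hx) scaler0 addr0.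
  rewrite -[LHS]/(c *: f _ + g _) lf lg -[(c *: f + g) x]/(c *: f x + g x).
  rewrite -[(c *: f + g) y]/(c *: f y + g y) !scalerDr addrACA !scalerA.
  by rewrite mulrC.
have wE' mu i n phi : dual_wt mu phi ->
    dual_wt (shift mu i n%:Z) (fun x => phi (wF i n x)).
  move=> [lp zp]; split; first exact: lin_comp.
  move=> nu x ne hx; apply: (zp _ _ _ (wtF Ux i n hx)); apply: contraNneq ne => <-.
  by rewrite shiftD addNr shift0.
have wF' mu i n phi : dual_wt mu phi ->
    dual_wt (shift mu i (- n%:Z)) (fun x => phi (wE i n x)).
  move=> [lp zp]; split; first exact: lin_comp.
  move=> nu x ne hx; apply: (zp _ _ _ (wtE Ux i n hx)); apply: contraNneq ne => <-.
  by rewrite shiftD subrr shift0.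
split=> //=.
- move=> mu i phi [lp zp]; apply: fun_ext_wt => //; first exact: lin_comp.
  by move=> nu x hx; rewrite /precomp (wF0 Ux _ hx).
- move=> mu i phi [lp zp]; apply: fun_ext_wt => //; first exact: lin_comp.
  by move=> nu x hx; rewrite /precomp (wE0 Ux _ hx).
- move=> mu i j m n phi ij [lp zp]; apply: fun_ext_wt.
  + by do 2!apply: (lin_comp).
  + by do 2!apply: (lin_comp).
  by move=> nu x hx; rewrite /precomp (wEF_ne Ux _ _ _ hx) // eq_sym.
move=> mu i m n phi hp; have [lp zp] := hp; apply: fun_ext_wt.
- by do 2!apply: (lin_comp).
- have : dual_wt (shift (shift mu i m) i (- n%:Z)) (\sum_(r < (minn m n).+1)
   gb (pairing mu i - n%:Z + m%:Z) r *: precomp (wE i (n - r))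
      (precomp (wF i (m - r)) phi)); last by case.
  apply: subspace_sum => // r _; apply: subspaceZ => //.
  have := wF' _ i (n - r)%N _ (wE' mu i (m - r)%N phi hp).
  rewrite !shiftD (_ : (m - r)%N%:Z - (n - r)%N%:Z = m%:Z - n%:Z) //.
  by have := ltn_ord r; lia.
move=> nu x hx; rewrite /precomp (wEF_eq Ux _ _ _ hx) fct_sumE.
have phi_sum k (f : 'I_k -> U) : phi (\sum_r f r) = \sum_r phi (f r).
  elim/big_rec2: _ => [|r y z _ <-]; first exact: linear_form0.
  by have := lp 1 (f r) z; rewrite !scale1r.
rewrite phi_sum minnC; apply: eq_bigr => r _.
have := lp (gb (pairing nu i - m%:Z + n%:Z) r) (wF i (m - r) (wE i (n - r) x)) 0.
rewrite addr0 (linear_form0 lp) addr0 => ->.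
have hz := wtF Ux i (m - r) (wtE Ux i (n - r) hx).
have [e|ne] := eqVneq (shift (shift nu i (n - r)%N) i (- (m - r)%N%:Z)) mu.
  rewrite -[RHS]/(_ *: phi _) -e shiftD pairing_shift cartan_diag; congr (gb _ _ *: _).
  by have := ltn_ord r; lia.
by rewrite -[RHS]/(_ *: phi _) (zp _ _ ne hz) !scaler0.
Qed.

Lemma dual_below : below la dual.
Proof.
move=> mu phi nle [lp zp]; apply: fun_ext_wt => // [c x y|nu x hx].
  by rewrite scaler0 addr0.
have [e|ne] := eqVneq nu mu; last exact: zp ne hx.
by rewrite (hw_below S _ hx) ?e // (linear_form0 lp).
Qed.

Variables (q : K) (gn : int -> K) (Q : qnumbers q gn gb).

(** [Gr mu x phi] says that [phi] is the pairing with [x] under the contravariant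
    form, which exists by the graph construction applied to [U], its dual and the
    coordinate along [v].  As the form is nondegenerate, an identity between the
    [F] follows from the transposed identity between the [E]. *)
Lemma form_exists : exists2 Gr : X -> U -> (U -> K^o) -> Prop,
  (forall mu x, wt mu x -> exists phi, Gr mu x phi) &
  [/\ forall mu x phi, Gr mu x phi -> linear phi,
      forall mu i n x phi, Gr mu x phi ->
        Gr (shift mu i (- n%:Z)) (wF i n x) (fun y => phi (wE i n y)),
      forall mu c x y phi psi, Gr mu x phi -> Gr mu y psi ->
        Gr mu (c *: x + y) (fun z => c *: phi z + psi z) &
      forall mu x phi, Gr mu x phi ->
        (forall nu y, wt nu y -> phi y = 0) -> x = 0].
Proof.
have [w [lw w1 wz]] := hw_coord S.
have hw : @wt _ _ _ _ _ dual la w by split=> // nu x ne; exact: wz.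
have w0 : w != 0 :> (U -> K^o).
  by apply/eqP => w0; move/eqP: w1; rewrite w0 eq_sym oner_eq0.
exists (@graph _ _ _ _ _ la U v dual w).
  by move=> mu x hx; apply: (@graph_total _ _ _ _ _ _ _ _ _ S dual w).
have lin mu x phi : graph la v (w : dual) mu x phi -> linear phi.
  by move=> g; have [_ []] := graph_wt S dual_ax hw g.
split=> //.
- by move=> mu i n x phi g; exact: (graph_F i n g).
- by move=> mu c x y phi psi gx gy; exact: (graph_lin c gx gy).
move=> mu x phi g z; apply: (graph_inj S dual_ax dual_below hw w0 (mu := mu)).
rewrite (_ : 0 = phi) //; apply: fun_ext_wt => [c a b||nu y hy].
- by rewrite scaler0 addr0.
- exact: lin g.
- by rewrite (z _ _ hy).
Qed.

(** This and the next three relations are the transposes of [wEE1], [wE1E], [wEC]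
    and [wE_serre]. *)
Lemma wF1F (i : I) mu (x : U) n : wt mu x ->
  wF i 1 (wF i n x) = gn n.+1%:Z *: wF i n.+1 x.
Proof.
move=> hx; have [Gr tot [lin GF GL inj]] := form_exists.
have [phi g] := tot _ _ hx; apply/eqP; rewrite -subr_eq0 addrC -scaleNr; apply/eqP.
have g1 := GF _ i n.+1 _ _ g.
have := GF _ i 1%N _ _ (GF _ i n _ _ g); rewrite shiftD.
rewrite (_ : - n%:Z - 1%N%:Z = - n.+1%:Z); last by lia.
move=> g2; apply: inj (GL _ (- gn n.+1%:Z) _ _ _ _ g1 g2) _ => nu y hy.
have l := lin _ _ _ g.
by rewrite -l (wEE1 Q S i hy) scaleNr addNr (linear_form0 l).
Qed.

Lemma wFF1 (i : I) mu (x : U) n : wt mu x ->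
  wF i n (wF i 1 x) = gn n.+1%:Z *: wF i n.+1 x.
Proof.
move=> hx; have [Gr tot [lin GF GL inj]] := form_exists.
have [phi g] := tot _ _ hx; apply/eqP; rewrite -subr_eq0 addrC -scaleNr; apply/eqP.
have g1 := GF _ i n.+1 _ _ g.
have := GF _ i n _ _ (GF _ i 1%N _ _ g); rewrite shiftD.
rewrite (_ : - 1%N%:Z - n%:Z = - n.+1%:Z); last by lia.
move=> g2; apply: inj (GL _ (- gn n.+1%:Z) _ _ _ _ g1 g2) _ => nu y hy.
have l := lin _ _ _ g.
by rewrite -l (wE1E Q S i hy) scaleNr addNr (linear_form0 l).
Qed.

Lemma wFC (i j : I) mu (x : U) n : i != j -> cartan i j = 0 -> cartan j i = 0 ->
  wt mu x -> wF i n (wF j 1 x) = wF j 1 (wF i n x).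
Proof.
move=> ij cij cji hx; have [Gr tot [lin GF GL inj]] := form_exists.
have [phi g] := tot _ _ hx; apply/eqP; rewrite -subr_eq0 addrC -scaleN1r; apply/eqP.
have g1 := GF _ j 1%N _ _ (GF _ i n _ _ g).
have := GF _ i n _ _ (GF _ j 1%N _ _ g); rewrite shiftC.
move=> g2; apply: inj (GL _ (- 1) _ _ _ _ g1 g2) _ => nu y hy.
by rewrite (wEC Q S ij cij cji hy) scaleN1r addNr.
Qed.

Lemma wF_serre (i j : I) mu (x : U) n : i != j ->
  cartan i j = -1 -> cartan j i = -1 -> wt mu x ->
  wF i n.+1 (wF j 1 x) =
  wF i 1 (wF j 1 (wF i n x)) - gn n%:Z *: wF j 1 (wF i n.+1 x).
Proof.
move=> ij cij cji hx; have [Gr tot [lin GF GL inj]] := form_exists.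
have [phi g] := tot _ _ hx.
have := GF _ i 1%N _ _ (GF _ j 1%N _ _ (GF _ i n _ _ g)).
have g2 := GF _ j 1%N _ _ (GF _ i n.+1 _ _ g).
have := GF _ i n.+1 _ _ (GF _ j 1%N _ _ g); rewrite shiftC => g3.
rewrite shiftC shiftD (_ : - n%:Z - 1%N%:Z = - n.+1%:Z); last by lia.
move=> g1; have := GL _ (-1) _ _ _ _ g1 (GL _ (gn n%:Z) _ _ _ _ g2 g3).
move=> G; apply/eqP; rewrite -subr_eq0; apply/eqP.
have -> : wF i n.+1 (wF j 1 x) -
    (wF i 1 (wF j 1 (wF i n x)) - gn n *: wF j 1 (wF i n.+1 x)) =
    -1 *: wF i 1 (wF j 1 (wF i n x)) +
     (gn n *: wF j 1 (wF i n.+1 x) + wF i n.+1 (wF j 1 x)).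
  by rewrite opprB scaleN1r addrA [LHS]addrC; congr (_ + _); rewrite addrC.
apply: inj G _ => nu y hy; have l := lin _ _ _ g.
have := wE_serre Q S ij cij cji hy n.+1; rewrite wEmS wEm0.
rewrite (_ : n.+1%:Z - 1 = n%:Z); last by lia.
move=> <-; rewrite [X in -1 *: phi X]addrC -l [gn n *: _ + _]addrC.
by rewrite [_ + gn n *: _]addrC scaleN1r addNr.
Qed.

End Dual.

(** * Highest weights divisible by the quantum characteristic and restricted ones *)

Section Steinberg.
Variables (R : realType) (V : vectType R) (Phi : root_system V) (Pi : base Phi).
Variable (K : fieldType).
Local Notation X := (weight Phi).
Local Notation I := 'I_(rank Pi).
Local Notation wmod := (wmod Pi K).
Variables (q : K) (q_neq0 : q != 0).
Variables (gn : int -> K) (gb : int -> nat -> K) (Q : qnumbers q gn gb).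
Variables (l : nat) (l_gt0 : (0 < l)%N) (gnl : gn l%:Z = 0)
  (gn_lt : forall m : nat, (0 < m < l)%N -> gn m%:Z != 0).

Section Frobenius.
Variables (la1 : X) (U : wmod) (v : U) (S : simple_hw gb (la1 *+ l) v).
Let Ux : wmod_ax gb U := hw_ax S.
Local Notation inL := (in_lattice Pi la1 l).

(** Outside the coset, only vectors [F_n y] with [l] not dividing [n] and [y] of
    degree in the coset come into question.  When [E_m F_n y] is expanded, the
    terms through degrees outside the coset vanish by induction, and the others
    carry a binomial [gb (l c) r] with [l] not dividing [r], which is zero.  So
    [F_n y] is killed by the [E], and vanishes by cogeneration. *)
Lemma frob_weights mu (x : U) : wt mu x -> ~ inL mu -> x = 0.
Proof.
move=> hx nL; move: mu nL x hx.
apply: (@wle_ind _ _ _ Pi (la1 *+ l)) => [mu nle _ x hx|mu IH nL x hx].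
  exact: (hw_below S nle hx).
have ne : mu != la1 *+ l by apply: contra_not_neq nL => ->; exact: in_lattice0.
apply: (hw_gen S (P := fun x => x = 0) ne) hx.
  by split=> // c y z -> ->; rewrite scaler0 addr0.
move=> i n y n0 hy.
have [L|nLi] := pselect (inL (shift mu i n%:Z)); last first.
  by rewrite (IH i n n0 nLi y hy) linear0.
have ndvd : ~ exists k, n%:Z = l%:Z * k.
  by move=> [k e]; apply: nL; apply: (in_lattice_shift (k := k)); rewrite -e; exact: L.
have hFy : wt mu (wF i n y).
  by have := wtF Ux i n hy; rewrite shiftD subrr shift0.
apply: (hw_cogen S ne hFy) => j m m0; have hE := wtE Ux j m hFy.
have [Lj|nLj] := pselect (inL (shift mu j m%:Z)); last exact: (IH j m m0 nLj _ hE).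
have [e|ji] := eqVneq j i; last first.
  by case: ndvd; apply: (in_lattice_step2 _ L Lj); rewrite eq_sym.
subst j; rewrite (wEF Ux _ _ _ hy); apply: big1 => r _.
have hm := wEm_wt Ux i m r hy; rewrite shiftD in hm.
have [rm|rm] := leqP r m; last first.
  by rewrite /wEm leqNgt rm /= linear0 scaler0.
have [Lm|nLm] := pselect (inL (shift mu i (n%:Z + (m%:Z - r%:Z)))); last first.
  have e : n%:Z + (m%:Z - r%:Z) = (n + (m - r))%N%:Z by lia.
  rewrite e in hm nLm; rewrite (IH _ _ _ nLm _ hm) ?linear0 ?scaler0 //; lia.
have [k1 e1] := in_lattice_step (mu := shift mu i n%:Z) (i := i) (n := m%:Z - n%:Z) L
   ltac:(by rewrite shiftD addrC subrK).
have [k2 e2] := in_lattice_step (mu := shift mu i m%:Z) (i := i) (n := n%:Z - r%:Z) Lj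
   ltac:(by rewrite shiftD addrCA).
have [k3 e3] := in_lattice_pairing i L.
rewrite (_ : _ - _ + _ = l%:Z * (k3 + k1)); last by rewrite mulrDr -e3 -e1; lia.
rewrite (gb_mull Q q_neq0 l_gt0 gnl gn_lt) ?scale0r //.
apply/negP => /dvdnP[k ek]; apply: ndvd; exists (k2 + k%:Z).
by rewrite mulrDr -e2 ek PoszM; lia.
Qed.

Lemma frob_E i n (x : U) : ~~ (l %| n)%N -> wE i n x = 0.
Proof.
move=> ln; apply: (hw_span S (P := fun x => wE i n x = 0)).
  by split=> [|c y z ey ez]; rewrite ?linear0 // linearP ey ez scaler0 addr0.
move=> mu {}x hx; have [L|nL] := pselect (inL mu); last first.
  by rewrite (frob_weights hx nL) linear0.
have [L'|nL'] := pselect (inL (shift mu i n%:Z)); last first.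
  exact: (frob_weights (wtE Ux i n hx) nL').
have [k e] := in_lattice_step L L'; case/negP: ln.
by apply/dvdnP; exists `|k|%N; nia.
Qed.

Lemma frob_F i n (x : U) : ~~ (l %| n)%N -> wF i n x = 0.
Proof.
move=> ln; apply: (hw_span S (P := fun x => wF i n x = 0)).
  by split=> [|c y z ey ez]; rewrite ?linear0 // linearP ey ez scaler0 addr0.
move=> mu {}x hx; have [L|nL] := pselect (inL mu); last first.
  by rewrite (frob_weights hx nL) linear0.
have [L'|nL'] := pselect (inL (shift mu i (- n%:Z))); last first.
  exact: (frob_weights (wtF Ux i n hx) nL').
have [k e] := in_lattice_step L L'; case/negP: ln.
by apply/dvdnP; exists `|k|%N; nia.
Qed.

End Frobenius.

Section Restricted.
Variables (la : X) (U : wmod) (v : U) (S : simple_hw gb la v).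
Hypothesis sl : simply_laced Pi.
Hypothesis la_restricted : forall i : I, 0 <= pairing la i < l%:Z.
Let Ux : wmod_ax gb U := hw_ax S.
Let hv := hw_wt S.

(** In [E_m F_n v] only the term [F_(n - m) v] survives.  It vanishes by induction
    if [n - m] exceeds [pairing la i], and its coefficient is a binomial
    [gb a m] with [0 <= a < m] otherwise. *)
Lemma wF_top i n : pairing la i < n%:Z -> wF i n v = 0.
Proof.
elim/ltn_ind: n => n IH pn; have /andP[p0 pl] := la_restricted i.
have n0 : (0 < n)%N by lia.
have ne : shift la i (- n%:Z) != la.
  apply/eqP => e; apply: (@wle_shiftN _ _ _ Pi la i n n0).
  rewrite -{1}e shiftD addNr shift0.
  by exists (fun=> 0%N); rewrite subrr big1.
apply: (hw_cogen S ne (wtF Ux i n hv)) => j m m0.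
have [e|ji] := eqVneq j i; last by rewrite (wEF_ne Ux _ _ ji hv) (wE_top S) // linear0.
subst j; rewrite (wEF Ux _ _ _ hv); apply: big1 => r _; rewrite /wEm.
case: leqP => rm; last by rewrite linear0 scaler0.
have [e|rm'] := eqVneq (r : nat) m; last first.
  by rewrite (wE_top S) ?linear0 ?scaler0 // subn_gt0 ltn_neqAle rm' rm.
have rn := ltn_ord r; rewrite ltnS e in rn *.
rewrite subnn (wE0 Ux _ hv); have [pm|pm] := ltrP (pairing la i) (n - m)%N%:Z.
  by rewrite IH ?scaler0 //; lia.
have -> : pairing la i - n%:Z + m%:Z = (absz (pairing la i - n%:Z + m%:Z))%:Z by lia.
by rewrite (gb_lt Q) ?scale0r //; lia.
Qed.

Inductive F1span : X -> U -> Prop :=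
| F1_zero mu : F1span mu 0
| F1_top : F1span la v
| F1_lin mu c x y : F1span mu x -> F1span mu y -> F1span mu (c *: x + y)
| F1_F mu i x : F1span mu x -> F1span (shift mu i (-1)) (wF i 1 x).

Lemma F1_wt mu x : F1span mu x -> wt mu x.
Proof.
elim=> {mu x} [mu||mu c x y _ h1 _ h2|mu i x _ h].
- exact: (wt_sub Ux _).1.
- exact: hv.
- exact: (wt_sub Ux _).2.
- exact: (wtF Ux i 1%N h).
Qed.

Lemma F1_sub mu : subspace (F1span mu).
Proof. by split; [exact: F1_zero|exact: F1_lin]. Qed.

Lemma F1_eq mu nu x : F1span mu x -> mu = nu -> F1span nu x.
Proof. by move=> g <-. Qed.

(** On [v] itself, [F_n] is a multiple of a power of [F_1], since the [gn m] with
    [0 < m <= pairing la i] are invertible and [F_n v] is zero beyond; and [F_n]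
    moves past every [F_1] by the Serre relations. *)
Lemma F1_closed mu x : F1span mu x ->
  forall i n, F1span (shift mu i (- n%:Z)) (wF i n x).
Proof.
elim=> {mu x} [mu i n||mu c x y _ h1 _ h2 i n|mu j x g IH i n].
- by rewrite linear0; exact: F1_zero.
- move=> i; elim=> [|n IH]; first by rewrite (wF0 Ux _ hv) oppr0 shift0; exact: F1_top.
  have [pn|pn] := ltrP (pairing la i) n.+1%:Z; first by rewrite wF_top //; exact: F1_zero.
  have gnn : gn n.+1%:Z != 0 by apply: gn_lt; have := la_restricted i; lia.
  rewrite -[wF i n.+1 v]scale1r -(mulVf gnn) -scalerA -(wF1F S Q i n hv).
  apply: subspaceZ (F1_sub _) _ _ _; apply: F1_eq (F1_F i IH) _.
  by rewrite shiftD; congr shift; lia.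
- by rewrite linearP; exact: F1_lin.
have hx := F1_wt g; have [e|ij] := eqVneq i j.
  subst j; rewrite (wFF1 S Q i n hx) -(wF1F S Q i n hx) shiftC.
  exact: F1_F.
have ji : j != i by rewrite eq_sym.
have [c0|c1] := cartan_off sl ij.
  rewrite (wFC S Q n ij c0 (cartan0_sym sl ij c0) hx) shiftC; exact: F1_F.
have c1' : cartan j i = -1.
  have [c0|//] := cartan_off sl ji.
  by have := cartan0_sym sl ji c0; rewrite c1.
case: n => [|n].
  by rewrite (wF0 Ux _ (wtF Ux j 1%N hx)) oppr0 shift0; exact: F1_F.
rewrite (wF_serre S Q n ij c1 c1' hx); apply: subspaceD (F1_sub _) _ _ _ _.
  apply: F1_eq (F1_F i (F1_F j (IH i n))) _.
  by rewrite [LHS]shiftC shiftD [RHS]shiftC; congr (shift (shift _ _ _) _ _); lia.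
apply: subspaceN (F1_sub _) _ _; apply: subspaceZ (F1_sub _) _ _ _.
rewrite shiftC; exact: F1_F.
Qed.

Lemma F1_all mu x : wt mu x -> F1span mu x.
Proof.
move: mu x; apply: (hw_ind S); first exact: F1_sub; first exact: F1_top.
by move=> mu i n x _ _ g; exact: F1_closed.
Qed.

Lemma hw_ind1 (P : X -> U -> Prop) :
  (forall mu, subspace (P mu)) -> P la v ->
  (forall mu i x, wt mu x -> P mu x -> P (shift mu i (-1)) (wF i 1 x)) ->
  forall mu x, wt mu x -> P mu x.
Proof.
move=> Ps Pv PF mu x /F1_all; elim=> {mu x} [mu||mu c x y _ h1 _ h2|mu i x g h].
- exact: (Ps mu).1.
- exact: Pv.
- exact: (Ps mu).2.
- exact: (PF _ _ _ (F1_wt g) h).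
Qed.

Lemma string_wt i n (x : U) : wt (shift la i (- n%:Z)) x ->
  exists c, x = c *: wF i n v.
Proof.
move=> hx; have [mu e] : exists mu, mu = shift la i (- n%:Z) by eexists.
rewrite -e in hx; have := F1_all hx => g; elim: g n e => {mu x hx}.
- by move=> mu n _; exists 0; rewrite scale0r.
- move=> [|n] e; first by exists 1; rewrite (wF0 Ux _ hv) scale1r.
  have := @wle_shiftN _ _ _ Pi la i n.+1 isT; rewrite {1}e shiftD addNr shift0.
  by case; exists (fun=> 0%N); rewrite subrr big1.
- move=> mu c x y _ h1 _ h2 n e; have [a ->] := h1 n e; have [b ->] := h2 n e.
  by exists (c * a + b); rewrite scalerDl scalerA.
move=> mu j x g h n e; have hx := F1_wt g.
have e' : mu = shift (shift la i (- n%:Z)) j 1 by rewrite -e shiftD addNr shift0.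
have [ij|ij] := eqVneq i j; last first.
  exists 0; rewrite (hw_below S _ hx) ?linear0 ?scale0r // e'.
  exact: wle_shift_off.
subst j; case: n e e' => [|n] e e'.
  exists 0; rewrite (hw_below S _ hx) ?linear0 ?scale0r // e' shiftD add0r.
  exact: (@wle_shiftN _ _ _ Pi la i 1).
have [|c ->] := h n.
  by rewrite e' shiftD; congr shift; lia.
exists (c * gn n.+1%:Z); rewrite linearZ /= (wF1F S Q i n hv) scalerA //.
Qed.

(** By the Serre relations [E_n x] is killed by all the [E_1] again, so it
    vanishes by induction from the top unless it has degree [la].  In that case
    [x] is a multiple of [F_n v], and either this is zero or [gn n] is invertible,
    so that [E_n] factors through [E_1]. *)
Lemma E1_cogenerated mu (x : U) : mu != la -> wt mu x ->
  (forall i, wE i 1 x = 0) -> x = 0.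
Proof.
move=> + hx; move: mu x hx.
apply: (@wle_ind _ _ _ Pi la) => [mu nle x hx _ _|mu IH x hx ne Ex].
  exact: (hw_below S nle hx).
apply: (hw_cogen S ne hx) => i n n0.
have hy := wtE Ux i n hx; have [e|ne'] := eqVneq (shift mu i n%:Z) la; last first.
  apply: (IH i n n0 _ hy ne') => j; have [e|ji] := eqVneq j i.
    by subst j; rewrite (wE1E Q S i hx) -(wEE1 Q S i hx) Ex linear0.
  have ij : i != j by rewrite eq_sym.
  have [c0|c1] := cartan_off sl ij.
    by rewrite (wEC Q S ij c0 (cartan0_sym sl ij c0) hx) Ex linear0.
  have c1' : cartan j i = -1.
    have [c0|//] := cartan_off sl ji.
    by have := cartan0_sym sl ji c0; rewrite c1.
  have := wE_serre Q S ij c1 c1' hx n.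
  by rewrite Ex (Ex i) !linear0 addr0.
have [pn|pn] := ltrP (pairing la i) n%:Z.
  have [|c ->] := @string_wt i n x; last by rewrite wF_top // scaler0 linear0.
  by rewrite -e shiftD subrr shift0.
have gnn : gn n%:Z != 0 by apply: gn_lt; have := la_restricted i; lia.
have := wEE1 Q S i hx n.-1; rewrite Ex linear0 prednK // => /esym/eqP.
by rewrite scaler_eq0 (negbTE gnn) => /eqP.
Qed.

End Restricted.
End Steinberg.

(** * Tensor products of vector spaces *)

Section TensorAlgebra.
Variables (K : fieldType).

Lemma scaleAC (A : lmodType K) (c d : K) (x : A) : c *: (d *: x) = d *: (c *: x).
Proof. by rewrite !scalerA mulrC. Qed.

Section Pure.
Variables (A B : lmodType K).
HB.instance Definition _ := bilinear_isBilinear.Build K A B (tensor A B) *:%R *:%R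
  (@tens K A B) (@tens_is_bilinear K A B).

Lemma tensZl c (a : A) (b : B) : tens (c *: a) b = c *: tens a b.
Proof. exact: linearZl_LR. Qed.

Lemma tensZr c (a : A) (b : B) : tens a (c *: b) = c *: tens a b.
Proof. exact: linearZr_LR. Qed.

Lemma tens0l (b : B) : tens 0 b = 0 :> tensor A B.
Proof. exact: linear0l. Qed.

Lemma tens0r (a : A) : tens a 0 = 0 :> tensor A B.
Proof. exact: linear0r. Qed.

Lemma tens_suml (J : Type) (r : seq J) (f : J -> A) (b : B) :
  tens (\sum_(i <- r) f i) b = \sum_(i <- r) tens (f i) b.
Proof. exact: linear_sumlz. Qed.

Lemma tens_sumr (J : Type) (r : seq J) (a : A) (f : J -> B) :
  tens a (\sum_(i <- r) f i) = \sum_(i <- r) tens a (f i).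
Proof. exact: linear_sumr. Qed.

Lemma tens_subl (P : tensor A B -> Prop) (b : B) : subspace P ->
  subspace (fun a => P (tens a b)).
Proof.
move=> sP; split=> [|c x y Px Py]; first by rewrite tens0l; exact: sP.1.
by rewrite linearPl /=; exact: sP.2.
Qed.

Lemma tens_subr (P : tensor A B -> Prop) (a : A) : subspace P ->
  subspace (fun b => P (tens a b)).
Proof.
move=> sP; split=> [|c x y Px Py]; first by rewrite tens0r; exact: sP.1.
by rewrite linearPr /=; exact: sP.2.
Qed.

Lemma tens_ind (P : tensor A B -> Prop) : subspace P ->
  (forall a b, P (tens a b)) -> forall x, P x.
Proof.
by move=> sP Pt x; rewrite [x]tensor_sum; apply: subspace_sum => // p _; exact: Pt.
Qed.

HB.instance Definition _ (C : lmodType K) (b : {bilinear A -> B -> C}) :=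
  GRing.isLinear.Build K (tensor A B) C *:%R (tensor_lift b)
    (@tensor_lift_linear K A B C b).

Definition slice_r_fun (phi : B -> K^o) (a : A) (b : B) : A := (phi b : K) *: a.
Fact slice_r_bilinear (phi : {linear B -> K^o}) :
  bilinear_for *:%R *:%R (slice_r_fun phi).
Proof.
split=> [b c x y|a c x y]; rewrite /slice_r_fun.
  by rewrite scalerDr; congr (_ + _); exact: scaleAC.
by rewrite linearP scalerDl; congr (_ + _); exact: (esym (scalerA c (phi x : K) a)).
Qed.
HB.instance Definition _ (phi : {linear B -> K^o}) :=
  bilinear_isBilinear.Build K A B A *:%R *:%R (slice_r_fun phi) (slice_r_bilinear phi).

Definition slice_l_fun (psi : A -> K^o) (a : A) (b : B) : B := (psi a : K) *: b.
Fact slice_l_bilinear (psi : {linear A -> K^o}) :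
  bilinear_for *:%R *:%R (slice_l_fun psi).
Proof.
split=> [b c x y|a c x y]; rewrite /slice_l_fun.
  by rewrite linearP scalerDl; congr (_ + _); exact: (esym (scalerA c (psi x : K) b)).
by rewrite scalerDr; congr (_ + _); exact: scaleAC.
Qed.
HB.instance Definition _ (psi : {linear A -> K^o}) :=
  bilinear_isBilinear.Build K A B B *:%R *:%R (slice_l_fun psi) (slice_l_bilinear psi).

Definition slice_r (phi : {linear B -> K^o}) : {linear tensor A B -> A} :=
  tensor_lift (slice_r_fun phi).
Definition slice_l (psi : {linear A -> K^o}) : {linear tensor A B -> B} :=
  tensor_lift (slice_l_fun psi).

Lemma slice_rE phi a b : slice_r phi (tens a b) = (phi b : K) *: a.
Proof. exact: tensor_lift_tens. Qed.

Lemma slice_lE psi a b : slice_l psi (tens a b) = (psi a : K) *: b.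
Proof. exact: tensor_lift_tens. Qed.
End Pure.

Section Map.
Variables (A B C D : lmodType K) (f : {linear A -> C}) (g : {linear B -> D}).
Definition tmap_fun (a : A) (b : B) : tensor C D := tens (f a) (g b).
Fact tmap_bilinear : bilinear_for *:%R *:%R tmap_fun.
Proof.
by split=> [b c x y|a c x y]; rewrite /tmap_fun linearP ?linearPl ?linearPr.
Qed.
HB.instance Definition _ := bilinear_isBilinear.Build K A B (tensor C D) *:%R *:%R
  tmap_fun tmap_bilinear.
Definition tmap : {linear tensor A B -> tensor C D} := tensor_lift tmap_fun.

Lemma tmapE a b : tmap (tens a b) = tens (f a) (g b).
Proof. exact: tensor_lift_tens. Qed.
End Map.
End TensorAlgebra.

Section SumReindex.
Variable (W : nmodType).

Lemma guard_sum N a (f : nat -> W) : (a < N)%N ->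
  \sum_(i < a.+1) f i = \sum_(i < N) if (i <= a)%N then f i else 0.
Proof. by move=> aN; rewrite (big_ord_widen N f aN) big_mkcond. Qed.

(** In the action of [E_m F_n] on a tensor, [E_k F_i] acts on the first factor
    and [E_(m-k) F_(n-i)] on the second one; contracting [r] and [s] times, the
    terms are collected by the total number [t = r + s] of contractions. *)
Lemma sum_contraction m n (G : nat -> nat -> nat -> nat -> W) :
  \sum_(i < n.+1) \sum_(k < m.+1) \sum_(r < i.+1) \sum_(s < (n - i).+1)
     (if (r <= k)%N && (s <= m - k)%N then G i k r s else 0) =
  \sum_(t < (minn m n).+1) \sum_(k < (m - t).+1) \sum_(i < (n - t).+1)
     \sum_(r < t.+1) G (i + r)%N (k + r)%N r (t - r)%N.
Proof.
pose N := (m + n).+1.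
pose c1 i k r s := [&& i <= n, k <= m, r <= i, s <= n - i, r <= k & s <= m - k]%N.
pose c2 t k i r := [&& t <= minn m n, k <= m - t, i <= n - t & r <= t]%N.
pose g i k r s := if (r <= k)%N && (s <= m - k)%N then G i k r s else 0.
pose g' t k i r := G (i + r)%N (k + r)%N r (t - r)%N.
(* With all indices below a common bound [N], the change of variables becomes
   a bijection between subsets of one finite type. *)
transitivity (\sum_(i < N) \sum_(k < N) \sum_(r < N) \sum_(s < N)
    if c1 i k r s then G i k r s else 0).
  rewrite (@guard_sum N n (fun i => \sum_(k < m.+1) \sum_(r < i.+1)
    \sum_(s < (n - i).+1) g i k r s)); last by lia.
  apply: eq_bigr => i _; rewrite /c1; case: leqP => hi /=; last first.
    by rewrite big1 // => k _; rewrite big1 // => r _; rewrite big1.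
  rewrite (@guard_sum N m (fun k => \sum_(r < i.+1)
    \sum_(s < (n - i).+1) g i k r s)); last by lia.
  apply: eq_bigr => k _; case: leqP => hk /=; last first.
    by rewrite big1 // => r _; rewrite big1.
  rewrite (@guard_sum N i (fun r => \sum_(s < (n - i).+1) g i k r s)); last by lia.
  apply: eq_bigr => r _; case: leqP => hr /=; last by rewrite big1.
  rewrite (@guard_sum N (n - i) (fun s => g i k r s)); last by lia.
  by apply: eq_bigr => s _; case: ifP.
transitivity (\sum_(t < N) \sum_(k < N) \sum_(i < N) \sum_(r < N)
    if c2 t k i r then G (i + r)%N (k + r)%N r (t - r)%N else 0); last first.
  rewrite (@guard_sum N (minn m n) (fun t => \sum_(k < (m - t).+1)
    \sum_(i < (n - t).+1) \sum_(r < t.+1) g' t k i r)); last by lia.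
  apply: eq_bigr => t _; rewrite /c2; case: leqP => ht /=; last first.
    by rewrite big1 // => k _; rewrite big1 // => r _; rewrite big1.
  rewrite (@guard_sum N (m - t) (fun k => \sum_(i < (n - t).+1)
    \sum_(r < t.+1) g' t k i r)); last by lia.
  apply: eq_bigr => k _; case: leqP => hk /=; last first.
    by rewrite big1 // => r _; rewrite big1.
  rewrite (@guard_sum N (n - t) (fun i => \sum_(r < t.+1) g' t k i r)); last by lia.
  apply: eq_bigr => i _; case: leqP => hi /=; last by rewrite big1.
  by rewrite (@guard_sum N t (fun r => g' t k i r)).
rewrite !pair_bigA /= -!big_mkcond /=.
pose h (p : 'I_N * 'I_N * 'I_N * 'I_N) : 'I_N * 'I_N * 'I_N * 'I_N :=
  (inord (p.1.2 + p.2), inord (p.1.1.2 + p.2), p.2, inord (p.1.1.1 - p.2)).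
pose h' (p : 'I_N * 'I_N * 'I_N * 'I_N) : 'I_N * 'I_N * 'I_N * 'I_N :=
  (inord (p.1.2 + p.2), inord (p.1.1.2 - p.1.2), inord (p.1.1.1 - p.1.2), p.1.2).
have inordE (x : nat) : (inord x : 'I_N) = (if x < N then x else 0)%N :> nat.
  by rewrite /inord val_insubd.
have EN : N = (m + n).+1 by [].
have Nlt (x : 'I_N) : (x < N)%N by [].
rewrite (reindex_onto h h') /=; last first.
  move=> [[[i k] r] s] /= /andP[hi /and5P[hk hr hs rk sk]]; rewrite /h /h' /=.
  have := Nlt i; have := Nlt k => Nk Ni.
  have eK (x : nat) : (x < N)%N -> (inord x : 'I_N) = x :> nat.
    by move=> xN; rewrite inordE xN.
  congr (_, _, _, _); apply: val_inj => /=.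
  - by rewrite eK eK; lia.
  - by rewrite eK eK; lia.
  - by rewrite eK eK; lia.
apply: eq_big => [[[[t k] i] r]|[[[t k] i] r]] /=.
  have := Nlt t; have := Nlt k; have := Nlt i; have := Nlt r => Nr Ni Nk Nt.
  rewrite /h' /h /= !xpair_eqE -!val_eqE /= !inordE eqxx andbT.
  have -> : (t - r < N)%N by lia.
  have -> : (r + (t - r) < N)%N by lia.
  have c2F : (N <= i + r)%N || (N <= k + r)%N -> c2 t k i r = false.
    by move=> ov; apply/negP => /and4P[]; lia.
  case: (ltnP (i + r) N) => ir; last first.
    rewrite c2F ?ir // /c1; apply/negP => /andP[/and5P[_ _ r0 _ _] /andP[_]].
    by rewrite sub0n /= => /eqP; lia.
  case: (ltnP (k + r) N) => kr; last first.
    rewrite c2F ?kr ?orbT // /c1; apply/negP => /andP[/and5P[_ _ _ _ /andP[r0 _]]].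
    by case/andP=> /andP[_]; rewrite sub0n /= => /eqP; lia.
  rewrite !addnK Ni Nk !eqxx /= !andbT /c1 /c2.
  clear -r; apply/idP/idP => [/andP[/and5P[? ? ? ? /andP[? ?]] /eqP ?]|/and4P[? ? ? ?]].
    by apply/and4P; split; lia.
  by apply/andP; split; [apply/and5P; split; [..|apply/andP; split]|apply/eqP]; lia.
move=> /andP[]; have := Nlt t; have := Nlt k; have := Nlt i; have := Nlt r => Nr Ni Nk Nt.
rewrite /c1 /= !inordE; do ?case: ifP => ?; move=> H _; congr G; lia.
Qed.
End SumReindex.

(** * The coproduct action on a tensor product *)

Section TensorModule.
Variables (R : realType) (V : vectType R) (Phi : root_system V) (Pi : base Phi).
Variable (K : fieldType).
Local Notation X := (weight Phi).
Local Notation I := 'I_(rank Pi).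
Local Notation wmod := (wmod Pi K).
Variables (q : K) (q_neq0 : q != 0).
Variables (gn : int -> K) (gb : int -> nat -> K) (Q : qnumbers q gn gb).
Variables (A B : wmod) (Ax : wmod_ax gb A) (Bx : wmod_ax gb B).
Hypothesis sl : simply_laced Pi.
Variables (KA : I -> int -> {linear A -> A}) (KB : I -> int -> {linear B -> B}).
Hypothesis KAE : forall i n mu x, wt mu x -> KA i n x = q ^ (n * pairing mu i) *: x.
Hypothesis KBE : forall i n mu x, wt mu x -> KB i n x = q ^ (n * pairing mu i) *: x.

(** The coproduct of the quantized enveloping algebra.  The operators [KA i n]
    and [KB i n] are the actions of [K_i^n], known on homogeneous vectors. *)
Definition tE_fun i n (y : tensor A B) : tensor A B := \sum_(k < n.+1)
  q ^+ (k * (n - k)) *: tmap (wE i k) (wE i (n - k)) (tmap (KA i (n - k)%N%:Z) idfun y).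

Definition tF_fun i n (y : tensor A B) : tensor A B := \sum_(k < n.+1)
  q ^+ (k * (n - k)) *: tmap (wF i k) (wF i (n - k)) (tmap idfun (KB i (- k%:Z)) y).

Fact tE_linear i n : linear (tE_fun i n).
Proof.
move=> c x y; rewrite /tE_fun scaler_sumr -big_split; apply: eq_bigr => k _.
by rewrite !linearP.
Qed.
HB.instance Definition _ i n := GRing.isLinear.Build K (tensor A B) (tensor A B)
  *:%R (tE_fun i n) (@tE_linear i n).

Fact tF_linear i n : linear (tF_fun i n).
Proof.
move=> c x y; rewrite /tF_fun scaler_sumr -big_split; apply: eq_bigr => k _.
by rewrite !linearP.
Qed.
HB.instance Definition _ i n := GRing.isLinear.Build K (tensor A B) (tensor A B)
  *:%R (tF_fun i n) (@tF_linear i n).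

(** The span of the tensors of homogeneous vectors of total degree [mu]. *)
Definition tensor_wt (mu : X) (y : tensor A B) : Prop :=
  forall P : tensor A B -> Prop, subspace P ->
    (forall nu nu' a b, wt nu a -> wt nu' b -> nu + nu' = mu -> P (tens a b)) -> P y.

Definition tensor_mod : wmod := @WMod _ _ _ Pi K (tensor A B) tensor_wt tE_fun tF_fun.

Lemma tE_tens i n mu nu (a : A) (b : B) : wt mu a -> wt nu b ->
  tE_fun i n (tens a b) = \sum_(k < n.+1)
    q ^ ((k * (n - k))%N%:Z + (n - k)%N%:Z * pairing mu i) *:
    tens (wE i k a) (wE i (n - k) b).
Proof.
move=> ha hb; apply: eq_bigr => k _; rewrite !tmapE (KAE _ _ ha) linearZ /= tensZl.
by rewrite scalerA expfzDr.
Qed.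

Lemma tF_tens i n mu nu (a : A) (b : B) : wt mu a -> wt nu b ->
  tF_fun i n (tens a b) = \sum_(k < n.+1)
    q ^ ((k * (n - k))%N%:Z - k%:Z * pairing nu i) *:
    tens (wF i k a) (wF i (n - k) b).
Proof.
move=> ha hb; apply: eq_bigr => k _; rewrite !tmapE (KBE _ _ hb) linearZ /= tensZr.
by rewrite scalerA expfzDr // mulNr.
Qed.

Lemma tensor_wt_sub mu : subspace (tensor_wt mu).
Proof.
split=> [P sP _|c x y hx hy P sP Pt]; first exact: sP.1.
by apply: sP.2; [exact: hx|exact: hy].
Qed.

Lemma tensor_wt_tens mu nu a b : wt mu a -> wt nu b -> tensor_wt (mu + nu) (tens a b).
Proof. by move=> ha hb P sP Pt; exact: (Pt _ _ _ _ ha hb erefl). Qed.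

Lemma tensor_wt_eq mu nu x : tensor_wt mu x -> mu = nu -> tensor_wt nu x.
Proof. by move=> h <-. Qed.

Lemma subspace_preim (U W : lmodType K) (f : {linear U -> W}) (P : W -> Prop) :
  subspace P -> subspace (fun x => P (f x)).
Proof.
move=> sP; split=> [|c x y Px Py]; first by rewrite linear0; exact: sP.1.
by rewrite linearP; exact: sP.2.
Qed.

Lemma subspace_eq (U W : lmodType K) (f g : {linear U -> W}) :
  subspace (fun x => f x = g x).
Proof. by split=> [|c x y ex ey]; rewrite ?linear0 // !linearP ex ey. Qed.

(** Expanding [E_m F_n] on both factors and fixing the total number of
    contractions leaves a sum of products of two binomials, with exactly the
    powers of [q] for which [q_vandermonde] evaluates it. *)
Lemma tensor_ax : wmod_ax gb tensor_mod.
Proof.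
split=> /=.
- exact: tensor_wt_sub.
- move=> mu i n x hx; apply: (hx (fun x => tensor_wt (shift mu i n%:Z) (tE_fun i n x))).
    exact: (subspace_preim (tE_fun i n) (tensor_wt_sub _)).
  move=> nu nu' a b ha hb <-; rewrite (tE_tens _ _ ha hb).
  apply: (subspace_sum (tensor_wt_sub _)) => k _.
  apply: (subspaceZ (tensor_wt_sub _)).
  apply: tensor_wt_eq (tensor_wt_tens (wtE Ax i k ha) (wtE Bx i (n - k) hb)) _.
  rewrite -shift_addl -shift_addr shiftD; congr shift.
  by have := ltn_ord k; lia.
- move=> mu i n x hx; apply: (hx (fun x => tensor_wt (shift mu i (- n%:Z)) (tF_fun i n x))).
    exact: (subspace_preim (tF_fun i n) (tensor_wt_sub _)).
  move=> nu nu' a b ha hb <-; rewrite (tF_tens _ _ ha hb).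
  apply: (subspace_sum (tensor_wt_sub _)) => k _.
  apply: (subspaceZ (tensor_wt_sub _)).
  apply: tensor_wt_eq (tensor_wt_tens (wtF Ax i k ha) (wtF Bx i (n - k) hb)) _.
  rewrite -shift_addl -shift_addr shiftD; congr shift.
  by have := ltn_ord k; lia.
- move=> mu i x hx; apply: (hx (fun x => tE_fun i 0 x = x)).
    exact: (subspace_eq (tE_fun i 0) idfun).
  move=> nu nu' a b ha hb _; rewrite (tE_tens _ _ ha hb) big_ord1 /= mul0n mul0r.
  by rewrite scale1r (wE0 Ax _ ha) (wE0 Bx _ hb).
- move=> mu i x hx; apply: (hx (fun x => tF_fun i 0 x = x)).
    exact: (subspace_eq (tF_fun i 0) idfun).
  move=> nu nu' a b ha hb _; rewrite (tF_tens _ _ ha hb) big_ord1 /= mul0n mul0r.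
  by rewrite scale1r (wF0 Ax _ ha) (wF0 Bx _ hb).
- move=> mu i j m n x ij hx.
  apply: (hx (fun x => tE_fun i m (tF_fun j n x) = tF_fun j n (tE_fun i m x))).
    exact: (subspace_eq (tE_fun i m \o tF_fun j n) (tF_fun j n \o tE_fun i m)).
  move=> nu nu' a b ha hb _; rewrite (tE_tens _ _ ha hb) (tF_tens _ _ ha hb).
  transitivity (\sum_(k < n.+1) \sum_(h < m.+1)
      q ^ ((k * (n - k))%N%:Z + (h * (m - h))%N%:Z - k%:Z * pairing nu' j +
           (m - h)%N%:Z * (pairing nu i - k%:Z * cartan j i)) *:
      tens (wF j k (wE i h a)) (wF j (n - k) (wE i (m - h) b))).
    rewrite /= linear_sum; apply: eq_bigr => k _.
    have hFa := wtF Ax j k ha; have hFb := wtF Bx j (n - k) hb.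
    rewrite linearZ /= (tE_tens _ _ hFa hFb) scaler_sumr; apply: eq_bigr => h _.
    rewrite (wEF_ne Ax _ _ ij ha) (wEF_ne Bx _ _ ij hb) scalerA -expfzDr //.
    by rewrite pairing_shift; congr (q ^ _ *: _); lia.
  rewrite exchange_big /= linear_sum; apply: eq_bigr => h _.
  have hEa := wtE Ax i h ha; have hEb := wtE Bx i (m - h) hb.
  rewrite linearZ /= (tF_tens _ _ hEa hEb) scaler_sumr; apply: eq_bigr => k _.
  rewrite scalerA -expfzDr // pairing_shift (cartan_sym j i sl).
  by congr (q ^ _ *: _); lia.
move=> mu i m n x hx; apply: (hx (fun x => tE_fun i m (tF_fun i n x) =
  \sum_(r < (minn m n).+1) gb (pairing mu i - n%:Z + m%:Z) r *:
     tF_fun i (n - r) (tE_fun i (m - r) x))).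
  split=> [|c y z ey ez].
    by rewrite !linear0 big1 // => r _; rewrite !linear0.
  rewrite (linearP (tF_fun i n)) (linearP (tE_fun i m)) /= ey ez scaler_sumr.
  rewrite -big_split; apply: eq_bigr => r _ /=.
  by rewrite !linearP.
move=> nu nu' a b ha hb <-.
pose pa := pairing nu i; pose pb := pairing nu' i.
pose T i' k' j' h' := tens (wF i i' (wE i k' a)) (wF i j' (wE i h' b)).
pose e i' k' j' h' : int := (i' * j')%N%:Z + (k' * h')%N%:Z - i'%:Z * (pb + 2 * h'%:Z) +
   h'%:Z * pa.
pose G i' k r s := (q ^ ((i' * (n - i'))%N%:Z - i'%:Z * pb + (k * (m - k))%N%:Z +
     (m - k)%N%:Z * (pa - 2 * i'%:Z)) *
   (gb (pa - i'%:Z + k%:Z) r * gb (pb - (n - i')%N%:Z + (m - k)%N%:Z) s)) *: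
   T (i' - r)%N (k - r)%N (n - i' - s)%N (m - k - s)%N.
transitivity (\sum_(i' < n.+1) \sum_(k < m.+1) \sum_(r < i'.+1) \sum_(s < (n - i').+1)
     (if (r <= k)%N && (s <= m - k)%N then G i' k r s else 0)).
  rewrite (tF_tens _ _ ha hb) linear_sum; apply: eq_bigr => i' _.
  have hFa := wtF Ax i i' ha; have hFb := wtF Bx i (n - i') hb.
  rewrite linearZ /= (tE_tens _ _ hFa hFb) scaler_sumr; apply: eq_bigr => k _.
  rewrite (wEF Ax _ _ _ ha) (wEF Bx _ _ _ hb) tens_suml !scaler_sumr.
  apply: eq_bigr => r _; rewrite tens_sumr !scaler_sumr; apply: eq_bigr => s _.
  rewrite tensZl tensZr !scalerA -!expfzDr // pairing_shift cartan_diag /wEm.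
  case: leqP => _ /=; last by rewrite linear0 tens0l scaler0.
  case: leqP => _ /=; last by rewrite linear0 tens0r scaler0.
  by rewrite /G /T -/pa -/pb; congr ((q ^ _ * _) *: _); lia.
rewrite sum_contraction; apply: eq_bigr => t _.
have tm : (t <= m)%N by have := ltn_ord t; lia.
have tn : (t <= n)%N by have := ltn_ord t; lia.
rewrite (tE_tens _ _ ha hb) [tF_fun _ _ _]linear_sum scaler_sumr; apply: eq_bigr => k _.
have hEa := wtE Ax i k ha; have hEb := wtE Bx i (m - t - k) hb.
have kt : (k <= m - t)%N by have := ltn_ord k; lia.
rewrite linearZ /= (tF_tens _ _ hEa hEb) !scaler_sumr; apply: eq_bigr => i' _.
have it : (i' <= n - t)%N by have := ltn_ord i'; lia.
rewrite /G; transitivity (\sum_(r < t.+1) (q ^ ((k * (m - t - k))%N%:Z + (m - t - k)%N%:Z * pa +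
   ((i' * (n - t - i'))%N%:Z - i'%:Z * (pb + (m - t - k)%N%:Z * 2))) *
  (q ^ ((t - r)%N%:Z * (pa - i'%:Z + k%:Z) - r%:Z * (pb - (n - t - i')%N%:Z + (m - t - k)%N%:Z)) *
  (gb (pa - i'%:Z + k%:Z) r * gb (pb - (n - t - i')%N%:Z + (m - t - k)%N%:Z) (t - r)))) *:
   T i' k (n - t - i')%N (m - t - k)%N).
  apply: eq_bigr => r _; have rt : (r <= t)%N by have := ltn_ord r; lia.
  rewrite !addnK mulrA -expfzDr //.
  have -> : (n - (i' + r) - (t - r) = n - t - i')%N by lia.
  have -> : (m - (k + r) - (t - r) = m - t - k)%N by lia.
  have -> : pa - (i' + r)%N%:Z + (k + r)%N%:Z = pa - i'%:Z + k%:Z by lia.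
  have -> : pb - (n - (i' + r))%N%:Z + (m - (k + r))%N%:Z =
    pb - (n - t - i')%N%:Z + (m - t - k)%N%:Z by lia.
  congr ((q ^ _ * _) *: _).
  have -> : (n - (i' + r) = n - t - i' + (t - r))%N by lia.
  have -> : (m - (k + r) = m - t - k + (t - r))%N by lia.
  move: (n - t - i')%N (m - t - k)%N (t - r)%N => u w s.
  by rewrite !PoszM !PoszD; ring.
rewrite -scaler_suml -mulr_sumr (q_vandermonde Q q_neq0) !scalerA -mulrA -!expfzDr //.
rewrite mulrC pairing_shift cartan_diag pairingD -/pa -/pb.
by congr ((gb _ _ * q ^ _) *: _); lia.
Qed.

End TensorModule.

(** * Generation and cogeneration of the tensor product *)

(** The vectors of a finite list involve only finitely many coordinates; with
    this a tensor is recovered from its contractions with linear forms on the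
    second factor. *)
Definition finite_coordinates (K : fieldType) (B : lmodType K) : Prop :=
  forall s : seq B, exists t : seq (B * {linear B -> K^o}),
    forall b, b \in s -> b = \sum_(p <- t) (p.2 b : K) *: p.1.

Section TensorSimple.
Variables (R : realType) (V : vectType R) (Phi : root_system V) (Pi : base Phi).
Variable (K : fieldType).
Local Notation X := (weight Phi).
Local Notation I := 'I_(rank Pi).
Local Notation wmod := (wmod Pi K).
Variables (q : K) (q_neq0 : q != 0).
Variables (gn : int -> K) (gb : int -> nat -> K) (Q : qnumbers q gn gb).
Variables (l : nat) (l_gt0 : (0 < l)%N) (gnl : gn l%:Z = 0)
  (gn_lt : forall m : nat, (0 < m < l)%N -> gn m%:Z != 0).
Hypothesis sl : simply_laced Pi.
Variables (A B : wmod) (la0 la1 : X) (vA : A) (vB : B).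
Variables (SA : simple_hw gb la0 vA) (SB : simple_hw gb (la1 *+ l) vB).
Hypothesis la0_restricted : forall i : I, 0 <= pairing la0 i < l%:Z.
Variables (KA : I -> int -> {linear A -> A}) (KB : I -> int -> {linear B -> B}).
Hypothesis KAE : forall i n mu x, wt mu x -> KA i n x = q ^ (n * pairing mu i) *: x.
Hypothesis KBE : forall i n mu x, wt mu x -> KB i n x = q ^ (n * pairing mu i) *: x.
Let Ax : wmod_ax gb A := hw_ax SA.
Let Bx : wmod_ax gb B := hw_ax SB.
Local Notation T := (tensor_mod q KA KB).
Local Notation tE := (tE_fun q KA).
Local Notation tF := (tF_fun q KB).
Let la := la0 + la1 *+ l.

Lemma tensor_hwt : @wt _ _ _ _ _ T la (tens vA vB).
Proof. exact: tensor_wt_tens (hw_wt SA) (hw_wt SB). Qed.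

Lemma tensor_below : below la T.
Proof.
move=> mu y nle hy; apply: (hy (fun y => y = 0)).
  by split=> // c x z -> ->; rewrite scaler0 addr0.
move=> nu nu' a b ha hb e; have [h|h] := pselect (wle Pi nu la0); last first.
  by rewrite (hw_below SA h ha) tens0l.
have [h'|h'] := pselect (wle Pi nu' (la1 *+ l)); last first.
  by rewrite (hw_below SB h' hb) tens0r.
by case: nle; rewrite -e; exact: wleD.
Qed.

Lemma tensor_hw_neq0 : tens vA vB != 0.
Proof.
have [phi [lphi phi1 _]] := hw_coord SA.
pose phiL : {linear A -> K^o} := HB.pack phi (GRing.isLinear.Build _ _ _ _ phi lphi).
apply/eqP => /(congr1 (slice_l B phiL)); rewrite slice_lE linear0 [phiL vA]phi1.
by rewrite scale1r => /eqP; apply/negP; exact: hw_neq0 SB.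
Qed.

Lemma tensor_span (P : tensor A B -> Prop) : subspace P ->
  (forall mu nu (a : A) (b : B), wt mu a -> wt nu b -> P (tens a b)) -> forall y, P y.
Proof.
move=> sP Pt; apply: tens_ind => // a b.
apply: (hw_span SA (P := fun a => P (tens a b))); first exact: tens_subl.
move=> mu {}a ha; apply: (hw_span SB (P := fun b => P (tens a b))).
  exact: tens_subr.
by move=> nu {}b hb; exact: Pt ha hb.
Qed.

Let l1 : ~~ (l %| 1)%N.
Proof. by rewrite dvdn1; have := l_gt1 Q l_gt0 gnl; case: (l) => [|[]]. Qed.

(** The operators of index [1] vanish on [B], where only multiples of [l] count. *)
Lemma tE1 i (y : tensor A B) : tE i 1 y = tmap (wE i 1) idfun y.
Proof.
apply: (tensor_span (P := fun y => tE i 1 y = tmap (wE i 1) idfun y)).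
  exact: (subspace_eq (tE i 1) (tmap (wE i 1) idfun)).
move=> mu nu a b ha hb; rewrite (tE_tens q_neq0 KAE _ _ ha hb).
rewrite !big_ord_recl big_ord0 /= addr0 tmapE.
rewrite (frob_E q_neq0 Q l_gt0 gnl gn_lt SB) // tens0r scaler0 add0r.
by rewrite subnn mul0r scale1r (wE0 Bx _ hb).
Qed.

Lemma tF1 i mu nu (a : A) (b : B) : wt mu a -> wt nu b ->
  tF i 1 (tens a b) = q ^ (- pairing nu i) *: tens (wF i 1 a) b.
Proof.
move=> ha hb; rewrite (tF_tens q_neq0 KBE _ _ ha hb).
rewrite !big_ord_recl big_ord0 /= addr0.
rewrite (frob_F q_neq0 Q l_gt0 gnl gn_lt SB) // tens0r scaler0 add0r.
by rewrite subnn (wF0 Bx _ hb) sub0r mul1r.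
Qed.

Lemma tE_top i n (b : B) :
  tE i n (tens vA b) = q ^ (n%:Z * pairing la0 i) *: tens vA (wE i n b).
Proof.
apply: (hw_span SB (P := fun b => tE i n (tens vA b) =
   q ^ (n%:Z * pairing la0 i) *: tens vA (wE i n b))).
  split=> [|c x y ex ey]; first by rewrite linear0 !tens0r linear0 scaler0.
  rewrite linearPr (linearP (tE i n)) /= ex ey (linearP (wE i n)) linearPr /=.
  by rewrite scalerDr scaleAC.
move=> nu {}b hb; rewrite (tE_tens q_neq0 KAE _ _ (hw_wt SA) hb).
rewrite big_ord_recl big1 ?addr0 /=; last first.
  by move=> k _; rewrite (wE_top SA) // tens0l scaler0.
by rewrite mul0n add0r subn0 (wE0 Ax _ (hw_wt SA)).
Qed.

(** The other terms involve [F_k vA] and [F_(n - k) b] with [k > 0].  If [l]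
    divides [k], then [k] exceeds [pairing la0 i] and the first one vanishes;
    otherwise [l] does not divide [n - k] and the second one vanishes. *)
Lemma tF_top i n nu (b : B) : (l %| n)%N -> wt nu b ->
  tF i n (tens vA b) = tens vA (wF i n b).
Proof.
move=> ln hb; rewrite (tF_tens q_neq0 KBE _ _ (hw_wt SA) hb).
rewrite big_ord_recl big1 ?addr0 /=; last first.
  move=> k _; rewrite /bump /=; set k' := (1 + k)%N.
  have kn : (k' <= n)%N by rewrite /k'; have := ltn_ord k; lia.
  have [lk|lk] := boolP (l %| k')%N.
    rewrite (wF_top q_neq0 Q l_gt0 SA la0_restricted) ?tens0l ?scaler0 //.
    have := la0_restricted i; have := dvdn_leq (isT : (0 < k')%N) lk; lia.
  rewrite (frob_F q_neq0 Q l_gt0 gnl gn_lt SB) ?tens0r ?scaler0 //.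
  by apply: contra lk => d; rewrite -(dvdn_addr _ d) subnK.
by rewrite mul0n mul0r subr0 expr0z scale1r subn0 (wF0 Ax _ (hw_wt SA)).
Qed.

(** Starting from the top, [tF_top] generates all the tensors [tens vA b]; from
    these the [F] of index [1], which act on the first factor only, reach all
    [tens a b] because [A] is generated by them. *)
Lemma tensor_ind (P : X -> tensor A B -> Prop) :
  (forall mu, subspace (P mu)) -> P la (tens vA vB) ->
  (forall mu i n y, tensor_wt mu y -> P mu y -> P (shift mu i (- n%:Z)) (tF i n y)) ->
  forall mu y, tensor_wt mu y -> P mu y.
Proof.
move=> sP Pv PF mu y hy; apply: (hy (P mu)) => // nu nu' a b ha hb <-.
have Pb : P (la0 + nu') (tens vA b).
  move: nu' b hb; apply: (hw_ind SB (P := fun nu' b => P (la0 + nu') (tens vA b))).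
  - by move=> nu'; exact: tens_subr.
  - exact: Pv.
  move=> nu' i n b n0 hb Pb; have [ln|ln] := boolP (l %| n)%N; last first.
    by rewrite (frob_F q_neq0 Q l_gt0 gnl gn_lt SB) // tens0r; exact: (sP _).1.
  rewrite -(tF_top i ln hb) -shift_addr; apply: PF => //.
  exact: tensor_wt_tens (hw_wt SA) hb.
move: nu a ha; apply: (hw_ind1 q_neq0 Q l_gt0 gn_lt SA sl la0_restricted
    (P := fun nu a => P (nu + nu') (tens a b))) => // [nu|nu i a ha Pa].
  exact: tens_subl.
have c0 : q ^ (- pairing nu' i) != 0 by rewrite expfz_neq0.
rewrite -[tens _ _]scale1r -(mulVf c0) -scalerA -(tF1 i ha hb).
apply: subspaceZ => //; rewrite -shift_addl.
by apply: (PF _ i 1%N) => //; exact: tensor_wt_tens.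
Qed.

Hypothesis cogA : forall a : A, (forall i, wE i 1 a = 0) -> exists c, a = c *: vA.
Hypothesis cogB : forall b : B, (forall i n, (0 < n)%N -> wE i n b = 0) ->
  exists c, b = c *: vB.
Hypothesis fcB : finite_coordinates B.

(** The [E] of index [1] act on the first factor only, so they kill every
    contraction of [y] with a linear form on the second factor. *)
Lemma tensor_E1_killed (y : tensor A B) : (forall i, tE i 1 y = 0) ->
  exists b, y = tens vA b.
Proof.
move=> Ey; have [t tE] := fcB [seq p.2 | p <- repr y].
have slE (k : B * {linear B -> K^o}) :
    slice_r A k.2 y = \sum_(p <- repr y) (k.2 p.2 : K) *: p.1.
  by rewrite {1}[y]tensor_sum linear_sum; apply: eq_bigr => p _; exact: slice_rE.
have yE : y = \sum_(k <- t) tens (slice_r A k.2 y) k.1.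
  rewrite {1}[y]tensor_sum; under [RHS]eq_bigr => k _ do rewrite slE tens_suml.
  rewrite exchange_big /= big_seq [RHS]big_seq; apply: eq_bigr => p py.
  rewrite {1}(tE p.2 (map_f snd py)) tens_sumr; apply: eq_bigr => k _.
  by rewrite tensZl tensZr.
have kil (k : B * {linear B -> K^o}) i : wE i 1 (slice_r A k.2 y) = 0.
  have -> : wE i 1 (slice_r A k.2 y) = slice_r A k.2 (tmap (wE i 1) idfun y).
    apply: (tens_ind (P := fun y => wE i 1 (slice_r A k.2 y) =
      slice_r A k.2 (tmap (wE i 1) idfun y))).
      exact: (subspace_eq (wE i 1 \o slice_r A k.2)
        (slice_r A k.2 \o tmap (wE i 1) idfun)).
    by move=> a b; rewrite tmapE !slice_rE linearZ.
  by rewrite -tE1 Ey linear0.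
have /choice[c cE] k := cogA (kil k).
exists (\sum_(k <- t) c k *: k.1); rewrite {1}yE tens_sumr; apply: eq_bigr => k _.
by rewrite cE tensZl tensZr.
Qed.

(** A vector killed by all the [E] is [tens vA b], and [b] is killed by all the
    [E] as well, so [b] is a multiple of [vB]. *)
Lemma tensor_cogen : cogenerated la T.
Proof.
move=> mu y ne hy Ey; have [b yE] := tensor_E1_killed (fun i => Ey i 1%N isT).
have [phi [lphi phi1 phi0]] := hw_coord SA.
have [psi [lpsi psi1 psi0]] := hw_coord SB.
pose phiL : {linear A -> K^o} := HB.pack phi (GRing.isLinear.Build _ _ _ _ phi lphi).
pose psiL : {linear B -> K^o} := HB.pack psi (GRing.isLinear.Build _ _ _ _ psi lpsi).
have [|c bE] := @cogB b.
  move=> i n n0; have := Ey i n n0; rewrite yE /= tE_top => /eqP.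
  rewrite scaler_eq0 expfz_eq0 (negbTE q_neq0) andbF /= => /eqP.
  move=> /(congr1 (slice_l B phiL)); rewrite slice_lE linear0.
  by rewrite [phiL vA]phi1 scale1r.
pose chi (y : tensor A B) : K^o := psiL (slice_l B phiL y).
have chi0 : chi y = 0.
  apply: (hy (fun y => chi y = 0)).
    split=> [|d x z ex ez]; first by rewrite /chi !linear0.
    by rewrite /chi !linearP [X in _ *: X]ex [X in _ + X]ez scaler0 addr0.
  move=> nu nu' a b' ha hb e; rewrite /chi slice_lE.
  have [e0|ne0] := eqVneq nu la0.
    rewrite linearZ /= (psi0 nu') ?scaler0 //; apply: contraNneq ne => e1.
    by rewrite -e e0 e1.
  by rewrite [phiL a](phi0 _ _ ne0 ha) scale0r linear0.
move: chi0; rewrite yE bE tensZr /chi !linearZ /= slice_lE [phiL vA]phi1 scale1r psi1.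
by rewrite -[c *: 1]/(c * 1) mulr1 => ->; rewrite scale0r.
Qed.

End TensorSimple.

Local Open Scope classical_set_scope.

(** * The total space of a graded object *)

Section TotalSpace.
Variables (R : realType) (V : vectType R) (Phi : root_system V) (Pi : base Phi).
Variable (K : fieldType).
Local Notation X := (weight Phi).
Local Notation I := 'I_(rank Pi).

Section Regrade.
Variable G : graded Phi K.
Local Notation rg := (@regrade _ _ _ _ G _).

Lemma regrade_id mu (x : G mu) : rg mu x = x.
Proof.
by rewrite /regrade; case: eqP => // e; rewrite [e](eq_irrelevance e erefl).
Qed.

Lemma regrade_ne mu nu (x : G mu) : mu != nu -> rg nu x = 0.
Proof. by rewrite /regrade; case: eqP. Qed.

Fact regrade_linear mu nu : linear (@regrade _ _ _ _ G mu nu).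
Proof.
move=> c x y; have [e|ne] := eqVneq mu nu.
  by case: _ / e; rewrite !regrade_id.
by rewrite !regrade_ne // scaler0 addr0.
Qed.
HB.instance Definition _ mu nu :=
  GRing.isLinear.Build K (G mu) (G nu) *:%R (@regrade _ _ _ _ G mu nu) (@regrade_linear mu nu).

Definition tot : lmodType K := @dirsum K X G.

Fact single_finite mu (x : G mu) : finite_set [set nu | rg nu x != 0].
Proof.
apply: (@sub_finite_set _ _ [set mu]) => [nu /= h|]; last exact: finite_set1.
by apply/esym/eqP; apply: contraNT h => ne; rewrite regrade_ne.
Qed.

Definition single mu (x : G mu) : tot := Dirsum (single_finite x).

Fact single_linear mu : linear (@single mu).
Proof. by move=> c x y; apply: dirsum_ext => nu /=; rewrite linearP. Qed.
HB.instance Definition _ mu :=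
  GRing.isLinear.Build K (G mu) tot *:%R (@single mu) (@single_linear mu).

Definition ev mu (f : tot) : G mu := f mu.
Fact ev_linear mu : linear (@ev mu).
Proof. by []. Qed.
HB.instance Definition _ mu :=
  GRing.isLinear.Build K tot (G mu) *:%R (@ev mu) (@ev_linear mu).

Lemma tot_ext (f g : tot) : (forall nu, ev nu f = ev nu g) -> f = g.
Proof. exact: dirsum_ext. Qed.

Lemma ev_single mu (x : G mu) : ev mu (single x) = x.
Proof. exact: regrade_id. Qed.

Lemma ev_single_ne mu nu (x : G mu) : mu != nu -> ev nu (single x) = 0.
Proof. exact: regrade_ne. Qed.

Lemma single_inj mu : injective (@single mu).
Proof. by move=> x y /(congr1 (ev mu)); rewrite !ev_single. Qed.

Lemma single_regrade mu nu (x : G mu) : mu = nu -> single (rg nu x) = single x.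
Proof. by move=> e; case: _ / e; rewrite regrade_id. Qed.

Definition homog (mu : X) (f : tot) : Prop := forall nu, nu != mu -> ev nu f = 0.

Lemma homog_single mu (x : G mu) : homog mu (single x).
Proof. by move=> nu ne; rewrite ev_single_ne // eq_sym. Qed.

Lemma homogE mu f : homog mu f -> f = single (ev mu f).
Proof.
move=> h; apply: dirsum_ext => nu; rewrite -/(ev nu f) -/(ev nu (single _)).
have [<-|ne] := eqVneq mu nu; first by rewrite ev_single.
by rewrite ev_single_ne // h // eq_sym.
Qed.

Lemma homog_sub mu : subspace (homog mu).
Proof.
split=> [nu _|c f g hf hg nu ne]; first by rewrite linear0.
by rewrite linearP /= hf // hg // scaler0 addr0.
Qed.

Lemma tot_expand (s : seq tot) : exists2 t : seq X, uniq t &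
  forall f, f \in s -> f = \sum_(nu <- t) single (ev nu f).
Proof.
have [t tP] : exists t : seq X, forall f, f \in s -> forall nu, ev nu f != 0 -> nu \in t.
  elim: s => [|f s [t tP]]; first by exists [::].
  have [t' t'E] := (finite_seqP _).1 (dsvalP f).
  exists (t' ++ t) => g; rewrite inE => /orP[/eqP -> nu h|gs nu h]; rewrite mem_cat.
    by have : [set` t'] nu by [rewrite -t'E]; rewrite /= => ->.
  by rewrite (tP g gs nu h) orbT.
exists (undup t) => [|f fs]; first exact: undup_uniq.
apply: dirsum_ext => nu; rewrite -/(ev nu f) -[RHS]/(ev nu _) linear_sum.
have [z|nz] := eqVneq (ev nu f) 0.
  rewrite z big1 // => mu _; have [->|ne] := eqVneq mu nu; last exact: ev_single_ne.
  by rewrite z linear0 [LHS]linear0.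
rewrite (bigD1_seq nu) ?undup_uniq ?mem_undup ?(tP f) // big1 => [|mu ne].
  by rewrite [RHS]addr0; exact/esym/ev_single.
exact: ev_single_ne.
Qed.

Lemma tot_span (P : tot -> Prop) : subspace P ->
  (forall mu f, homog mu f -> P f) -> forall f, P f.
Proof.
move=> sP Ph f; have [t _ tE] := tot_expand [:: f].
rewrite (tE f) ?inE //; apply: subspace_sum => // nu _.
exact: Ph (homog_single _).
Qed.
End Regrade.

Variable (M : EFspace Pi K).
Local Notation T := (tot (component M)).

Fact totE_finite i n (f : T) : finite_set [set nu |
  @regrade _ _ _ _ (component M) _ nu
    (opE M (shift nu i (- n%:Z)) i n (ev (shift nu i (- n%:Z)) f)) != 0].
Proof.
apply: (@sub_finite_set _ _ ((fun mu => shift mu i n%:Z) @` [set mu | f mu != 0])).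
  move=> nu /= h; exists (shift nu i (- n%:Z)); last by rewrite shiftD addNr shift0.
  by apply: contraNneq h => z; rewrite /ev z !linear0.
exact/finite_image/dsvalP.
Qed.

Definition totE_fun i n (f : T) : T := Dirsum (totE_finite i n f).

Fact totE_linear i n : linear (totE_fun i n).
Proof. by move=> c f g; apply: dirsum_ext => nu /=; rewrite !linearP. Qed.
HB.instance Definition _ i n :=
  GRing.isLinear.Build K T T *:%R (totE_fun i n) (@totE_linear i n).

Fact totF_finite i n (f : T) : finite_set [set nu |
  opF M nu i n (ev (nu + srt i *+ n) f) != 0].
Proof.
apply: (@sub_finite_set _ _ ((fun mu => shift mu i (- n%:Z)) @` [set mu | f mu != 0])).
  move=> nu /= h; exists (nu + srt i *+ n).
    by apply: contraNneq h => z; rewrite /ev z !linear0.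
  by rewrite -[nu + _]/(shift nu i n%:Z) shiftD subrr shift0.
exact/finite_image/dsvalP.
Qed.

Definition totF_fun i n (f : T) : T := Dirsum (totF_finite i n f).

Fact totF_linear i n : linear (totF_fun i n).
Proof. by move=> c f g; apply: dirsum_ext => nu /=; rewrite !linearP. Qed.
HB.instance Definition _ i n :=
  GRing.isLinear.Build K T T *:%R (totF_fun i n) (@totF_linear i n).

Definition tot_mod : wmod Pi K := @WMod _ _ _ Pi K T (@homog (component M)) totE_fun totF_fun.

Lemma ev_totE nu i n (f : T) : ev nu (totE_fun i n f) =
  @regrade _ _ _ _ (component M) _ nu (opE M _ i n (ev (shift nu i (- n%:Z)) f)).
Proof. by []. Qed.

Lemma ev_totF nu i n (f : T) :
  ev nu (totF_fun i n f) = opF M nu i n (ev (nu + srt i *+ n) f).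
Proof. by []. Qed.

Lemma totE_single mu i n (x : M mu) : totE_fun i n (single x) = single (opE M mu i n x).
Proof.
apply: tot_ext => nu; rewrite ev_totE.
have [e|ne] := eqVneq (shift nu i (- n%:Z)) mu.
  by case: _ / e x => x; rewrite ev_single.
rewrite ev_single_ne 1?eq_sym // !linear0 ev_single_ne //.
by apply: contraNneq ne => <-; rewrite -[mu + _]/(shift mu i n%:Z) shiftD subrr shift0.
Qed.

Lemma totF_single mu i n (x : M (mu + srt i *+ n)) :
  totF_fun i n (single x) = single (opF M mu i n x).
Proof.
apply: tot_ext => nu; rewrite ev_totF.
have [<-|ne] := eqVneq mu nu; first by rewrite !ev_single.
rewrite [RHS]ev_single_ne // ev_single_ne ?linear0 //.
by apply: contraNneq ne => /addIr ->.
Qed.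

Lemma homog_shift mu (i : I) n (f : T) : homog mu f ->
  exists x : M (shift mu i (- n%:Z) + srt i *+ n), f = single x.
Proof.
move=> h; exists (ev _ f); apply: homogE.
by rewrite -[_ + _]/(shift _ i n%:Z) shiftD addNr shift0.
Qed.

Variable q : K.
Hypothesis MX : in_X q M.

Lemma totE0 i f : totE_fun i 0 f = f.
Proof.
have [[X0 _] _ _ _] := MX.
apply: (tot_span (P := fun f => totE_fun i 0 f = f)) => [|mu {}f h].
  split=> [|c x y ex ey]; first exact: (linear0 (totE_fun i 0)).
  by rewrite (linearP (totE_fun i 0)) /= ex ey.
by rewrite (homogE h) totE_single X0 single_regrade // mulr0n addr0.
Qed.

Lemma totF0 i f : totF_fun i 0 f = f.
Proof.
have [[_ X0] _ _ _] := MX.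
apply: (tot_span (P := fun f => totF_fun i 0 f = f)) => [|mu {}f h].
  split=> [|c x y ex ey]; first exact: (linear0 (totF_fun i 0)).
  by rewrite (linearP (totF_fun i 0)) /= ex ey.
have [x ->] := homog_shift i 0 h.
by rewrite totF_single X0 single_regrade // mulr0n addr0.
Qed.

Lemma tot_ax : (forall a : int, gb q a 0 = 1) -> wmod_ax (gb q) tot_mod.
Proof.
move=> gb0; have [_ _ X2 _] := MX; split=> /=.
- exact: homog_sub.
- move=> mu i n f /homogE ->; rewrite totE_single; exact: homog_single.
- move=> mu i n f h; have [x ->] := homog_shift i n h.
  by rewrite totF_single; exact: homog_single.
- by move=> mu i f _; exact: totE0.
- by move=> mu i f _; exact: totF0.
- move=> mu i j m n f ij h.
  case: m => [|m]; first by rewrite !totE0.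
  case: n => [|n]; first by rewrite !totF0.
  have [x ->] := homog_shift j n.+1 h; rewrite totF_single !totE_single.
  have [XX _] := X2 (shift mu j (- n.+1%:Z)) i j m.+1 n.+1 isT isT.
  rewrite (XX ij) -totF_single single_regrade // addrAC //.
move=> mu i m n f h.
case: m => [|m]; first by rewrite min0n big_ord1 gb0 scale1r !totE0 subn0.
case: n => [|n]; first by rewrite minn0 big_ord1 gb0 scale1r !totF0 subn0.
have [x ->] := homog_shift i n.+1 h; rewrite totF_single !totE_single.
have [_ XX] := X2 (shift mu i (- n.+1%:Z)) i i m.+1 n.+1 isT isT.
rewrite XX linear_sum; apply: eq_bigr => r _; rewrite linearZ /= -totF_single.
rewrite single_regrade -?totE_single.
  have -> : gb q (pairing mu i - n.+1%:Z + m.+1%:Z) r =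
      gb q (pairing (shift mu i (- n.+1%:Z)) i + m.+1%:Z + n.+1%:Z) r.
    by rewrite pairing_shift cartan_diag; congr gb; lia.
  by [].
have rm := ltn_ord r; rewrite ltnS leq_min in rm; case/andP: rm => rm rn.
have E (w : X) a b : w + srt i *+ a + srt i *+ b = w + srt i *+ (a + b).
  by rewrite -addrA -mulrnDr.
by rewrite !E; congr (_ + _ *+ _); lia.
Qed.
End TotalSpace.

(** * Subobjects *)

Section SubLmodule.
Variables (K : fieldType) (W : lmodType K).

Record subsp := Subsp { sp :> W -> Prop; spP : subspace sp }.

Definition sp_pred (s : subsp) : {pred W} := fun x => `[< s x >].

Fact sp_closed s : submod_closed (sp_pred s).
Proof.
split=> [|c x y /asboolP sx /asboolP sy]; apply/asboolP; first exact: (spP s).1.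
exact: (spP s).2.
Qed.
HB.instance Definition _ s := GRing.isSubmodClosed.Build K W (sp_pred s) (sp_closed s).

Record sub_lmod (s : subsp) := SubLmod { sub_val :> W; sub_valP : sub_val \in sp_pred s }.
HB.instance Definition _ s := [isSub for @sub_val s].
HB.instance Definition _ s := [Choice of sub_lmod s by <:].
HB.instance Definition _ s := [SubChoice_isSubLmodule of sub_lmod s by <:].

Lemma sub_lmodP s (x : sub_lmod s) : s (\val x).
Proof. exact/asboolP/sub_valP. Qed.

Definition mk_sub (s : subsp) x (sx : s x) : sub_lmod s := SubLmod (asboolT sx).

(** Elimination along the spanning family of [W]: either some vector of the
    subspace involves the first generator, and then it accounts for that
    generator, or the generator can be dropped. *)
Lemma findim_sub s : findim W -> findim (sub_lmod s).
Proof.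
move=> [g gE].
suff [t tE] : exists t : seq (sub_lmod s), forall x, s x ->
    exists c : 'I_(size t) -> K, x = \sum_i c i *: \val (t`_i).
  exists t => w; have [c cE] := tE _ (sub_lmodP w); exists c; apply: val_inj.
  by rewrite [RHS]linear_sum [LHS]cE; apply: eq_bigr => i _; rewrite [RHS]linearZ.
have {gE} gE x : s x -> exists c : 'I_(size g) -> K, x = \sum_i c i *: g`_i.
  by move=> _; exact: gE.
suff : forall (P : W -> Prop), subspace P -> (forall x, P x -> s x) ->
  (forall x, P x -> exists c : 'I_(size g) -> K, x = \sum_i c i *: g`_i) ->
  exists t : seq (sub_lmod s), forall x, P x ->
    exists c : 'I_(size t) -> K, x = \sum_i c i *: \val (t`_i).
  by move/(_ s (spP s)); apply.
elim: g {gE} => [|a g IH] P sP Ps gE.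
  by exists [::] => x Px; exists (fun=> 0); have [c ->] := gE x Px; rewrite !big_ord0.
have [[u [Pu [c [c0 uE]]]]|no] := pselect (exists u, P u /\ exists c : 'I_(size g).+1 -> K,
    c ord0 != 0 /\ u = \sum_i c i *: (a :: g)`_i); last first.
  apply: IH => // x Px; have [c cE] := gE x Px.
  have [c0|c0] := eqVneq (c ord0) 0; last by case: no; exists x; split=> //; exists c.
  exists (fun i => c (lift ord0 i)); rewrite {1}cE big_ord_recl c0 scale0r add0r.
  by apply: eq_bigr.
pose Q x := P x /\ exists c : 'I_(size g) -> K, x = \sum_i c i *: g`_i.
have [||x [Px xE] //|t tE] := IH Q.
- split; first by split; [exact: sP.1|exists (fun=> 0); rewrite big1 // => i _; rewrite scale0r].
  move=> d x y [Px [cx xE]] [Py [cy yE]]; split; first exact: sP.2.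
  exists (fun i => d * cx i + cy i); rewrite {1}xE {1}yE scaler_sumr -big_split.
  by apply: eq_bigr => i _; rewrite scalerDl scalerA.
- by move=> x [Px _]; exact: Ps.
exists (mk_sub (Ps u Pu) :: t) => x Px; have [d dE] := gE x Px.
pose k := d ord0 / c ord0.
have [|e eE] := tE (- k *: u + x).
  split; first exact: sP.2.
  exists (fun i => - k * c (lift ord0 i) + d (lift ord0 i)).
  rewrite {1}uE {1}dE scaler_sumr -big_split big_ord_recl /=.
  rewrite scalerA -scalerDl mulNr /k divfK // addNr scale0r add0r.
  by apply: eq_bigr => i _; rewrite scalerDl scalerA.
exists (fun i => if unlift ord0 i is Some j then e j else k).
rewrite big_ord_recl unlift_none /=.
under eq_bigr => i _ do rewrite liftK.
by rewrite -eE scaleNr addrA subrr add0r.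
Qed.
End SubLmodule.

Section ImageF.
Variables (R : realType) (V : vectType R) (Phi : root_system V) (Pi : base Phi).
Variables (K : fieldType) (M : EFspace Pi K) (mu : weight Phi).

Lemma imF_sub : subspace (@imF _ _ _ _ _ M mu).
Proof.
split.
  exists 0%N, (fun i n => 0); rewrite big1 // => i _; rewrite big1 // => n _.
  by rewrite linear0.
move=> c x y [N [w ->]] [N' [w' ->]]; exists (maxn N N'), (fun i n =>
  c *: (if (n <= N)%N then w i n else 0) + (if (n <= N')%N then w' i n else 0)).
rewrite scaler_sumr -big_split; apply: eq_bigr => i _ /=.
have ext L (z : forall n, M (mu + srt i *+ n)) : (L <= maxn N N')%N ->
  \sum_(1 <= n < L.+1) opF M mu i n (z n) =
  \sum_(1 <= n < (maxn N N').+1) opF M mu i n (if (n <= L)%N then z n else 0).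
  move=> le; rewrite (big_nat_widen _ _ (maxn N N').+1) // big_mkcond.
  by apply: eq_bigr => n _ /=; rewrite ltnS; case: ifP => // _; rewrite linear0.
rewrite (ext N (w i)) ?leq_maxl // (ext N' (w' i)) ?leq_maxr //.
by rewrite scaler_sumr -big_split; apply: eq_bigr => n _; rewrite linearP.
Qed.

Lemma imF_F i n (x : M (mu + srt i *+ n)) : (0 < n)%N -> imF (opF M mu i n x).
Proof.
move=> n0; exists n, (fun j m => if (j == i) && (m == n) then
   @regrade _ _ _ _ (component M) _ (mu + srt j *+ m) x else 0).
rewrite (bigD1 i) //= [X in _ = _ + X]big1 ?addr0 => [|j /negbTE ji]; last first.
  by rewrite big1 // => m _; rewrite ji linear0.
rewrite (bigD1_seq n) ?iota_uniq ?mem_index_iota ?n0 ?ltnS ?leqnn //= !eqxx /=.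
rewrite regrade_id [X in _ = _ + X]big1 ?addr0 // => m /negbTE mn.
by rewrite mn linear0.
Qed.
End ImageF.

Section SubObject.
Variables (R : realType) (V : vectType R) (Phi : root_system V) (Pi : base Phi).
Variables (K : fieldType) (q : K) (M : EFspace Pi K).
Local Notation X := (weight Phi).
Local Notation I := 'I_(rank Pi).
Variable S : forall mu : X, subsp (M mu).
Hypothesis SE : forall mu i n (x : M mu), S mu x -> S (mu + srt i *+ n) (opE M mu i n x).
Hypothesis SF : forall mu i n (x : M (mu + srt i *+ n)),
  S (mu + srt i *+ n) x -> S mu (opF M mu i n x).

Definition sub_graded : graded Phi K := fun mu => sub_lmod (S mu).

Definition sub_opE_fun mu i n (x : sub_graded mu) : sub_graded (mu + srt i *+ n) :=
  mk_sub (SE i n (sub_lmodP x)).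
Fact sub_opE_linear mu i n : linear (@sub_opE_fun mu i n).
Proof. by move=> c x y; apply: val_inj; rewrite /= !linearP. Qed.
HB.instance Definition _ mu i n := GRing.isLinear.Build K (sub_graded mu)
  (sub_graded (mu + srt i *+ n)) *:%R (@sub_opE_fun mu i n) (@sub_opE_linear mu i n).

Definition sub_opF_fun mu i n (x : sub_graded (mu + srt i *+ n)) : sub_graded mu :=
  mk_sub (SF (sub_lmodP x)).
Fact sub_opF_linear mu i n : linear (@sub_opF_fun mu i n).
Proof. by move=> c x y; apply: val_inj; rewrite /= !linearP. Qed.
HB.instance Definition _ mu i n := GRing.isLinear.Build K
  (sub_graded (mu + srt i *+ n)) (sub_graded mu) *:%R (@sub_opF_fun mu i n)
  (@sub_opF_linear mu i n).

Definition subEF : EFspace Pi K := @EFSpace _ _ _ Pi K sub_graded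
  (fun mu i n => @sub_opE_fun mu i n) (fun mu i n => @sub_opF_fun mu i n).

Lemma val_regrade mu nu (x : sub_graded mu) :
  \val (@regrade _ _ _ _ sub_graded mu nu x) =
  @regrade _ _ _ _ (component M) mu nu (\val x).
Proof.
have [e|ne] := eqVneq mu nu; first by case: _ / e; rewrite !regrade_id.
by rewrite !regrade_ne // linear0.
Qed.

Lemma val_opE mu i n (x : subEF mu) :
  \val (opE subEF mu i n x) = opE M mu i n (\val x).
Proof. by []. Qed.

Lemma val_opF mu i n (x : subEF (mu + srt i *+ n)) :
  \val (opF subEF mu i n x) = opF M mu i n (\val x).
Proof. by []. Qed.

Lemma imF_val mu (x : subEF mu) : imF x -> imF (\val x : M mu).
Proof.
move=> [N [w ->]]; exists N, (fun i n => \val (w i n)).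
rewrite linear_sum; apply: eq_bigr => i _; rewrite linear_sum; apply: eq_bigr => n _.
by [].
Qed.

Hypothesis MX : in_X q M.
Hypothesis S3 : forall mu (x : subEF mu), exists k f : subEF mu,
  [/\ kerE k, imF f & x = k + f].

(** Of [axX3] only the existence of a decomposition has to be assumed for the
    subobject; its uniqueness is inherited. *)
Lemma subEF_in_X : in_X q subEF.
Proof.
have [[E0 F0] [qb fd] X2 X3] := MX; split.
- split=> mu i x; apply: val_inj; first by rewrite val_opE E0 val_regrade.
  by rewrite val_opF F0 val_regrade.
- split=> [mu|mu]; last exact/findim_sub/fd.
  apply: sub_finite_set (qb mu) => nu /= [[x x0] le]; split=> //.
  by exists (\val x); apply: contraNneq x0 => z; apply/eqP/val_inj; rewrite z linear0.
- move=> mu i j m n m0 n0; have [h1 h2] := X2 mu i j m n m0 n0; split.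
    move=> ij x; apply: val_inj.
    by rewrite val_opE !val_opF h1 // val_regrade val_opE.
  move=> x; apply: val_inj; rewrite val_opE val_opF.
  have [_ h] := X2 mu i i m n m0 n0; rewrite h linear_sum; apply: eq_bigr => r _.
  rewrite [RHS]linearZ; congr (_ *: _).
  by rewrite -[RHS]/(opF M _ i _ (\val _)) val_regrade.
move=> mu; split; first exact: S3.
move=> x kx ix; apply: val_inj; rewrite linear0; apply: (X3 mu).2 (imF_val ix) => i n n0.
by rewrite -val_opE kx // linear0.
Qed.
End SubObject.

(** * Decomposition of an object along its primitive vectors *)

Lemma linear_inverse (K : fieldType) (A B : lmodType K) (f : {linear A -> B}) :
  injective f -> (forall y, exists x, f x = y) ->
  {g : {linear B -> A} | cancel f g /\ cancel g f}.
Proof.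
move=> fi fs; pose g y := sval (cid (fs y)).
have gK : cancel g f by move=> y; exact: svalP (cid (fs y)).
have lg : linear g by move=> c x y; apply: fi; rewrite linearP !gK.
pose gL : {linear B -> A} := HB.pack g (GRing.isLinear.Build _ _ _ _ g lg).
by exists gL; split=> // x; apply: fi; rewrite [LHS]gK.
Qed.

Section Isomorphism.
Variables (R : realType) (V : vectType R) (Phi : root_system V) (Pi : base Phi).
Variables (K : fieldType) (M N : EFspace Pi K).

Lemma isomorphic_of_inverse (f : forall mu, {linear M mu -> N mu}) :
  is_hom f -> (forall mu, injective (f mu)) ->
  (forall mu y, exists x, f mu x = y) -> isomorphic N M.
Proof.
move=> [fE fF] fi fs; pose g mu := sval (linear_inverse (@fi mu) (fs mu)).
have gP mu : cancel (f mu) (g mu) /\ cancel (g mu) (f mu).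
  exact: svalP (linear_inverse (@fi mu) (fs mu)).
exists g; split; last by move=> mu; exists (f mu); have [] := gP mu.
split=> mu i n v; apply: (@fi).
  by rewrite fE !(gP _).2.
by rewrite fF !(gP _).2.
Qed.
End Isomorphism.

Section Decomposition.
Variables (R : realType) (V : vectType R) (Phi : root_system V) (Pi : base Phi).
Variables (K : fieldType) (q : K) (q_neq0 : q != 0).
Variables (M : EFspace Pi K) (MX : in_X q M) (la : weight Phi).
Hypothesis Mwt : forall mu, nonzero M mu -> wle Pi mu la.
Local Notation X := (weight Phi).
Local Notation I := 'I_(rank Pi).
Local Notation U := (tot_mod M).
Let Q := qnumbersP q_neq0.

Lemma tot_axX : wmod_ax (gb q) U.
Proof. exact: tot_ax MX (gb0 Q). Qed.
Let Ux := tot_axX.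

Lemma tot_below : below la U.
Proof.
move=> mu f nle h; rewrite (homogE h); apply/eqP; apply: contra_notT nle => nz.
apply: Mwt; exists (ev mu f); apply: contraNneq nz => ->; by rewrite linear0.
Qed.

Section FSpan.
Variable T : X -> U -> Prop.
Hypothesis T_sub : forall mu, subspace (T mu).
Hypothesis T_wt : forall mu f, T mu f -> wt mu f.
Hypothesis T_killed : forall mu f i n, (0 < n)%N -> T mu f -> wE i n f = 0.

(** The subobject generated by the vectors in [T], which the [E] kill. *)
Inductive Fspan : X -> U -> Prop :=
| Fs_0 mu : Fspan mu 0
| Fs_base mu f : T mu f -> Fspan mu f
| Fs_lin mu c f g : Fspan mu f -> Fspan mu g -> Fspan mu (c *: f + g)
| Fs_F mu i n f : (0 < n)%N -> Fspan mu f -> Fspan (shift mu i (- n%:Z)) (wF i n f).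

Lemma Fs_sub mu : subspace (Fspan mu).
Proof. by split; [exact: Fs_0|exact: Fs_lin]. Qed.

Lemma Fs_wt mu f : Fspan mu f -> wt mu f.
Proof.
elim=> {mu f} [mu|mu f|mu c f g _ h1 _ h2|mu i n f _ _ h].
- exact: (wt_sub Ux _).1.
- exact: T_wt.
- exact: (wt_sub Ux _).2.
- exact: (wtF Ux i n h).
Qed.

Lemma Fs_eq mu nu f : Fspan mu f -> mu = nu -> Fspan nu f.
Proof. by move=> g <-. Qed.

Lemma Fs_F0 mu i n f : Fspan mu f -> Fspan (shift mu i (- n%:Z)) (wF i n f).
Proof.
case: n => [|n] g; last exact: Fs_F.
by rewrite (wF0 Ux _ (Fs_wt g)) oppr0 shift0.
Qed.

Lemma Fs_E mu f : Fspan mu f -> forall i m, Fspan (shift mu i m%:Z) (wE i m f).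
Proof.
elim=> {mu f} [mu i m|mu f Tf i m|mu c f g _ h1 _ h2 i m|mu j n f n0 g IH i m].
- by rewrite linear0; exact: Fs_0.
- case: m => [|m]; first by rewrite (wE0 Ux _ (T_wt Tf)) shift0; exact: Fs_base.
  by rewrite (T_killed _ _ Tf) //; exact: Fs_0.
- by rewrite linearP; exact: Fs_lin.
have hf := Fs_wt g; have [ij|ij] := eqVneq i j; last first.
  by rewrite (wEF_ne Ux _ _ ij hf) shiftC; exact: Fs_F.
subst j; rewrite (wEF Ux _ _ _ hf); apply: (subspace_sum (Fs_sub _)) => r _.
apply: (subspaceZ (Fs_sub _)); rewrite /wEm; case: leqP => rm; last first.
  by rewrite linear0; exact: Fs_0.
apply: Fs_eq (Fs_F0 i (n - r) (IH i (m - r)%N)) _.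
by rewrite !shiftD; congr shift; have := ltn_ord r; lia.
Qed.

Fact Fs_typed_sub mu : subspace (fun x : M mu => Fspan mu (single x)).
Proof.
split=> [|c x y]; first by rewrite linear0; exact: Fs_0.
by rewrite linearP; exact: Fs_lin.
Qed.

Definition Fs_typed mu : subsp (M mu) := Subsp (@Fs_typed_sub mu).

Lemma Fs_typedE mu i n (x : M mu) : Fs_typed mu x ->
  Fs_typed (mu + srt i *+ n) (opE M mu i n x).
Proof. by move=> h; rewrite /= -totE_single; exact: Fs_E h i n. Qed.

Lemma Fs_typedF mu i n (x : M (mu + srt i *+ n)) : Fs_typed (mu + srt i *+ n) x ->
  Fs_typed mu (opF M mu i n x).
Proof.
move=> h; rewrite /= -totF_single; apply: Fs_eq (Fs_F0 i n h) _.
by rewrite -[mu + _]/(shift mu i n%:Z) shiftD subrr shift0.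
Qed.

Definition FsEF : EFspace Pi K := subEF Fs_typedE Fs_typedF.

(** All generators lie in the kernel of the [E] and all the rest in the image of
    the [F], so the subobject inherits [axX3]. *)
Lemma FsEF_split mu f : Fspan mu f -> exists t g : FsEF mu,
  [/\ T mu (single (\val t : M mu)), imF g & f = single (\val t : M mu) + single (\val g : M mu)].
Proof.
elim=> {mu f} [mu|mu f Tf|mu c f g _ [t [k [Tt ik ->]]] _ [t' [k' [Tt' ik' ->]]]|mu i n f n0 h _].
- exists 0, 0; split; [by rewrite !linear0; exact: (T_sub _).1|exact: (imF_sub _ _).1|].
  by rewrite !linear0 addr0.
- have fE := homogE (T_wt Tf); have Sf : Fs_typed mu (ev mu f).
    by rewrite /= -fE; exact: Fs_base.
  exists (mk_sub Sf), 0; split; [by rewrite /= -fE|exact: (imF_sub _ _).1|].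
  by rewrite !linear0 addr0.
- exists (c *: t + t'), (c *: k + k'); split.
  + by rewrite !linearP; exact: (T_sub _).2.
  + exact: (imF_sub _ _).2.
  + by rewrite !linearP /= scalerDr addrACA.
have [x fE] := homog_shift i n (Fs_wt h); rewrite fE in h *.
have Sx : Fs_typed (shift mu i (- n%:Z) + srt i *+ n) x.
  by apply: Fs_eq h _; rewrite -[_ + _]/(shift _ i n%:Z) shiftD addNr shift0.
exists 0, (opF FsEF (shift mu i (- n%:Z)) i n (mk_sub Sx)); split.
- by rewrite !linear0; exact: (T_sub _).1.
- exact: imF_F.
- by rewrite !linear0 add0r /= totF_single.
Qed.

Lemma FsEF_in_X : in_X q FsEF.
Proof.
apply: subEF_in_X => // mu x; have := sub_lmodP x => /= /FsEF_split [t [g [Tt ig xE]]].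
exists t, g; split=> // [i n n0|].
  apply: val_inj; rewrite linear0; apply: (@single_inj _ _ _ _ (component M)).
  rewrite [RHS]linear0; transitivity (totE_fun i n (single (\val t : M mu))).
    exact/esym/totE_single.
  exact: (T_killed _ n0 Tt).
by apply: val_inj; apply: (@single_inj _ _ _ _ (component M)); rewrite xE !linearD.
Qed.
End FSpan.

(** The vectors killed by the [E] in degree [la] and in the other degrees: they
    generate two complementary subobjects. *)
Definition top_part (mu : X) (f : U) : Prop := wt mu f /\ (mu != la -> f = 0).

Definition prim_part (mu : X) (f : U) : Prop :=
  [/\ wt mu f, forall i n, (0 < n)%N -> wE i n f = 0 & mu = la -> f = 0].

Lemma top_part_sub mu : subspace (top_part mu).
Proof.
split=> [|c x y [hx zx] [hy zy]]; first by split=> //; exact: (wt_sub Ux _).1.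
by split=> [|ne]; [exact: (wt_sub Ux _).2|rewrite zx // zy // scaler0 addr0].
Qed.

Lemma top_part_killed mu f i n : (0 < n)%N -> top_part mu f -> wE i n f = 0.
Proof.
move=> n0 [hf zf]; have [e|ne] := eqVneq mu la; last by rewrite zf // linear0.
rewrite e in hf; apply: tot_below (wtE Ux i n hf); exact: wle_shiftN.
Qed.

Lemma prim_part_sub mu : subspace (prim_part mu).
Proof.
split=> [|c x y [hx kx zx] [hy ky zy]].
  by split=> // i n _; rewrite linear0.
split=> [|i n n0|e]; first exact: (wt_sub Ux _).2.
  by rewrite linearP kx // ky // scaler0 addr0.
by rewrite zx // zy // scaler0 addr0.
Qed.

Local Notation SN := (Fspan top_part).
Local Notation SP := (Fspan prim_part).
Let tN_wt mu f : top_part mu f -> wt mu f. Proof. by case. Qed.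
Let tP_wt mu f : prim_part mu f -> wt mu f. Proof. by case. Qed.
Let tP_killed mu f i n : (0 < n)%N -> prim_part mu f -> wE i n f = 0.
Proof. by move=> n0 [_ k _]; exact: k. Qed.

(** By [axX3] a vector of degree other than [la] is primitive up to images under
    the [F] of vectors of higher degree. *)
Lemma span_cover mu f : wt mu f -> exists a b, [/\ SN mu a, SP mu b & f = a + b].
Proof.
move: mu f; apply: (@wle_ind _ _ _ Pi la) => [mu nle f hf|mu IH f hf].
  by exists 0, 0; split; [exact: Fs_0|exact: Fs_0|rewrite (tot_below nle hf) addr0].
have [e|ne] := eqVneq mu la.
  exists f, 0; split; [|exact: Fs_0|by rewrite addr0].
  by apply: Fs_base; split=> //; rewrite e eqxx.
pose D (f : U) := exists a b, [/\ SN mu a, SP mu b & f = a + b].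
have Ds : subspace D.
  split; first by exists 0, 0; split; [exact: Fs_0|exact: Fs_0|rewrite addr0].
  move=> c x y [a [b [Sa Sb ->]]] [a' [b' [Sa' Sb' ->]]].
  exists (c *: a + a'), (c *: b + b').
  by split; [exact: Fs_lin|exact: Fs_lin|rewrite scalerDr addrACA].
have [_ _ _ X3] := MX; have [k [g [kk [N [w gE]] xE]]] := (X3 mu).1 (ev mu f).
rewrite (homogE hf) xE linearD; apply: (subspaceD Ds).
  exists 0, (single k); split; [exact: Fs_0| |by rewrite add0r].
  apply: Fs_base; split=> [|i n n0|e]; first exact: homog_single.
    by rewrite /= totE_single kk // linear0.
  by rewrite e eqxx in ne.
rewrite gE linear_sum; apply: (subspace_sum Ds) => i _.
rewrite linear_sum; apply: (subspace_sum_seq Ds) => n; rewrite mem_index_iota => /andP[n0 _].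
suff : D (totF_fun i n (single (w i n))) by rewrite totF_single.
have [a [b [Sa Sb ->]]] := IH i n n0 (single (w i n)) (homog_single _).
have e : shift (shift mu i n%:Z) i (- n%:Z) = mu by rewrite shiftD subrr shift0.
rewrite [totF_fun _ _ _](linearD (totF_fun i n)).
exists (totF_fun i n a), (totF_fun i n b); split=> //.
  by have := Fs_F i n0 Sa; rewrite e.
by have := Fs_F i n0 Sb; rewrite e.
Qed.

Lemma SP_top mu f : SP mu f -> mu = la -> f = 0.
Proof.
elim=> {mu f} [//|mu f [_ _ z]|mu c f g _ h1 _ h2 e|mu i n f n0 h IH e].
- exact: z.
- by rewrite h1 // h2 // scaler0 addr0.
rewrite (tot_below _ (Fs_wt tP_wt h)) ?linear0 //.
have -> : mu = shift la i n by rewrite -e shiftD addNr shift0.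
exact: wle_shiftN.
Qed.

(** By induction from the top, a common vector is killed by the [E].  In a degree
    other than [la] it is in the image of the [F], as it comes from the span of
    the top component; these two properties are incompatible by [axX3]. *)
Lemma span_disjoint mu f : SN mu f -> SP mu f -> f = 0.
Proof.
move: mu f; apply: (@wle_ind _ _ _ Pi la) => [mu nle f Sf _|mu IH f Nf Pf].
  exact: tot_below nle (Fs_wt tN_wt Sf).
have [e|ne] := eqVneq mu la; first exact: SP_top Pf e.
have hf := Fs_wt tN_wt Nf.
have kf i n : (0 < n)%N -> wE i n f = 0.
  move=> n0; apply: (IH i n n0).
    exact: (Fs_E tN_wt top_part_killed Nf).
  exact: (Fs_E tP_wt tP_killed Pf).
have [t [g [[_ zt] ig fE]]] := FsEF_split top_part_sub tN_wt top_part_killed Nf.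
have {}fE : f = single (\val g : M mu) by rewrite fE zt // add0r.
have [_ _ _ X3] := MX; rewrite fE (_ : \val g = 0) ?linear0 //.
apply: ((X3 mu).2 _ _ (imF_val ig)) => i n n0.
have := kf i n n0; rewrite fE /= totE_single => h.
by apply: (@single_inj _ _ _ _ (component M)); rewrite h linear0.
Qed.

Lemma decompose : isomorphic M
  (EFsum (FsEF tN_wt top_part_killed) (FsEF tP_wt tP_killed)).
Proof.
pose N := FsEF tN_wt top_part_killed.
pose P := FsEF tP_wt tP_killed.
pose f mu (x : EFsum N P mu) : M mu := \val x.1 + \val x.2.
have fl mu : linear (@f mu).
  move=> c x y; rewrite /f.
  transitivity ((c *: \val x.1 + \val y.1) + (c *: \val x.2 + \val y.2) : M mu).
    by congr (_ + _); rewrite -[RHS]linearP.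
  by rewrite addrACA -scalerDr.
pose fL mu : {linear EFsum N P mu -> M mu} :=
  HB.pack (@f mu) (GRing.isLinear.Build _ _ _ _ _ (fl mu)).
apply: (@isomorphic_of_inverse _ _ _ _ _ (EFsum N P) M fL).
- split=> mu i n x; first by rewrite [RHS]linearD.
  by rewrite [RHS]linearD.
- move=> mu x y /eqP; rewrite -subr_eq0 -linearB => /eqP.
  case: (x - y) (subr_eq0 x y) => a b e0; rewrite /= /f /= => /eqP ab.
  apply/eqP; rewrite -e0; apply/eqP.
  have ab' : \val a = - \val b :> M mu by apply/eqP; rewrite -addr_eq0.
  have a0 : single (\val a : M mu) = 0.
    apply: (span_disjoint (sub_lmodP a)); rewrite ab' linearN.
    exact: subspaceN (Fs_sub _ _) _ (sub_lmodP b).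
  have a1 : \val a = 0 :> M mu.
    by apply: (@single_inj _ _ _ _ (component M)); rewrite a0 linear0.
  congr (_, _); apply: val_inj; rewrite [RHS]linear0 //.
  by apply/eqP; rewrite -oppr_eq0 -ab' a1.
move=> mu y; have [a [b [Sa Sb yE]]] := span_cover (homog_single y).
have aE := homogE (Fs_wt tN_wt Sa); have bE := homogE (Fs_wt tP_wt Sb).
rewrite aE in Sa; rewrite bE in Sb.
exists (mk_sub (s := Fs_typed top_part mu) Sa, mk_sub (s := Fs_typed prim_part mu) Sb).
by apply: (@single_inj _ _ _ _ (component M)); rewrite yE [in RHS]aE [in RHS]bE -linearD.
Qed.

Hypothesis Mind : indecomposable q M.
Hypothesis Mtop : nonzero M la.

(** By indecomposability the span of the primitive vectors of degree other than
    [la] vanishes, the top component being in the other summand. *)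
Lemma kerE_eq0 mu (x : M mu) : mu != la -> kerE x -> x = 0.
Proof.
move=> ne kx; have [_ ind] := Mind; have [v v0] := Mtop.
have [zN|zP] := ind _ _ (FsEF_in_X top_part_sub tN_wt top_part_killed)
   (FsEF_in_X prim_part_sub tP_wt tP_killed) decompose.
  have Sv : Fs_typed top_part la v.
    by apply: Fs_base; split; [exact: homog_single|rewrite eqxx].
  have := zN la (mk_sub Sv) => /(congr1 (fun z => \val z)) /= vz.
  by rewrite vz eqxx in v0.
have Sx : Fs_typed prim_part mu x.
  apply: Fs_base; split=> [|i n n0|e]; first exact: homog_single.
    by rewrite /= totE_single kx // linear0.
  by rewrite e eqxx in ne.
exact: (congr1 (fun z => \val z) (zP mu (mk_sub Sx))).
Qed.

End Decomposition.

(** * Indecomposable objects as highest weight modules *)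

Section Coordinates.
Variables (K : fieldType) (W : lmodType K).

(** A spanning family of least length is a basis. *)
Lemma findim_coordinates : findim W -> exists t : seq (W * {linear W -> K^o}),
  forall w, w = \sum_(p <- t) (p.2 w : K) *: p.1.
Proof.
move=> [s sE].
pose spans n := `[< exists e : 'I_n -> W, forall w, exists c : 'I_n -> K,
   w = \sum_i c i *: e i >].
have ex : exists n, spans n.
  by exists (size s); apply/asboolP; exists (fun i => s`_i).
have [n /asboolP[e eE] nmin] := ex_minnP ex.
have free (c : 'I_n -> K) : \sum_i c i *: e i = 0 -> forall j, c j = 0.
  move=> c0 j; apply/eqP; apply/negPn/negP => cj.
  case: n e eE nmin c c0 j cj => [|n] e eE nmin c c0 j cj; first by case: j cj.
  suff : spans n by move/nmin; rewrite ltnn.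
  apply/asboolP; exists (fun i => e (lift j i)) => w; have [d dE] := eE w.
  exists (fun i => d (lift j i) - d j / c j * c (lift j i)).
  have lS (f : 'I_n.+1 -> W) : \sum_i f i = f j + \sum_(i < n) f (lift j i).
    rewrite (bigD1 j) //=; congr (_ + _).
    rewrite (reindex_omap (lift j) (unlift j)) /=; last first.
      by move=> i; rewrite eq_sym => /unlift_some[k -> ->].
    by apply: eq_bigl => i; rewrite liftK eqxx eq_sym neq_lift.
  rewrite dE lS; under [RHS]eq_bigr => i _ do rewrite scalerBl -scalerA.
  rewrite sumrB -scaler_sumr; move/eqP: c0; rewrite lS addrC addr_eq0 => /eqP ->.
  by rewrite scalerN opprK scalerA divfK // addrC.
have /choice[c cE] := eE.
have clin i : linear (fun w => c w i : K^o).
  move=> d x y; apply/eqP; rewrite -subr_eq0; apply/eqP.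
  apply: (free (fun i => c (d *: x + y) i - (d * c x i + c y i))).
  under eq_bigr => k _ do rewrite scalerBl scalerDl -scalerA.
  by rewrite sumrB big_split -scaler_sumr /= -!cE subrr.
pose phi i : {linear W -> K^o} :=
  HB.pack (fun w => c w i : K^o) (GRing.isLinear.Build _ _ _ _ _ (clin i)).
exists [seq (e i, phi i) | i <- index_enum 'I_n] => w.
by rewrite {1}(cE w) big_map.
Qed.
End Coordinates.

Section SimpleObject.
Variables (R : realType) (V : vectType R) (Phi : root_system V) (Pi : base Phi).
Variables (K : fieldType) (q : K) (q_neq0 : q != 0).
Variables (M : EFspace Pi K) (la : weight Phi) (MS : is_S q la M).
Local Notation X := (weight Phi).
Local Notation I := 'I_(rank Pi).
Local Notation U := (tot_mod M).
Let Q := qnumbersP q_neq0.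

(** Since no vector of degree other than [la] is killed by the [E], [axX3] leaves
    only the image of the [F] in such a degree. *)
Lemma tot_simple_hw : exists v : U, simple_hw (gb q) la v.
Proof.
have [MX Mind [v v0 vE] Mwt] := MS; exists (single v).
have Mtop : nonzero M la by exists v.
have ker0 mu (x : M mu) : mu != la -> kerE x -> x = 0.
  exact: (kerE_eq0 q_neq0 MX Mwt Mind Mtop).
split.
- exact: tot_axX.
- exact: (tot_below Mwt).
- move=> mu f ne h kf; rewrite (homogE h) (ker0 mu (ev mu f) ne) ?linear0 // => i n n0.
  have := kf i n n0; rewrite {1}(homogE h) /= totE_single => e.
  by apply: (@single_inj _ _ _ _ (component M)); rewrite e linear0.
- move=> mu P ne sP PF f h; rewrite (homogE h).
  have [_ _ _ X3] := MX; have [k [g [kk [N [w gE]] ->]]] := (X3 mu).1 (ev mu f).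
  rewrite (ker0 _ _ ne kk) add0r gE linear_sum; apply: (subspace_sum sP) => i _.
  rewrite linear_sum; apply: (subspace_sum_seq sP) => n; rewrite mem_index_iota => /andP[n0 _].
  suff : P (totF_fun i n (single (w i n))) by rewrite totF_single.
  exact: (PF i n _ n0 (homog_single _)).
- exact: tot_span.
- exact: homog_single.
- by apply: contraNneq v0 => /(congr1 (ev la)); rewrite ev_single linear0 => ->.
- move=> f h; have [c cE] := vE (ev la f); exists c.
  by rewrite (homogE h) cE linearZ.
have /choice[c cE] := vE.
have cu a b : a *: v = b *: v -> a = b.
  move=> /eqP; rewrite -subr_eq0 -scalerBl scaler_eq0 (negbTE v0) orbF subr_eq0.
  by move/eqP.
exists (fun f => c (ev la f) : K^o); split.
- move=> a f g; apply: cu; rewrite -cE linearP /= [in LHS](cE (ev la f)).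
  rewrite [in LHS](cE (ev la g)) [RHS]scalerDl; congr (_ + _); exact: (scalerA a _ v).
- by apply: cu; rewrite -cE ev_single scale1r.
- by move=> mu f ne h; apply: cu; rewrite -cE scale0r h // eq_sym.
Qed.

Fact kop_finite (i : I) (n : int) (f : tot (component M)) :
  finite_set [set mu | q ^ (n * pairing mu i) *: ev mu f != 0 :> M mu].
Proof.
apply: sub_finite_set (dsvalP f) => mu /=; apply: contra_neq => z.
by rewrite /ev z scaler0.
Qed.

(** The action of [K_i^n]. *)
Definition kop_fun (i : I) n (f : tot (component M)) : tot (component M) :=
  Dirsum (kop_finite i n f).

Fact kop_linear i n : linear (kop_fun i n).
Proof.
by move=> c f g; apply: tot_ext => mu; rewrite [LHS]scalerDr; congr (_ + _); exact: scaleAC.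
Qed.
HB.instance Definition _ i n := GRing.isLinear.Build K (tot (component M))
  (tot (component M)) *:%R (kop_fun i n) (@kop_linear i n).

Lemma kopE i n mu (f : U) : wt mu f -> kop_fun i n f = q ^ (n * pairing mu i) *: f.
Proof.
move=> h; apply: tot_ext => nu; rewrite linearZ -[LHS]/(q ^ _ *: ev nu f) /=.
have [->//|ne] := eqVneq nu mu.
by rewrite h // !scaler0.
Qed.

Lemma totE_component i n (f : U) mu : totE_fun i n f = 0 ->
  totE_fun i n (single (ev mu f)) = 0.
Proof.
move=> f0; apply: tot_ext => nu; rewrite ev_totE linear0.
have [e|ne] := eqVneq (shift nu i (- n%:Z)) mu; last first.
  by rewrite ev_single_ne 1?eq_sym // !linear0.
by rewrite -e ev_single -ev_totE f0 linear0.
Qed.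

Lemma tot_prim (v : U) : simple_hw (gb q) la v ->
  forall f : U, (forall i n, (0 < n)%N -> wE i n f = 0) -> exists c, f = c *: v.
Proof.
move=> S f kf; apply: (hw_top S) => mu ne.
apply: (@single_inj _ _ _ _ (component M)); rewrite [RHS]linear0.
apply: (hw_cogen S ne (homog_single _)) => i n n0.
by apply: totE_component; exact: kf.
Qed.

Lemma tot_coordinates : finite_coordinates (tot (component M)).
Proof.
have [[_ [_ fd] _ _] _ _ _] := MS; move=> s; have [t _ tE] := tot_expand s.
have [T TE] : exists T : forall nu, seq (M nu * {linear M nu -> K^o}),
    forall nu w, w = \sum_(p <- T nu) (p.2 w : K) *: p.1.
  exists (fun nu => sval (cid (findim_coordinates (fd nu)))) => nu.
  exact: svalP (cid (findim_coordinates (fd nu))).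
have lin nu (phi : {linear M nu -> K^o}) :
    linear (fun f : tot (component M) => phi (ev nu f) : K^o).
  by move=> c f g; rewrite !linearP.
pose comp nu (phi : {linear M nu -> K^o}) : {linear tot (component M) -> K^o} :=
  HB.pack (fun f : tot (component M) => phi (ev nu f) : K^o)
    (GRing.isLinear.Build _ _ _ _ _ (lin nu phi)).
exists (flatten [seq [seq (single p.1, comp nu p.2) | p <- T nu] | nu <- t]) => f fs.
rewrite big_flatten big_map {1}(tE f fs); apply: eq_bigr => nu _.
rewrite big_map {1}(TE nu (ev nu f)) linear_sum; apply: eq_bigr => p _.
exact: linearZ.
Qed.
End SimpleObject.

Section RestrictedObject.
Variables (R : realType) (V : vectType R) (Phi : root_system V) (Pi : base Phi).
Variables (K : fieldType) (q : K) (q_neq0 : q != 0).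
Variables (l : nat) (l_gt0 : (0 < l)%N)
  (gn_lt : forall m : nat, (0 < m < l)%N -> gn q m%:Z != 0).
Hypothesis sl : simply_laced Pi.
Variables (M : EFspace Pi K) (la : weight Phi) (v : tot_mod M).
Hypothesis S : simple_hw (gb q) la v.
Hypothesis la_restricted : forall i : 'I_(rank Pi), 0 <= pairing la i < l%:Z.

Lemma tot_E1_killed (f : tot_mod M) : (forall i, wE i 1 f = 0) -> exists c, f = c *: v.
Proof.
move=> kf; apply: (hw_top S) => mu ne.
apply: (@single_inj _ _ _ _ (component M)); rewrite [RHS]linear0.
apply: (E1_cogenerated q_neq0 (qnumbersP q_neq0) l_gt0 gn_lt S sl la_restricted ne
  (homog_single _)) => i.
by apply: totE_component; exact: kf.
Qed.
End RestrictedObject.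

(** * The tensor product theorem *)

Section Transport.
Variables (R : realType) (V : vectType R) (Phi : root_system V) (Pi : base Phi).
Variables (K : fieldType) (q : K) (M : EFspace Pi K) (MX : in_X q M).
Local Notation X := (weight Phi).
Local Notation I := 'I_(rank Pi).
Variables (G : graded Phi K) (g : forall mu, {linear M mu -> G mu})
  (h : forall mu, {linear G mu -> M mu}).
Hypotheses (gK : forall mu, cancel (g mu) (h mu)) (hK : forall mu, cancel (h mu) (g mu)).

Definition trE_fun mu (i : I) n (x : G mu) : G (mu + srt i *+ n) :=
  g _ (opE M mu i n (h mu x)).
Fact trE_linear mu i n : linear (@trE_fun mu i n).
Proof. by move=> c x y; rewrite /trE_fun !linearP. Qed.
HB.instance Definition _ mu i n := GRing.isLinear.Build K (G mu) (G (mu + srt i *+ n)) *:%R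
  (@trE_fun mu i n) (@trE_linear mu i n).

Definition trF_fun mu (i : I) n (x : G (mu + srt i *+ n)) : G mu :=
  g _ (opF M mu i n (h _ x)).
Fact trF_linear mu i n : linear (@trF_fun mu i n).
Proof. by move=> c x y; rewrite /trF_fun !linearP. Qed.
HB.instance Definition _ mu i n := GRing.isLinear.Build K (G (mu + srt i *+ n)) (G mu) *:%R
  (@trF_fun mu i n) (@trF_linear mu i n).

Definition trE : E_ops Pi G := fun mu i n => @trE_fun mu i n.
Definition trF : F_ops Pi G := fun mu i n => @trF_fun mu i n.
Local Notation N := (EFSpace trE trF).

Lemma tr_regrade mu nu (x : G mu) :
  h nu (@regrade _ _ _ _ G mu nu x) = @regrade _ _ _ _ (component M) mu nu (h mu x).
Proof.
have [e|ne] := eqVneq mu nu; first by case: _ / e; rewrite !regrade_id.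
by rewrite !regrade_ne // linear0.
Qed.

Lemma h_inj mu : injective (h mu). Proof. exact: can_inj (@hK mu). Qed.

Lemma h_opE mu i n (x : N mu) : h _ (opE N mu i n x) = opE M mu i n (h mu x).
Proof. exact: gK. Qed.

Lemma h_opF mu i n (x : N (mu + srt i *+ n)) : h _ (opF N mu i n x) = opF M mu i n (h _ x).
Proof. exact: gK. Qed.

Lemma tr_in_X : in_X q N.
Proof.
have [[E0 F0] [qb fd] X2 X3] := MX; split.
- split=> mu i x; apply: h_inj; first by rewrite h_opE E0 tr_regrade.
  by rewrite h_opF F0 tr_regrade.
- split=> mu.
    apply: sub_finite_set (qb mu) => nu /= [[x x0] le]; split=> //.
    by exists (h nu x); apply: contraNneq x0 => z; apply/eqP/h_inj; rewrite z linear0.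
  have [s sE] := fd mu; exists [seq g mu x | x <- s] => w.
  have [c cE] := sE (h mu w); have sz : size [seq g mu x | x <- s] = size s by rewrite size_map.
  exists (fun i => c (cast_ord sz i)); rewrite -[LHS]hK cE linear_sum.
  rewrite (reindex (cast_ord (esym sz))) /=; last first.
    exists (cast_ord sz) => i _; first exact: cast_ordKV.
    exact: cast_ordK.
  apply: eq_bigr => i _; rewrite cast_ordKV linearZ /=; congr (_ *: _).
  by rewrite (nth_map 0).
- move=> mu i j m n m0 n0; have [h1 h2] := X2 mu i j m n m0 n0; split.
    move=> ij x; apply: h_inj.
    by rewrite h_opE !h_opF h1 // tr_regrade h_opE.
  move=> x; apply: h_inj; rewrite h_opE h_opF.
  have [_ e] := X2 mu i i m n m0 n0; rewrite e linear_sum; apply: eq_bigr => r _.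
  by rewrite [RHS]linearZ /= gK tr_regrade h_opE.
move=> mu; have [x1 x2] := X3 mu; split=> x.
  have [k [f [kk [L [w fE]] xE]]] := x1 (h mu x); exists (g mu k), (g mu f); split.
  - by move=> i n n0; apply: h_inj; rewrite h_opE gK kk // linear0.
  - exists L, (fun i n => g _ (w i n)); apply: h_inj; rewrite gK fE linear_sum.
    apply: eq_bigr => i _; rewrite linear_sum; apply: eq_bigr => n _.
    by rewrite /= gK [h _ (g _ _)]gK.
  - by apply: h_inj; rewrite linearD /= !gK.
move=> kx [L [w xE]]; apply: h_inj; rewrite linear0; apply: x2.
  by move=> i n n0; rewrite -h_opE kx // linear0.
exists L, (fun i n => h _ (w i n)); rewrite xE linear_sum; apply: eq_bigr => i _.
by rewrite linear_sum; apply: eq_bigr => n _; exact: h_opF.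
Qed.

Lemma tr_isomorphic : isomorphic N M.
Proof.
exists h; split; first by split=> mu i n x; [exact: h_opE|exact: h_opF].
by move=> mu; exists (g mu); [exact: hK|exact: gK].
Qed.
End Transport.

Section GradedTensor.
Variables (R : realType) (V : vectType R) (Phi : root_system V).
Variables (K : fieldType) (M N : graded Phi K).
Local Notation X := (weight Phi).
Local Notation TT := (tensor (tot M) (tot N)).

(** In degree [mu], a tensor of the two total spaces has only finitely many
    components, although infinitely many pairs of weights add up to [mu]. *)
Fact components_finite (mu : X) (y : TT) :
  finite_set [set p : {p : X * X | p.1 + p.2 == mu} |
    tmap (@ev _ _ _ _ M (val p).1) (@ev _ _ _ _ N (val p).2) y != 0].
Proof.
apply: (tens_ind (P := fun y => finite_set [set p : {p : X * X | p.1 + p.2 == mu} |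
    tmap (@ev _ _ _ _ M (val p).1) (@ev _ _ _ _ N (val p).2) y != 0])).
  split=> [|c x z fx fz].
    rewrite (_ : [set p | _] = set0) //; apply/seteqP; split=> p //=.
    by rewrite linear0 eqxx.
  apply: (@sub_finite_set _ _ ([set p : {p : X * X | p.1 + p.2 == mu} |
      tmap (@ev _ _ _ _ M (val p).1) (@ev _ _ _ _ N (val p).2) x != 0] `|`
    [set p : {p : X * X | p.1 + p.2 == mu} |
      tmap (@ev _ _ _ _ M (val p).1) (@ev _ _ _ _ N (val p).2) z != 0])).
    move=> p /= h; have [e|] := eqVneq (tmap (ev (val p).1) (ev (val p).2) x) 0.
      by right; move: h; rewrite (linearP (tmap _ _)) /= e scaler0 add0r.
    by left.
  by rewrite finite_setU; split.
move=> a b; pose D := [set nu | dsval a nu != 0] `*` [set nu | dsval b nu != 0].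
apply: (@sub_finite_set _ _ (val @^-1` D)).
  move=> p /= h; split=> /=; apply: contraNneq h => z.
    by rewrite tmapE [X in tens X _]z tens0l.
  by rewrite tmapE [X in tens _ X]z tens0r.
apply: finite_preimage; first by move=> p1 p2 _ _; exact: val_inj.
by apply: finite_setX; exact: dsvalP.
Qed.

Definition components (mu : X) (y : TT) : graded_tensor M N mu :=
  Dirsum (components_finite mu y).

Fact components_linear mu : linear (components mu).
Proof. by move=> c x y; apply: dirsum_ext => p /=; rewrite linearP. Qed.
HB.instance Definition _ mu := GRing.isLinear.Build K TT (graded_tensor M N mu) *:%R
  (components mu) (@components_linear mu).

Definition include (nu nu' : X) : {linear tensor (M nu) (N nu') -> TT} :=
  tmap (@single _ _ _ _ M nu) (@single _ _ _ _ N nu').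

Lemma tensor_expand (y : TT) : exists s : seq (X * X),
  uniq s /\ y = \sum_(p <- s) include p.1 p.2 (tmap (ev p.1) (ev p.2) y).
Proof.
have [s us sE] := tot_expand [seq p.1 | p <- repr y].
have [t ut tE] := tot_expand [seq p.2 | p <- repr y].
exists [seq (nu, nu') | nu <- s, nu' <- t]; split.
  by apply: allpairs_uniq => // -[a b] [c d].
rewrite {1}[y]tensor_sum.
have cE p : tmap (ev p.1) (ev p.2) y =
    \sum_(z <- repr y) tens (ev p.1 z.1 : M p.1) (ev p.2 z.2 : N p.2).
  by rewrite {1}[y]tensor_sum linear_sum; apply: eq_bigr => z _; exact: tmapE.
under [RHS]eq_bigr => p _ do rewrite cE linear_sum.
rewrite exchange_big big_seq [RHS]big_seq; apply: eq_bigr => z zy.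
rewrite big_allpairs_dep {1}(sE z.1 (map_f fst zy)) tens_suml; apply: eq_bigr => nu _.
rewrite {1}(tE z.2 (map_f snd zy)) tens_sumr; apply: eq_bigr => nu' _.
by rewrite /= tmapE.
Qed.

Lemma ev_include nu nu' x : tmap (ev nu) (ev nu') (include nu nu' x) = x.
Proof.
apply: (tens_ind (P := fun x => tmap (ev nu) (ev nu') (include nu nu' x) = x)).
  exact: (subspace_eq (tmap (ev nu) (ev nu') \o include nu nu') idfun).
by move=> a b; rewrite !tmapE [X in tens X _]ev_single [X in tens _ X]ev_single.
Qed.

Lemma ev_include_ne nu nu' la la' (x : tensor (M nu) (N nu')) : (nu, nu') != (la, la') ->
  tmap (ev la) (ev la') (include nu nu' x) = 0 :> tensor (M la) (N la').
Proof.
move=> ne; apply: (tens_ind (P := fun x =>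
    tmap (ev la) (ev la') (include nu nu' x) = 0 :> tensor (M la) (N la'))).
  exact: (subspace_eq (tmap (ev la) (ev la') \o include nu nu') \0).
move=> a b; rewrite !tmapE; have [e|ne1] := eqVneq nu la; last first.
  by rewrite [X in tens X _]ev_single_ne // tens0l.
have ne2 : nu' != la' by apply: contraNneq ne => ->; rewrite e.
by rewrite [X in tens _ X]ev_single_ne // tens0r.
Qed.

Lemma components_onto mu (t : graded_tensor M N mu) :
  exists s : seq {p : X * X | p.1 + p.2 == mu},
  components mu (\sum_(p <- s) include (val p).1 (val p).2 (t p)) = t.
Proof.
have [s sE] := (finite_seqP _).1 (dsvalP t).
exists (undup s); apply: dirsum_ext => p' /=; rewrite linear_sum /=.
have zero (p : {p : X * X | p.1 + p.2 == mu}) : p != p' ->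
    tmap (ev (val p').1) (ev (val p').2) (include (val p).1 (val p).2 (t p)) =
    0 :> tensor (M (val p').1) (N (val p').2).
  move=> ne; apply: ev_include_ne; apply: contra_neq ne => e; apply: val_inj.
  by move: e; case: (val p) => a b; case: (val p') => a' b' /= [-> ->].
have [ps|ps] := boolP (p' \in s); last first.
  have -> : t p' = 0.
    apply/eqP/negPn/negP => nz; case/negP: ps.
    by have : [set` s] p' by rewrite -sE.
  rewrite big_seq big1 // => p; rewrite mem_undup => pin; apply: zero.
  by apply: contraNneq ps => <-.
rewrite (bigD1_seq p') ?mem_undup ?undup_uniq //= big1 ?addr0 => [|p ne].
  exact: ev_include.
exact: zero.
Qed.
End GradedTensor.

Section TensorComponents.
Variables (R : realType) (V : vectType R) (Phi : root_system V) (Pi : base Phi).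
Variables (K : fieldType) (M N : EFspace Pi K).
Local Notation X := (weight Phi).
Local Notation A := (tot_mod M).
Local Notation B := (tot_mod N).

Lemma include_wt nu nu' (x : tensor (M nu) (N nu')) :
  @tensor_wt _ _ _ _ _ A B (nu + nu') (include (component M) (component N) nu nu' x).
Proof.
apply: (tens_ind (P := fun x => @tensor_wt _ _ _ _ _ A B (nu + nu')
    (include (component M) (component N) nu nu' x))).
  exact: (subspace_preim (include (component M) (component N) nu nu') (tensor_wt_sub A B _)).
by move=> a b; rewrite tmapE; apply: tensor_wt_tens; exact: homog_single.
Qed.

Lemma components_inj mu (y : tensor A B) : @tensor_wt _ _ _ _ _ A B mu y ->
  components mu y = 0 -> y = 0.
Proof.
move=> hy y0; have [s [_ ->]] := tensor_expand y; rewrite big1 // => p _.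
have [e|ne] := eqVneq (p.1 + p.2) mu.
  have pP : p.1 + p.2 == mu by exact/eqP.
  have /= -> := congr1 (fun f : graded_tensor (component M) (component N) mu =>
    f (exist _ p pP)) y0.
  by rewrite linear0.
rewrite (_ : tmap _ _ y = 0) ?linear0 //.
apply: (hy (fun y => tmap (@ev _ _ _ _ (component M) p.1) (@ev _ _ _ _ (component N) p.2) y = 0)).
  exact: (subspace_eq (tmap (@ev _ _ _ _ (component M) p.1) (@ev _ _ _ _ (component N) p.2)) \0).
move=> nu nu' a b ha hb e; rewrite tmapE; have [e1|ne1] := eqVneq p.1 nu; last first.
  by rewrite [X in tens X _]ha // tens0l.
have ne2 : p.2 != nu' by apply: contraNneq ne => ->; rewrite e1 e.
by rewrite [X in tens _ X]hb // tens0r.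
Qed.
End TensorComponents.

Theorem theoremC (R : realType) (V : vectType R) (Phi : root_system V)
    (Pi : base Phi) (Pi_simply_laced : simply_laced Pi)
    (K : fieldType) (q : K) (q_neq0 : q != 0)
    (l : nat) (l_char : quantum_char q l) (l_gt0 : (0 < l)%N)
    (q_odd : q != 1 -> q != -1 ->
       exists n : nat, odd n /\ n.-primitive_root q)
    (la0 la1 : weight Phi)
    (la0_restricted : forall i : 'I_(rank Pi), 0 <= pairing la0 i < l%:Z)
    (S0 S1 S2 : EFspace Pi K)
    (S0P : is_S q la0 S0) (S1P : is_S q (la1 *+ l) S1)
    (S2P : is_S q (la0 + la1 *+ l) S2) :
  exists (E : E_ops Pi (graded_tensor (component S0) (component S1)))
         (F : F_ops Pi (graded_tensor (component S0) (component S1))),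
    in_X q (EFSpace E F) /\ isomorphic (EFSpace E F) S2.
Proof.
have Q := qnumbersP q_neq0.
have [gnl gn_lt] : gn q l%:Z = 0 /\ forall m : nat, (0 < m < l)%N -> gn q m%:Z != 0.
  by case: l_char => [[l0]|[_ h1 h2]]; [rewrite l0 in l_gt0|split].
have [v0 H0] := tot_simple_hw q_neq0 S0P.
have [v1 H1] := tot_simple_hw q_neq0 S1P.
have [v2 H2] := tot_simple_hw q_neq0 S2P.
pose k0 (i : 'I_(rank Pi)) n : {linear tot_mod S0 -> tot_mod S0} := kop_fun q i n.
pose k1 (i : 'I_(rank Pi)) n : {linear tot_mod S1 -> tot_mod S1} := kop_fun q i n.
have k0E i n mu x : wt mu x -> k0 i n x = q ^ (n * pairing mu i) *: x by exact: kopE.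
have k1E i n mu x : wt mu x -> k1 i n x = q ^ (n * pairing mu i) *: x by exact: kopE.
pose W := tensor_mod q k0 k1; pose w : W := tens v0 v1.
have Wx : wmod_ax (gb q) W.
  exact: (tensor_ax q_neq0 Q (hw_ax H0) (hw_ax H1) Pi_simply_laced k0E k1E).
have Wb : below (la0 + la1 *+ l) W by exact: tensor_below H0 H1 _ _.
have Wc : cogenerated (la0 + la1 *+ l) W.
  apply: (tensor_cogen q_neq0 Q l_gt0 gnl gn_lt H0 H1 k0E).
  - exact: (tot_E1_killed q_neq0 l_gt0 gn_lt Pi_simply_laced H0 la0_restricted).
  - exact: (tot_prim H1).
  - exact: tot_coordinates S1P.
have hw : wt (la0 + la1 *+ l) w by exact: tensor_hwt H0 H1 _ _.
have w0 : w != 0 by exact: tensor_hw_neq0 H0 H1.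
pose U := tot_mod S2; pose Gr := @graph _ _ _ Pi K (la0 + la1 *+ l) U v2 W w.
have Gonto mu (y : W) : wt mu y -> exists x : U, Gr mu x y.
  move: mu y; apply: (tensor_ind q_neq0 Q l_gt0 gnl gn_lt Pi_simply_laced H0 H1
    la0_restricted k1E (P := fun mu (y : W) => exists x : U, Gr mu x y)).
  - move=> mu; split=> [|c y y' [x g] [x' g']]; first by exists 0; exact: graph0.
    by exists (c *: x + x'); exact: graph_lin.
  - by exists v2; exact: graph_top.
  by move=> mu i n y _ [x g]; exists (wF i n x); exact: (graph_F i n g).
have Guniq mu x y y' : Gr mu x y -> Gr mu x y' -> y = y'.
  move=> g g'; apply/eqP; rewrite -subr_eq0; apply/eqP.
  by apply: (graph_fun H2 Wx Wb Wc hw (mu := mu)); have := graphB g g'; rewrite subrr.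
(* The graph compares [S2] with the tensor product of the total spaces; its
   components give the bijection onto the graded tensor product. *)
pose Th mu (x : S2 mu) : W := sval (cid (graph_total H2 w (homog_single x))).
have ThP mu (x : S2 mu) : Gr mu (single x) (Th mu x).
  exact: svalP (cid (graph_total H2 w (homog_single x))).
have Thl mu : linear (Th mu).
  move=> c x y; apply: (Guniq mu _ _ _ (ThP mu _)); rewrite linearP.
  exact: (graph_lin c (ThP mu x) (ThP mu y)).
pose g mu (x : S2 mu) : graded_tensor (component S0) (component S1) mu :=
  components mu (Th mu x).
have gl mu : linear (g mu) by move=> c x y; rewrite /g Thl linearP.
pose gL mu : {linear S2 mu -> graded_tensor (component S0) (component S1) mu} :=
  HB.pack (g mu) (GRing.isLinear.Build _ _ _ _ _ (gl mu)).
have gi mu : injective (gL mu).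
  move=> x x' /eqP; rewrite -subr_eq0 -linearB => /eqP e.
  apply/eqP; rewrite -subr_eq0; apply/eqP.
  apply: (@single_inj _ _ _ _ (component S2)); rewrite [RHS]linear0.
  apply: (graph_inj H2 Wx Wb hw (mu := mu) w0).
  have := ThP mu (x - x'); rewrite (_ : Th mu (x - x') = 0) //.
  by apply: components_inj e; have [] := graph_wt H2 Wx hw (ThP mu (x - x')).
have gs mu (t : graded_tensor (component S0) (component S1) mu) : exists x, gL mu x = t.
  have [s <-] := components_onto t; set y := \sum_(p <- s) _.
  have hy : @wt _ _ _ _ _ W mu y.
    apply: (subspace_sum (wt_sub Wx mu)) => p _.
    by rewrite -{1}(eqP (valP p)); exact: include_wt.
  have [x gx] := Gonto _ _ hy; have [hx _] := graph_wt H2 Wx hw gx.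
  exists (ev mu x); congr (components mu _); apply: (Guniq mu x); last exact: gx.
  by rewrite {1}(homogE hx); exact: ThP.
pose h mu := sval (linear_inverse (gi mu) (gs mu)).
have hP mu : cancel (gL mu) (h mu) /\ cancel (h mu) (gL mu).
  exact: svalP (linear_inverse (gi mu) (gs mu)).
have gK mu : cancel (gL mu) (h mu) by have [] := hP mu.
have hK mu : cancel (h mu) (gL mu) by have [] := hP mu.
exists (trE gL h), (trF gL h); split; last exact: tr_isomorphic gK hK.
by have [S2X _ _ _] := S2P; exact: (tr_in_X S2X gK hK).
Qed.
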